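(* Let $G$ be a commutative multiplicative group, and let $\mathcal Y=(h\colon Y\to\mathbf P_{L/l})$ and $\mathcal X=(g\colon X\to\mathbf P_{K/k})$ be objects of $\mathrm{bir}_G$ with a proper morphism $f\colon\mathcal Y\to\mathcal X$. Let $\mathbf P$ be one of the properties: separated; affine; separated and $H$-strict, for a subgroup $H$ with $\rho(l^\times)\subseteq H\subseteq G$. Then $\mathcal Y$ satisfies $\mathbf P$ if and only if $\mathcal X$ satisfies $\mathbf P$.
   Context: Graded fields are nonzero $G$-graded rings with all nonzero homogeneous elements invertible; $F^\times$ is the group of nonzero homogeneous elements and $\rho\colon F^\times\to G$ the grading. For graded fields $k\subseteq K$, $\mathbf P_{K/k}$ is the set of graded valuation rings of $K$ containing $k$, topologized by the basis $\mathbf P_{K/k}\{f_1,\dots,f_n\}=\{\mathcal O: f_i\in\mathcal O\}$ ($f_i$ homogeneous); for a finitely generated graded $k$-subalgebra $A=k[f_1,\dots,f_n]\subseteq K$ write $\mathbf P_{K/k}\{A\}=\mathbf P_{K/k}\{f_1,\dots,f_n\}$ (an affine subset). Objects of $\mathrm{bir}_G$: $(X\to\mathbf P_{K/k})$ with $K/k$ a graded field extension and $X\to\mathbf P_{K/k}$ a local homeomorphism from a non-empty connected quasi-compact quasi-separated space. A morphism $(Y\to\mathbf P_{L/l})\to(X\to\mathbf P_{K/k})$: compatible graded embeddings $k\hookrightarrow l$, $K\hookrightarrow L$ and a continuous $Y\to X$ compatible with $\psi_{L/l,K/k}\colon\mathcal O\mapsto\mathcal O\cap K$; it is proper if $Y\to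 X\times_{\mathbf P_{K/k}}\mathbf P_{L/l}$ is bijective and $\psi_{L/l,K/k}$ is surjective. An object $(X\to\mathbf P_{K/k})$ is separated if $X\to\mathbf P_{K/k}$ is injective, and affine if it maps $X$ bijectively onto an affine subset. For a subgroup $H\supseteq\rho(k^\times)$, let $K_H=\oplus_{g\in H}K_g$; the object is $H$-strict if it admits a proper morphism (over $k$) to some object $(X_H\to\mathbf P_{K_H/k})$; a separated object, viewed as an open subset of $\mathbf P_{K/k}$, is $H$-strict iff it is the full preimage of its image in $\mathbf P_{K_H/k}$. *)

(* Defs.v *)
From HB Require Import structures.
From mathcomp Require Import all_boot all_order all_algebra.
From mathcomp Require Import all_classical topology.
Set Implicit Arguments. Unset Strict Implicit. Unset Printing Implicit Defensive.
Import GRing.Theory.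
Local Open Scope classical_set_scope.
Local Open Scope ring_scope.

Section Graded.
Variables (G : zmodType) (R : comNzRingType) (hom : G -> set R).

Definition is_decomp (x : R) (s : seq G) (c : G -> R) : Prop :=
  [/\ uniq s, (forall g, hom g (c g)) & x = \sum_(g <- s) c g].

Definition homogeneous (x : R) : Prop := exists g, hom g x.

(* R = (+)_{g in G} R_g is a G-graded ring all of whose nonzero homogeneous
   elements are invertible (a graded field; nonzero since R is a NzRing) *)
Definition graded_field : Prop :=
  [/\ forall g, hom g 0,
      forall g x y, hom g x -> hom g y -> hom g (x - y),
      hom 0 1 &
      forall g h x y, hom g x -> hom h y -> hom (g + h) (x * y)] /\
  (forall x, exists s c, is_decomp x s c) /\
  (forall s c, uniq s -> (forall g, hom g (c g)) -> \sum_(g <- s) c g = 0 ->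
         forall g, g \in s -> c g = 0) /\
  (forall g x, hom g x -> x != 0 -> exists y, x * y = 1).

Definition subring_set (S : set R) : Prop :=
  [/\ S 1, forall x y, S x -> S y -> S (x - y)
    & forall x y, S x -> S y -> S (x * y)].

Definition graded_set (S : set R) : Prop :=
  forall x s c, S x -> is_decomp x s c -> forall g, g \in s -> S (c g).

Definition graded_subfield (k : set R) : Prop :=
  [/\ subring_set k, graded_set k &
      forall x, homogeneous x -> x != 0 -> k x -> exists2 y, k y & x * y = 1].

Definition gvr (k : set R) (O : set R) : Prop :=
  [/\ subring_set O, graded_set O, k `<=` O &
      forall x, homogeneous x -> x != 0 -> O x \/ exists2 y, O y & x * y = 1].

Definition gpart (H : set G) : set R :=
  [set x | exists s c, is_decomp x s c /\ forall g, g \in s -> H g].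
End Graded.

Record gfield (G : zmodType) := GField {
  gcar : comNzRingType;
  ghom : G -> set gcar;
  gfieldP : graded_field ghom }.

Record gext (G : zmodType) := GExt {
  gtop : gfield G;
  gbase : set (gcar gtop);
  gbaseP : graded_subfield (@ghom G gtop) gbase }.
Arguments ghom {G}.
Arguments gcar {G}.
Arguments gtop {G}.
Arguments gbase {G}.

Definition gK (G : zmodType) (E : gext G) : comNzRingType := gcar (gtop E).

Definition PKk (G : zmodType) (E : gext G) : Type := {O : set (gK E) | gvr (ghom (gtop E)) (gbase E) O}.

HB.instance Definition _ (G : zmodType) (E : gext G) := gen_eqMixin (PKk E).
HB.instance Definition _ (G : zmodType) (E : gext G) := gen_choiceMixin (PKk E).

(* subbase: the sets P{f} = {O | f in O}, f homogeneous; finite intersections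
   give the basis P{f_1,...,f_n} *)
Definition Psub_dom (G : zmodType) (E : gext G) : set (option (gK E)) :=
  [set i | exists2 f, homogeneous (ghom (gtop E)) f & i = Some f].
Definition Psub (G : zmodType) (E : gext G) (i : option (gK E)) : set (PKk E) :=
  if i is Some f then [set O | sval O f] else setT.

HB.instance Definition _ (G : zmodType) (E : gext G) :=
  isSubBaseTopological.Build (PKk E) (@Psub_dom G E) (@Psub G E).

Section Top.
Variables (S T : topologicalType).
Definition local_homeo (g : S -> T) : Prop :=
  continuous g /\
  forall x, exists U : set S, [/\ open U, U x, {in U &, injective g} &
     forall V, open V -> V `<=` U -> open (g @` V)].
Definition quasi_separated : Prop :=
  forall U V : set S, open U -> compact U -> open V -> compact V -> compact (U `&` V).
End Top.

Record birobj (G : zmodType) := BirObj {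
  bsp : topologicalType;
  bext : gext G;
  bmap : bsp -> PKk bext;
  bmap_lh : local_homeo bmap;
  bsp_ne : exists x : bsp, True;
  bsp_conn : connected [set: bsp];
  bsp_qc : compact [set: bsp];
  bsp_qs : quasi_separated bsp }.
Arguments bsp {G}.
Arguments bext {G}.
Arguments bmap {G}.

Definition bK (G : zmodType) (X : birobj G) := gK (bext X).

Definition gemb (G : zmodType) (E F : gext G) (phi : {rmorphism gK E -> gK F}) : Prop :=
  injective phi /\ forall g x, ghom (gtop E) g x -> ghom (gtop F) g (phi x).

Definition bir_mor (G : zmodType) (Y X : birobj G) (phi : {rmorphism bK X -> bK Y})
    (f : bsp Y -> bsp X) : Prop :=
  [/\ gemb phi, phi @` gbase (bext X) `<=` gbase (bext Y), continuous f &
      forall y, sval (bmap X (f y)) = phi @^-1` sval (bmap Y y)].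

Definition proper_mor (G : zmodType) (Y X : birobj G) (phi : {rmorphism bK X -> bK Y})
    (f : bsp Y -> bsp X) : Prop :=
  [/\ bir_mor phi f,
      (forall (x : bsp X) (O : PKk (bext Y)), sval (bmap X x) = phi @^-1` sval O ->
          exists! y, f y = x /\ bmap Y y = O) &
      forall O : PKk (bext X), exists O' : PKk (bext Y), sval O = phi @^-1` sval O'].

Definition bir_separated (G : zmodType) (X : birobj G) : Prop := injective (bmap X).

Definition bir_affine (G : zmodType) (X : birobj G) : Prop :=
  injective (bmap X) /\
  exists s : seq (bK X), (forall f, f \in s -> homogeneous (ghom (gtop (bext X))) f) /\
     range (bmap X) = [set O | forall f, f \in s -> sval O f].

Definition subgroup_set (G : zmodType) (H : set G) : Prop :=
  H 0 /\ forall a b, H a -> H b -> H (a - b).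

(* X -> P_{K/k} is H-strict: it admits a proper morphism over k to some object
   Z -> P_{K_H/k}; Z's field extension is identified with K_H/k via a graded
   embedding phi with image K_H mapping Z's base field onto k *)
Definition Hstrict (G : zmodType) (H : set G) (X : birobj G) : Prop :=
  exists (Z : birobj G) (phi : {rmorphism bK Z -> bK X}) (f : bsp X -> bsp Z),
    [/\ proper_mor phi f,
        range phi = gpart (ghom (gtop (bext X))) H &
        phi @` gbase (bext Z) = gbase (bext X)].

Definition degs_in (G : zmodType) (E : gext G) (H : set G) : Prop :=
  forall g x, gbase E x -> ghom (gtop E) g x -> x != 0 -> H g.

(* Main.v *)
(* For a proper morphism Y is the full preimage of X under the surjection
   psi : P_{L/l} -> P_{K/k}, which makes separatedness and the passage from X to Y easy.

   Affinity of X. Let U be the image of X and let P_{L/l}{h_1, ..., h_m} be that of Y.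
   By compactness only finitely many elements of l matter, and one adjoins them to k one
   at a time. Take O minimal in P_{K/k} and O' over it containing l: since the residue
   field of O is algebraic over k, an element t of l transcendental over k stays
   transcendental over K and O' is a Gauss valuation on K(t), so that the pair K(t)/k(t)
   inherits such an O'. When l is algebraic over k, h_i lies in every extension of every
   O in U, so by Gauss's lemma the coefficients of its minimal polynomial lie in all O in U;
   for the step from K(t)/k(t) to K/k one writes an element as w / D with D in k[t] and
   w in K[t], and Gauss extensions show that the coefficients of w lie in all O in U.
   The finitely many coefficients obtained define U.

   Strictness. A separated object is H-strict iff its image in P_{K/k} is saturated for
   the restriction to K_H; this image is then open in P_{K_H/k} by compactness.
   Saturation descends because valuation rings of K and of L_H that agree on K_H have a
   common extension to L. *)
Require Import Defs.
From HB Require Import structures.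
From mathcomp Require Import all_boot all_order all_algebra.
From mathcomp Require Import all_classical topology.
From mathcomp Require Import ring zify.
Set Implicit Arguments. Unset Strict Implicit. Unset Printing Implicit Defensive.
Import GRing.Theory.
Local Open Scope classical_set_scope.
Local Open Scope ring_scope.

(** A graded field may have zero divisors among its nonhomogeneous elements, so all arguments are
    run on homogeneous elements: the variable of a polynomial carries a degree, and sums are formed
    within one degree.

    The affine case takes place inside L. The fields k and K become subsets of L, and an open subset
    of P_{K/k} becomes a predicate on valuation rings V of L that depends only on the trace of V on
    K. The pair k, K can then absorb elements of l while the predicate and the chosen O' stay the
    same.

    The residue field of a minimal O is algebraic over k because a residue transcendental over k
    could be used to compose O with a valuation of its residue field, giving a smaller ring. In the
    proof this appears as integrality over the ring k + m, where m is the maximal ideal of O',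
    tested on valuation rings by Chevalley's theorem.

    Compactness comes from ultrafilters: the elements lying in almost all rings of a family of
    valuation rings form a valuation ring again. *)

Record graded_units (G : zmodType) (R : comUnitRingType) (hom : G -> set R) : Prop :=
  GradedUnits {
    hom0 : forall g, hom g 0;
    homB : forall g x y, hom g x -> hom g y -> hom g (x - y);
    hom1 : hom 0 1;
    homM : forall g h x y, hom g x -> hom h y -> hom (g + h) (x * y);
    homU : forall g x, hom g x -> x != 0 -> x \is a GRing.unit;
    homV : forall g x, hom g x -> x != 0 -> hom (- g) x^-1;
    homI : forall g h x, hom g x -> hom h x -> x != 0 -> g = h }.

(** * Graded rings through their homogeneous elements *)

Section HomogeneousSets.
Variables (G : zmodType) (R : comUnitRingType) (hom : G -> set R).
Hypothesis gr : graded_units hom.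

Local Notation homg := (homogeneous hom).

(* A graded subring (ideal, subfield, valuation ring) is represented by the set of
   its homogeneous elements, so sums are only formed within one degree. *)
Definition hadd (A : set R) : Prop :=
  A 0 /\ forall g x y, A x -> A y -> hom g x -> hom g y -> A (x - y).

Definition hring (A : set R) : Prop :=
  [/\ A `<=` homg, A 1, forall x y, A x -> A y -> A (x * y) & hadd A].

Definition hideal (B J : set R) : Prop :=
  [/\ J `<=` B, hadd J, forall b x, B b -> J x -> J (b * x) & ~ J 1].

Definition hfield (K : set R) : Prop :=
  hring K /\ forall x, K x -> x != 0 -> K x^-1.

Definition hval (V : set R) : Prop :=
  hring V /\ forall x, homg x -> x != 0 -> V x \/ V x^-1.

(** The nonunits of [V]. The guard keeps [0] among them, since [0^-1] is [0] and belongs to [V]. *)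
Definition maxid (V : set R) : set R :=
  [set x | V x /\ (x != 0 -> ~ V x^-1)].

Lemma haddN A : hadd A -> forall g x, A x -> hom g x -> A (- x).
Proof. by move=> [A0 AB] g x Ax hx; rewrite -sub0r; apply: AB hx => //; apply: hom0. Qed.

Lemma homN g x : hom g x -> hom g (- x).
Proof. by move=> h; rewrite -sub0r; apply: homB => //; apply: hom0. Qed.

Lemma homD g x y : hom g x -> hom g y -> hom g (x + y).
Proof. by move=> hx hy; rewrite -[y]opprK; apply: homB => //; apply: homN. Qed.

Lemma hom_hadd g : hadd (hom g).
Proof.
split=> [|h x y gx gy _ _]; [exact: hom0 | exact: homB].
Qed.

Lemma haddD A : hadd A ->
  forall g x y, A x -> A y -> hom g x -> hom g y -> A (x + y).
Proof.
move=> AA g x y Ax Ay hx hy; rewrite -[y]opprK.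
by apply: (proj2 AA g) => //; [apply: haddN hy | apply: homN].
Qed.

Lemma hadd_sum A d (I : Type) {s : seq I} (P : pred I) (F : I -> R) : hadd A ->
  (forall i, P i -> A (F i) /\ hom d (F i)) -> A (\sum_(i <- s | P i) F i).
Proof.
move=> AA H; suff [] : A (\sum_(i <- s | P i) F i) /\ hom d (\sum_(i <- s | P i) F i) by [].
elim/big_rec: _ => [|i x Pi [Ax hx]]; first by split; [case: AA | apply: hom0].
have [AF hF] := H i Pi.
by split; [apply: (haddD AA AF Ax hF) | apply: homD].
Qed.

Lemma hom_sum d (I : Type) {s : seq I} (P : pred I) (F : I -> R) :
  (forall i, P i -> hom d (F i)) -> hom d (\sum_(i <- s | P i) F i).
Proof. by move=> H; apply: (@hadd_sum (hom d) d) => [|i /H]; first exact: hom_hadd. Qed.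

Lemma homX g x n : hom g x -> hom (g *+ n) (x ^+ n).
Proof.
move=> hx; elim: n => [|n IH]; first by rewrite mulr0n expr0; apply: hom1.
by rewrite mulrS exprS; apply: homM.
Qed.

Lemma hring_hadd A : hring A -> hadd A. Proof. by case. Qed.

Lemma hringX A : hring A -> forall x n, A x -> A (x ^+ n).
Proof.
move=> [_ A1 AM _] x n Ax; elim: n => [|n IH]; first by rewrite expr0.
by rewrite exprS; apply: AM.
Qed.

Lemma homg_hring : hring homg.
Proof.
split=> //; first by exists 0; apply: hom1.
- by move=> x y [g hx] [h hy]; exists (g + h); apply: homM.
- split=> [|g x y _ _ hx hy]; first by exists 0; apply: hom0.
  by exists g; apply: homB.
Qed.

Lemma homgV x : homg x -> x != 0 -> homg x^-1.
Proof. by move=> [g hx] x0; exists (- g); apply: homV. Qed.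

Lemma homgU x : homg x -> x != 0 -> x \is a GRing.unit.
Proof. by move=> [g hx] x0; apply: homU hx x0. Qed.

Lemma unit_neq0 (x : R) : x \is a GRing.unit -> x != 0.
Proof. by apply: contraTneq => ->; rewrite unitr0. Qed.

Lemma homg_neq0V x : homg x -> x != 0 -> x^-1 != 0.
Proof. by move=> hx x0; rewrite unit_neq0 // unitrV (homgU hx). Qed.

Lemma homg_mul_neq0 x y : homg x -> homg y -> x != 0 -> y != 0 -> x * y != 0.
Proof.
by move=> hx hy x0 y0; rewrite unit_neq0 // unitrM !homgU.
Qed.

Lemma homgX_neq0 x n : homg x -> x != 0 -> x ^+ n != 0.
Proof.
by move=> hx x0; rewrite unit_neq0 // unitrX // homgU.
Qed.

(* [p] is homogeneous of degree [d] when its variable has degree [g]. *)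
Definition hpoly (A : set R) (g d : G) (p : {poly R}) : Prop :=
  forall i, A p`_i /\ hom (d - g *+ i) p`_i.

Lemma hp_sub A B g d p : A `<=` B -> hpoly A g d p -> hpoly B g d p.
Proof. by move=> AB H i; have [/AB ? ?] := H i. Qed.

Lemma hp0 A g d : A 0 -> hpoly A g d 0.
Proof. by move=> A0 i; rewrite coef0; split=> //; apply: hom0. Qed.

Lemma hpB A g d p q : hadd A -> hpoly A g d p -> hpoly A g d q -> hpoly A g d (p - q).
Proof.
move=> AA hP hQ i; have [Ap hpi] := hP i; have [Aq hqi] := hQ i.
by rewrite coefB; split; [apply: (proj2 AA) hpi hqi | apply: homB].
Qed.

Lemma hpD A g d p q : hadd A -> hpoly A g d p -> hpoly A g d q -> hpoly A g d (p + q).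
Proof.
move=> AA hP hQ i; have [Ap hpi] := hP i; have [Aq hqi] := hQ i.
by rewrite coefD; split; [apply: (haddD AA) hpi hqi | apply: homD].
Qed.

Lemma hpM A B C g d e p q : hadd C -> (forall a b, A a -> B b -> C (a * b)) ->
  hpoly A g d p -> hpoly B g e q -> hpoly C g (d + e) (p * q).
Proof.
move=> CC AB hP hQ i; rewrite coefM.
have hF (j : 'I_i.+1) : C (p`_j * q`_(i - j)) /\
    hom (d + e - g *+ i) (p`_j * q`_(i - j)).
  have [Ap hpi] := hP j; have [Aq hqi] := hQ (i - j)%N; split; first exact: AB.
  have -> : d + e - g *+ i = (d - g *+ j) + (e - g *+ (i - j)).
    rewrite addrACA -opprD -mulrnDr subnKC //.
    by case: j {Ap hpi Aq hqi}.
  exact: homM.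
split; first exact: (hadd_sum (d := d + e - g *+ i)).
by apply: hom_sum => j _; have [] := hF j.
Qed.

Lemma hpMr A g d e p q : hring A -> hpoly A g d p -> hpoly A g e q ->
  hpoly A g (d + e) (p * q).
Proof. by move=> [_ _ AM AA]; apply: hpM. Qed.

Lemma hpZXn A g e c n : hadd A -> A c -> hom e c -> hpoly A g (e + g *+ n) (c *: 'X^n).
Proof.
move=> [A0 _] Ac hc i; rewrite coefZ coefXn; case: eqP => [->|_].
  by rewrite mulr1 addrK.
by rewrite mulr0; split=> //; apply: hom0.
Qed.

Lemma hpC A g d c : hadd A -> A c -> hom d c -> hpoly A g d c%:P.
Proof.
by move=> AA Ac hc; have := hpZXn g 0 AA Ac hc; rewrite mulr0n addr0 alg_polyC.
Qed.

Lemma hpXn A g n : hring A -> hpoly A g (g *+ n) 'X^n.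
Proof.
move=> [_ A1 _ AA]; have := hpZXn g n AA A1 (hom1 gr).
by rewrite scale1r add0r.
Qed.

Lemma hpX A g : hring A -> hpoly A g g 'X.
Proof. by move=> AA; have := hpXn g 1 AA; rewrite mulr1n expr1. Qed.

Lemma hp_horner A V g d p x : hring V -> A `<=` V -> hom g x -> V x ->
  hpoly A g d p -> V p.[x] /\ hom d p.[x].
Proof.
move=> VV AV hx Vx hP; rewrite horner_coef.
have hF (i : 'I_(size p)) : V (p`_i * x ^+ i) /\ hom d (p`_i * x ^+ i).
  have [/AV Ap hpi] := hP i; split.
    by case: (VV) => _ _ + _; apply=> //; apply: hringX.
  by rewrite -[d](subrK (g *+ i)); apply: homM => //; apply: homX.
split; first by apply: (hadd_sum (d := d) (hring_hadd VV)).
by apply: hom_sum => i _; have [] := hF i.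
Qed.

Lemma hp_hom A g d p x : hom g x -> hpoly A g d p -> hom d p.[x].
Proof.
move=> hx hP; have hP' : hpoly homg g d p.
  by move=> i; have [_ h] := hP i; split=> //; exists (d - g *+ i).
by have [] := hp_horner homg_hring (@subset_refl _ _) hx (ex_intro _ g hx) hP'.
Qed.

(** * Simple ring extensions and Chevalley's extension theorem *)

(** The homogeneous elements of A[x] when [J] is a ring A, and those of the extended ideal J B[x]
    when [J] is an ideal of a ring B. *)
Definition adjoin (J : set R) g x : set R :=
  [set y | exists d p, hpoly J g d p /\ y = p.[x]].

Lemma adj_hadd J g x : hadd J -> hom g x -> hadd (adjoin J g x).
Proof.
move=> JJ hx; split.
  by exists 0, 0; rewrite horner0; split=> //; apply: hp0; case: JJ.
move=> e _ _ [d [p [hP ->]]] [d' [q [hQ ->]]] hpe hqe.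
(* A zero value has every degree, so [d] and [d'] can be identified with [e] only for nonzero
   values. *)
have [p0|p0] := eqVneq p.[x] 0.
  exists d', (- q); rewrite p0 sub0r hornerN; split=> //.
  by rewrite -sub0r; apply: hpB => //; apply: hp0; case: JJ.
have [q0|q0] := eqVneq q.[x] 0.
  by exists d, p; rewrite q0 subr0.
have ed : d = e by apply: (homI gr (hp_hom hx hP)).
have ed' : d' = e by apply: (homI gr (hp_hom hx hQ)).
subst d d'; exists e, (p - q); rewrite hornerD hornerN; split=> //.
exact: hpB.
Qed.

Lemma adj_mul A B C g x : hadd C -> (forall a b, A a -> B b -> C (a * b)) ->
  forall y z, adjoin A g x y -> adjoin B g x z -> adjoin C g x (y * z).
Proof.
move=> CC AB _ _ [d [p [hP ->]]] [e [q [hQ ->]]].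
by exists (d + e), (p * q); rewrite hornerM; split=> //; apply: hpM hP hQ.
Qed.

Lemma adj_sub A g x : A `<=` homg -> hadd A -> A `<=` adjoin A g x.
Proof.
move=> Ah AA a Aa; have [d hd] := Ah _ Aa.
by exists d, a%:P; rewrite hornerC; split=> //; apply: hpC.
Qed.

Lemma adj_gen A g x : hring A -> adjoin A g x x.
Proof. by move=> AA; exists g, 'X; rewrite hornerX; split=> //; apply: hpX. Qed.

Lemma adj_hring A g x : hring A -> hom g x -> hring (adjoin A g x).
Proof.
move=> AA hx; have [Ah A1 AM A0] := AA; split.
- by move=> _ [d [p [hP ->]]]; exists d; apply: hp_hom hP.
- exact: adj_sub.
- exact: adj_mul.
- exact: adj_hadd.
Qed.

(* A maximal pair (B, J) dominating (A, I) is a valuation ring with its maximal ideal. *)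
Definition dominates (A I : set R) (P : set R * set R) : Prop :=
  [/\ hring P.1, hideal P.1 P.2, A `<=` P.1 & I `<=` P.2].

(** Zorn's lemma for the componentwise order. Ring and ideal grow together, so that maximality can
    be tested against [B[y]] with the ideal generated by [J] in it. *)
Lemma maximal_pair A I : hring A -> hideal A I ->
  exists P, dominates A I P /\
    forall Q, dominates A I Q -> P.1 `<=` Q.1 -> P.2 `<=` Q.2 ->
      Q.1 `<=` P.1 /\ Q.2 `<=` P.2.
Proof.
move=> AA II; have dAI : dominates A I (A, I) by split.
pose T := {P | dominates A I P}.
pose r (P Q : T) := `[< (sval P).1 `<=` (sval Q).1 /\ (sval P).2 `<=` (sval Q).2 >].
have [||C tC|P mP] := @ZL_preorder T (exist _ _ dAI) r.
- by move=> P; apply/asboolP; split.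
- move=> P Q S /asboolP[PQ PQ'] /asboolP[QS QS']; apply/asboolP.
  by split; [apply: subset_trans QS | apply: subset_trans QS'].
- have [[P0 CP0]|nC] := pselect (exists P, C P); last first.
    by exists (exist _ _ dAI) => P CP; case: nC; exists P.
  pose B := [set x | exists2 P, C P & (sval P).1 x].
  pose J := [set x | exists2 P, C P & (sval P).2 x].
  have two (P Q : T) : C P -> C Q ->
      exists2 S, C S & [/\ (sval P).1 `<=` (sval S).1, (sval P).2 `<=` (sval S).2,
         (sval Q).1 `<=` (sval S).1 & (sval Q).2 `<=` (sval S).2].
    move=> CP CQ; have [/asboolP[? ?]|/asboolP[? ?]] := tC _ _ CP CQ.
    - by exists Q => //; split.
    - by exists P => //; split.
  have dBJ : dominates A I (B, J).
    split=> /=.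
    - split.
      + by move=> x [P _]; case: (svalP P) => [[h _ _ _] _ _ _]; apply: h.
      + by exists P0 => //; case: (svalP P0) => [[]].
      + move=> x y [P CP Px] [Q CQ Qy]; have [S CS [i1 _ i2 _]] := two _ _ CP CQ.
        exists S => //; case: (svalP S) => [[_ _ h _] _ _ _].
        by apply: h; [apply: i1 | apply: i2].
      + split; first by exists P0 => //; case: (svalP P0) => [[_ _ _ []]].
        move=> g x y [P CP Px] [Q CQ Qy] hx hy.
        have [S CS [i1 _ i2 _]] := two _ _ CP CQ.
        exists S => //; case: (svalP S) => [[_ _ _ [_ h]] _ _ _].
        by apply: h hx hy; [apply: i1 | apply: i2].
    - split.
      + move=> x [P CP Px]; exists P => //.
        by case: (svalP P) => [_ [h _ _ _] _ _]; apply: h.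
      + split; first by exists P0 => //; case: (svalP P0) => [_ [_ [? _] _ _] _ _].
        move=> g x y [P CP Px] [Q CQ Qy] hx hy.
        have [S CS [_ i1 _ i2]] := two _ _ CP CQ.
        exists S => //; case: (svalP S) => [_ [_ [_ h] _ _] _ _].
        by apply: h hx hy; [apply: i1 | apply: i2].
      + move=> x y [P CP Px] [Q CQ Qy]; have [S CS [i1 _ _ i2]] := two _ _ CP CQ.
        exists S => //; case: (svalP S) => [_ [_ _ h _] _ _].
        by apply: h; [apply: i1 | apply: i2].
      + by move=> [P CP]; case: (svalP P) => [_ []].
    - by move=> x Ax; exists P0 => //; case: (svalP P0) => [_ _ h _]; apply: h.
    - by move=> x Ix; exists P0 => //; case: (svalP P0) => [_ _ _ h]; apply: h.
  exists (exist _ _ dBJ) => P CP; apply/asboolP; split=> x Px /=; by exists P.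
exists (sval P); split; first exact: svalP.
move=> Q dQ PQ1 PQ2; have /asboolP[] : r (exist _ Q dQ) P; last by [].
by apply: mP; apply/asboolP.
Qed.

(* Since [1 - q`_0] is invertible, the shorter equation rewrites the leading
   term of the longer one; shortening repeatedly leads to [1] in [J]. *)
Lemma shorten_equations B J : hring B -> hideal B J ->
  (forall b, J b -> hom 0 b -> B (1 - b)^-1) ->
  forall N g x p q, homg x -> x != 0 -> hom g x ->
    hpoly J g 0 p -> hpoly J (- g) 0 q -> p.[x] = 1 -> q.[x^-1] = 1 ->
    (size p + size q <= N)%N -> False.
Proof.
move=> BB JJ inv1; have [JB J0 JM J1] := JJ.
have [Bh B1 BM B0] := BB.
elim=> [|N IH] g x p q hgx x0 hx hP hQ px qx.
  rewrite leqn0 addn_eq0 => /andP[]; rewrite size_poly_eq0 => /eqP p0 _.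
  by move: px; rewrite p0 horner0 => /eqP; rewrite eq_sym oner_eq0.
wlog le_qp : g x p q hgx x0 hx hP hQ px qx / (size q <= size p)%N => [th|].
  have [le|/ltnW le] := leqP (size q) (size p); first by move=> ?; apply: (th g x p q).
  rewrite addnC; apply: (th (- g) x^-1 q p) => //; rewrite ?invrK ?opprK //.
  - exact: homgV.
  - exact: homg_neq0V.
  - exact: homV.
move=> leN.
have sq : (0 < size q)%N.
  rewrite lt0n size_poly_eq0; apply/eqP => q0.
  by move: qx; rewrite q0 horner0 => /eqP; rewrite eq_sym oner_eq0.
set n := (size p).-1; set m := (size q).-1.
have sp : (0 < size p)%N by apply: leq_trans le_qp.
have [Jq0 hq0] := hQ 0; rewrite mulr0n subr0 in hq0.
set u := 1 - q`_0; have Bu := inv1 _ Jq0 hq0; rewrite -/u in Bu.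
have hu : hom 0 u by apply: homB => //; apply: hom1.
have u0 : u != 0.
  by apply/eqP => /subr0_eq e; apply: J1; rewrite e.
have Uu : u \is a GRing.unit by apply: homU hu u0.
have Ux : x \is a GRing.unit by apply: homgU.
(* The equation for [x^-1] is multiplied by [x ^+ m], its constant term is moved to the left, and
   the unit [u] is divided out. *)
have xm : x ^+ m = \sum_(i < m) (u^-1 * q`_i.+1) * x ^+ (m - i.+1).
  apply: (mulrI Uu); rewrite mulr_sumr.
  have : 1 = q`_0 + \sum_(i < m) q`_i.+1 * x^-1 ^+ i.+1.
    rewrite -{1}qx horner_coef -(prednK sq) big_ord_recl expr0 mulr1; congr (_ + _).
  move/eqP; rewrite addrC -subr_eq -/u => /eqP e.
  rewrite [in LHS]e mulr_suml; apply: eq_bigr => i _.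
  rewrite !mulrA mulrV // mul1r -mulrA; congr (_ * _).
  by rewrite exprVn -[in x ^+ m](subnKC (ltn_ord i)) exprD mulrA mulVr ?mul1r // unitrX.
pose r : {poly R} := \sum_(i < m) (u^-1 * q`_i.+1) *: 'X^(m - i.+1).
have rx : r.[x] = x ^+ m.
  rewrite xm horner_sum; apply: eq_bigr => i _.
  by rewrite hornerZ hornerXn.
have mn : (m <= n)%N by rewrite /m /n; lia.
have [Jpn hpn] := hP n.
have hr : hpoly B g (g *+ m) r.
  move=> i; rewrite /r coef_sum.
  have hF (j : 'I_m) : B (((u^-1 * q`_j.+1) *: 'X^(m - j.+1))`_i) /\
      hom (g *+ m - g *+ i) (((u^-1 * q`_j.+1) *: 'X^(m - j.+1))`_i).
    have [Jq hq] := hQ j.+1.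
    rewrite coefZ coefXn; case: eqP => [->|_]; last first.
      by rewrite mulr0; split; [case: B0 | apply: hom0].
    rewrite mulr1; split; first by apply: BM => //; apply: JB.
    have -> : g *+ m - g *+ (m - j.+1) = - 0 + (0 - - g *+ j.+1).
      rewrite oppr0 add0r sub0r mulNrn opprK -[in g *+ m](subnKC (ltn_ord j)).
      by rewrite mulrnDr addrK.
    by apply: homM => //; apply: homV.
  split; first exact: (hadd_sum (d := g *+ m - g *+ i)).
  by apply: hom_sum => j _; have [] := hF j.
(* The leading term of [p] gives way to [x ^+ (n - m)] times the expression [r] of [x ^+ m] by lower
   powers. Its coefficient is in [J], hence so are the new coefficients. *)
pose p' := p - p`_n *: 'X^n + (p`_n *: 'X^(n - m)) * r.
have hP' : hpoly J g 0 p'.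
  apply: hpD => //.
    apply: hpB => //; have := hpZXn g n J0 Jpn hpn.
    by rewrite subrK.
  have -> : 0 = (0 - g *+ n + g *+ (n - m)) + g *+ m.
    by rewrite -addrA -mulrnDr subnK // subrK.
  apply: (hpM (A := J) (B := B)) hr => //; first by move=> a b Ja Bb; rewrite mulrC; apply: JM.
  exact: hpZXn.
have p'x : p'.[x] = 1.
  by rewrite hornerD hornerM !hornerD hornerN !hornerZ !hornerXn rx px -mulrA -exprD subnK // subrK.
have sp' : (size p' <= n)%N.
  apply/leq_sizeP => j nj; rewrite /p' coefD coefB coefZ coefXn -scalerAl coefZ coefXnM.
  move: nj; rewrite leq_eqVlt => /orP[/eqP<-|nj].
    rewrite eqxx mulr1 subrr add0r.
    case: ltnP => _; rewrite ?mulr0 //.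
    rewrite /r coef_sum big1 ?mulr0 // => i _; rewrite coefZ coefXn.
    case: eqP; rewrite ?mulr0 // => e; have := ltn_ord i; lia.
  rewrite gtn_eqF // mulr0 subr0.
  have -> : p`_j = 0 by apply: nth_default; apply: leq_trans (leqSpred _) nj.
  rewrite add0r; case: ltnP => _; rewrite ?mulr0 //.
  rewrite /r coef_sum big1 ?mulr0 // => i _; rewrite coefZ coefXn.
  case: eqP; rewrite ?mulr0 // => e; have := ltn_ord i; lia.
apply: (IH g x p' q) => //; move: leN sp'; rewrite /n; lia.
Qed.

(** For [y] outside the ring [B] of a maximal pair, adjoining [y] must make the ideal improper, so
    [1] is a polynomial in [y] with coefficients in [J]. If [x] and [x^-1] were both outside [B],
    two such equations would coexist, which [shorten_equations] excludes. *)
Lemma chevalley A I : hring A -> hideal A I ->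
  exists V, [/\ hval V, A `<=` V & I `<=` maxid V].
Proof.
move=> AA II; have [[B J] [[/= BB JJ AB IJ] mBJ]] := maximal_pair AA II.
have [JB J0 JM J1] := JJ; have [Bh B1 BM B0] := BB.
have adjP g y : hom g y -> ~ B y -> exists2 p, hpoly J g 0 p & p.[y] = 1.
  move=> hy nBy.
  have [[d [p [hP e]]]|n1] := pselect (adjoin J g y 1).
    have d0 : d = 0.
      by apply: (homI gr (x := 1)); rewrite ?oner_eq0 //; [rewrite e; apply: hp_hom hP | apply: hom1].
    by exists p => //; rewrite -d0.
  case: nBy; have [|||BB' _] := mBJ (adjoin B g y, adjoin J g y).
  - split=> /=.
    + exact: adj_hring.
    + split=> //.
      * by move=> _ [d [p [hP ->]]]; exists d, p; split=> //; apply: hp_sub hP.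
      * exact: adj_hadd.
      * exact: adj_mul.
    + by apply: subset_trans AB _; apply: adj_sub.
    + by apply: subset_trans IJ _; apply: adj_sub => //; apply: subset_trans Bh.
  - exact: adj_sub.
  - by apply: adj_sub => //; apply: subset_trans Bh.
  - by apply: BB'; apply: adj_gen.
(* [B] is local in degree 0: if the inverse of [s = 1 - b] were missing, [1 = p.[s^-1]] with [p]
   over [J], and clearing denominators puts a power of [s] into [J]; modulo [J] this power is
   [1]. *)
have inv1 b : J b -> hom 0 b -> B (1 - b)^-1.
  move=> Jb hb; apply: contrapT => nB; set s := 1 - b in nB.
  have hs : hom 0 s by apply: homB => //; apply: hom1.
  have s0 : s != 0 by apply/eqP => /subr0_eq e; apply: J1; rewrite e.
  have Us := homU gr hs s0.
  have [p hP pE] := adjP _ _ (homV gr hs s0) nB.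
  have Bs : B s by apply: (proj2 B0 0) => //; [apply: JB | apply: hom1].
  have Jsn n : J (s ^+ n) -> J 1.
    elim: n => [|n IH]; first by rewrite expr0.
    rewrite exprS /s mulrBl mul1r => H; apply: IH.
    have hsn : hom 0 (s ^+ n) by have := homX n hs; rewrite mul0rn.
    have hbs : hom 0 (b * s ^+ n) by have := homM gr hb hsn; rewrite addr0.
    rewrite -[_ ^+ _](subrK (b * s ^+ n)); apply: (haddD J0 (g := 0)) => //.
    - by rewrite mulrC; apply: JM => //; apply: hringX.
    - exact: homB.
  apply: J1; apply: (Jsn (size p)); rewrite -[s ^+ _]mul1r -pE horner_coef mulr_suml.
  apply: (hadd_sum (d := 0)) => // i _; have [Jp hpi] := hP i.
  have -> : p`_i * s^-1 ^+ i * s ^+ size p = s ^+ (size p - i) * p`_i.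
    rewrite mulrC [p`_i * _]mulrC mulrA; congr (_ * _).
    by rewrite exprVn -{1}(subnK (ltnW (ltn_ord i))) exprD -mulrA mulrV ?mulr1 // unitrX.
  split; first by apply: JM => //; apply: hringX.
  have := homM gr (homX (size p - i) hs) hpi.
  by rewrite oppr0 !mul0rn !subr0 addr0.
have VB : hval B.
  split=> // x hgx x0; apply: contrapT => /not_orP[nx nxV].
  have [g hx] := hgx.
  have [p hP px] := adjP _ _ hx nx.
  have [q hQ qx] := adjP _ _ (homV gr hx x0) nxV.
  exact: (shorten_equations BB JJ inv1 hgx x0 hx hP hQ px qx (leqnn _)).
exists B; split=> // x /IJ Jx; split; first exact: JB.
move=> x0 BxV; apply: J1; rewrite -(mulVr (homgU _ x0)); last exact/Bh/JB.
exact: JM.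
Qed.

(** * Valuation rings and their maximal ideals *)

Lemma hval_hring V : hval V -> hring V. Proof. by case. Qed.

Lemma hval0 V : hval V -> V 0. Proof. by move=> [[_ _ _ []]]. Qed.

Lemma hvalM V x y : hval V -> V x -> V y -> V (x * y).
Proof. by move=> [[_ _ h _] _]; apply: h. Qed.

Lemma hval_homg V x : hval V -> V x -> homg x.
Proof. by move=> [[h _ _ _] _]; apply: h. Qed.

Lemma hval_homgT : hval homg.
Proof. by split; [exact: homg_hring | move=> x hx _; left]. Qed.

Lemma maxid0 V : hval V -> maxid V 0.
Proof. by move=> VV; split; [exact: hval0 | rewrite eqxx]. Qed.

Lemma maxidM V x y : hval V -> V x -> maxid V y -> maxid V (x * y).
Proof.
move=> VV Vx [Vy my]; split; first exact: hvalM.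
move=> xy0 Vxy; have [y0|y0] := eqVneq y 0; first by rewrite y0 mulr0 eqxx in xy0.
have [x0|x0] := eqVneq x 0; first by rewrite x0 mul0r eqxx in xy0.
apply: (my y0); have Ux := homgU (hval_homg VV Vx) x0.
have Uy := homgU (hval_homg VV Vy) y0.
have -> : y^-1 = x * (x * y)^-1 by rewrite invrM // mulrC -mulrA mulVr ?mulr1.
exact: hvalM.
Qed.

Lemma notin_hval V x : hval V -> homg x -> ~ V x -> x != 0 /\ maxid V x^-1.
Proof.
move=> VV hx nVx; have x0 : x != 0 by apply/eqP => e; apply: nVx; rewrite e; apply: hval0.
split=> //; have [//|Vi] := proj2 VV x hx x0.
by split=> // _; rewrite invrK.
Qed.

Lemma notin_maxid V x : hval V -> V x -> ~ maxid V x -> x != 0 /\ V x^-1.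
Proof.
move=> VV Vx nm; have x0 : x != 0 by apply/eqP => e; apply: nm; rewrite e; apply: maxid0.
by split=> //; apply: contrapT => n; apply: nm; split.
Qed.

Lemma hval_total V x y : hval V -> homg x -> homg y -> x != 0 -> y != 0 ->
  V (x / y) \/ V (y / x).
Proof.
move=> VV hx hy x0 y0.
have hxy : homg (x / y) by case: homg_hring => _ _ + _; apply=> //; apply: homgV.
have [//||] := proj2 VV _ hxy; [|by left|].
  by apply: homg_mul_neq0 => //; [apply: homgV | apply: homg_neq0V].
by rewrite invrM ?unitrV ?homgU // invrK; right.
Qed.

(** Of two nonzero elements of the same degree one divides the other in [V], and their difference is
    a multiple of that one. *)
Lemma maxid_hadd V : hval V -> hadd (maxid V).
Proof.
move=> VV; have [VR _] := VV; have [_ V1 _ [_ VB]] := VR; split; first exact: maxid0.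
move=> g x y mx my hx hy.
have [->|x0] := eqVneq x 0.
  by rewrite sub0r -mulN1r; apply: maxidM => //; apply: (haddN (hring_hadd VR) V1 (hom1 gr)).
have [->|y0] := eqVneq y 0; first by rewrite subr0.
have hgx : homg x by exists g.
have hgy : homg y by exists g.
have Ux := homgU hgx x0; have Uy := homgU hgy y0.
have h0 a b : hom g a -> hom g b -> b != 0 -> hom 0 (a / b).
  by move=> ha hb b0; rewrite -(subrr g); apply: homM => //; apply: homV.
have [Vxy|Vyx] := hval_total VV hgx hgy x0 y0.
  have -> : x - y = (x / y - 1) * y by rewrite mulrBl mul1r divrK.
  by apply: maxidM => //; apply: (VB 0) => //; [apply: h0 | apply: hom1].
have -> : x - y = (1 - y / x) * x by rewrite mulrBl mul1r divrK.
by apply: maxidM => //; apply: (VB 0) => //; [apply: hom1 | apply: h0].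
Qed.

Lemma maxid_not1 V : hval V -> ~ maxid V 1.
Proof. by move=> [[_ V1 _ _] _] [_]; rewrite oner_neq0 invr1; apply. Qed.

(** * Integral elements as the common elements of valuation rings *)

Definition integ (A : set R) g h : Prop :=
  exists n r, [/\ hpoly A g (g *+ n) r, (size r <= n)%N & h ^+ n = r.[h]].

Lemma integ_hval A V g h : hval V -> A `<=` V -> hom g h -> integ A g h -> V h.
Proof.
move=> VV AV hh [n [r [hr sr e]]]; have [h0|h0] := eqVneq h 0.
  by rewrite h0; apply: hval0.
have hgh : homg h by exists g.
have Uh := homgU hgh h0; have [//|Vi] := proj2 VV h hgh h0.
(* Degree 0 would give [1 = 0]. Otherwise the equation is divided by [h ^+ n], one power below the
   leading one, which writes [h] as a polynomial in [h^-1]. *)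
case: n => [|n] in hr sr e *.
  move: sr e; rewrite leqn0 size_poly_eq0 => /eqP ->; rewrite expr0 horner0.
  by move/eqP; rewrite oner_eq0.
have -> : h = \sum_(i < size r) r`_i * h^-1 ^+ (n - i).
  rewrite -[LHS]mulr1 -(mulrV (unitrX n Uh)) mulrA -exprS e horner_coef mulr_suml.
  apply: eq_bigr => i _; rewrite -mulrA; congr (_ * _).
  have le : (i <= n)%N by rewrite -ltnS (leq_trans (ltn_ord i)).
  by rewrite -{1}(subnKC le) exprD invrM ?unitrX // mulrA mulrAC mulrV ?unitrX // mul1r exprVn.
apply: (hadd_sum (d := g) (hring_hadd (hval_hring VV))) => i _.
have [/AV Vr hri] := hr i; split.
  by apply: hvalM => //; apply: hringX => //; apply: hval_hring.
have le : (i <= n)%N by rewrite -ltnS (leq_trans (ltn_ord i)).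
have -> : g = (g *+ n.+1 - g *+ i) + (- g) *+ (n - i).
  by rewrite mulNrn -addrA -opprD -mulrnDr subnKC // mulrS addrK.
by apply: homM => //; apply: homX => //; apply: homV.
Qed.

(** If [h^-1] generated a proper ideal of [A[h^-1]], Chevalley's theorem would give a valuation ring
    over [A] with [h^-1] in its maximal ideal, hence without [h]. So [h] itself lies in
    [A[h^-1]]. *)
Lemma integ_of_hval A g h : hring A -> hom g h ->
  (forall V, hval V -> A `<=` V -> V h) -> integ A g h.
Proof.
move=> AA hh H; have [h0|h0] := eqVneq h 0.
  exists 1%N, 0; rewrite size_poly0 horner0 expr1; split=> //.
  by apply: hp0; case: AA => _ _ _ [].
have hgh : homg h by exists g.
have Uh := homgU hgh h0; have hV := homV gr hh h0.
have BB := adj_hring AA hV; have [Bh B1 BM [B0 BB']] := BB.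
set B := adjoin A (- g) h^-1 in BB Bh B1 BM B0 BB'.
have Bhi : B h^-1 by apply: adj_gen.
pose I := [set y | exists2 z, B z & y = h^-1 * z].
have hideg e z : B z -> hom e (h^-1 * z) -> hom (g + e) z.
  by move=> Bz /(homM gr hh); rewrite mulrA mulrV // mul1r.
have [I1|nI1] := pselect (I 1).
  have [z [d [p [hP ->]]] e] := I1.
  have hE : h = p.[h^-1] by rewrite -[LHS]mulr1 e mulrA mulrV // mul1r.
  have dg : d = g.
    by apply: (homI gr (x := h)) => //; rewrite {1}hE; apply: hp_hom hP.
  subst d; pose n := size p.
  (* Multiplying [h = p.[h^-1]] by [h ^+ n] reverses [p] into [r] and leaves a monic equation of
     degree [n.+1]. *)
  pose r : {poly R} := \sum_(i < n) p`_i *: 'X^(n - i).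
  exists n.+1, r; split.
  - move=> j; rewrite coef_sum.
    have hF (i : 'I_n) : A ((p`_i *: 'X^(n - i))`_j) /\
        hom (g *+ n.+1 - g *+ j) ((p`_i *: 'X^(n - i))`_j).
      have [Ap hpi] := hP i; rewrite coefZ coefXn; case: eqP => [->|_]; last first.
        by rewrite mulr0; split; [case: AA => _ _ _ [] | apply: hom0].
      rewrite mulr1; split=> //.
      have -> // : g *+ n.+1 - g *+ (n - i) = g - (- g) *+ i.
      by rewrite mulNrn opprK -{1}(subnKC (ltnW (ltn_ord i))) -addSn mulrnDr addrK mulrS.
    split; first by apply: (hadd_sum (d := g *+ n.+1 - g *+ j) (hring_hadd AA)).
    by apply: hom_sum => i _; have [] := hF i.
  - apply: leq_trans (size_sum _ _ _) _; apply/bigmax_leqP => i _.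
    apply: leq_trans (size_scale_leq _ _) _; rewrite size_polyXn ltnS leq_subr //.
  - rewrite exprSr {2}hE horner_coef mulr_sumr horner_sum; apply: eq_bigr => i _.
    rewrite hornerZ hornerXn mulrCA; congr (_ * _).
    rewrite -[in h ^+ size p](subnK (ltnW (ltn_ord i))) exprD exprVn mulrK //.
    exact: unitrX.
have II : hideal B I.
  split=> //.
  - by move=> _ [z Bz ->]; apply: BM.
  - split; first by exists 0; rewrite ?mulr0.
    move=> e _ _ [z Bz ->] [z' Bz' ->] hz hz'; exists (z - z'); last by rewrite mulrBr.
    by apply: (BB' (g + e)) => //; apply: hideg.
  - by move=> b _ Bb [z Bz ->]; exists (b * z); [apply: BM | rewrite mulrCA].
have [V [VV BV IV]] := chevalley BB II.
have [|_] := IV h^-1; first by exists 1; rewrite ?mulr1.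
rewrite (homg_neq0V hgh h0) invrK => /(_ isT)[]; apply: H => //.
by apply: subset_trans BV; apply: adj_sub; case: AA.
Qed.

(** * Contents and Gauss's lemma *)

Lemma hval_content_seq V (s : seq R) : hval V -> (forall x, x \in s -> homg x) ->
  has (fun x => x != 0) s ->
  exists2 x, x \in s & x != 0 /\ forall y, y \in s -> V (y / x).
Proof.
move=> VV; elim: s => //= a s IH hs.
have ha : homg a by apply: hs; rewrite mem_head.
have {}IH := IH (fun x xs => hs x (mem_behead (s := a :: s) xs)).
have [a0|a0] /= := eqVneq a 0.
  move=> /IH[x xs [x0 hx]]; exists x; first by rewrite inE xs orbT.
  split=> // y; rewrite inE => /orP[/eqP->|/hx //].
  by rewrite a0 mul0r; apply: hval0.
move=> _; have V1 : V (a / a).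
  by rewrite mulrV ?homgU //; case: VV => [[]].
have [/IH[x xs [x0 hx]]|/hasPn n] := boolP (has (fun x => x != 0) s); last first.
  exists a; rewrite ?mem_head //; split=> // y; rewrite inE => /orP[/eqP-> //|/n].
  by rewrite negbK => /eqP->; rewrite mul0r; apply: hval0.
have hgx : homg x by apply: hs; rewrite inE xs orbT.
have Ux := homgU hgx x0; have Ua := homgU ha a0.
have [Vax|Vxa] := hval_total VV ha hgx a0 x0.
  exists x; first by rewrite inE xs orbT.
  by split=> // y; rewrite inE => /orP[/eqP->|/hx].
exists a; rewrite ?mem_head //; split=> // y; rewrite inE => /orP[/eqP-> //|/hx Vyx].
have -> : y / a = (y / x) * (x / a) by rewrite mulrA divrK.
exact: hvalM.
Qed.

Lemma hp_homg A g d p i : hpoly A g d p -> homg p`_i.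
Proof. by move=> /(_ i)[_ h]; exists (d - g *+ i). Qed.

Lemma hval_content V A g d p : hval V -> hpoly A g d p -> p != 0 ->
  exists j, p`_j != 0 /\ forall i, V (p`_i / p`_j).
Proof.
move=> VV hP p0; have [||x] := @hval_content_seq V p VV.
- by move=> x /(nthP 0)[i _ <-]; apply: hp_homg hP.
- apply/hasP; exists (lead_coef p); last by rewrite lead_coef_eq0.
  by rewrite lead_coefE mem_nth // prednK // size_poly_gt0.
move=> /(nthP 0)[j _ <-] [x0 H]; exists j; split=> // i.
have [lt|ge] := ltnP i (size p); first by apply: H; rewrite mem_nth.
by rewrite (nth_default _ ge) mul0r; apply: hval0.
Qed.

Definition prim (V : set R) (p : {poly R}) : Prop :=
  exists j, V p`_j /\ ~ maxid V p`_j.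

(** Let [j] and [l] be the first positions of unit coefficients in [p] and [q]. In the coefficient
    of index [j + l] of the product, every term except the one pairing these two has a factor in the
    maximal ideal. *)
Lemma gauss V g d e p q : hval V -> hpoly V g d p -> hpoly V g e q ->
  prim V p -> prim V q -> prim V (p * q).
Proof.
move=> VV hP hQ Pp Pq.
have first_unit f : prim V f -> exists j, [/\ V f`_j, ~ maxid V f`_j &
    forall i, (i < j)%N -> V f`_i -> maxid V f`_i].
  move=> [j0 [Vj0 mj0]].
  have ex : exists j, `[< V f`_j /\ ~ maxid V f`_j >] by exists j0; apply/asboolP.
  have [j /asboolP[Vj mj] jmin] := ex_minnP ex.
  exists j; split=> // i ij Vi; apply: contrapT => mi.
  by have := jmin i (asboolT (conj Vi mi)); rewrite leqNgt ij.
have [j [Vj mj jmin]] := first_unit p Pp; have [l [Vl ml lmin]] := first_unit q Pq.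
have hpq := hpMr (hval_hring VV) hP hQ.
exists (j + l)%N; have [Vjl hjl] := hpq (j + l)%N; split=> // mjl.
have [pj0 Vpj] := notin_maxid VV Vj mj; have [ql0 Vql] := notin_maxid VV Vl ml.
have mm : maxid V (p`_j * q`_l).
  have jlt : (j < (j + l).+1)%N by rewrite ltnS leq_addr.
  pose F (i : 'I_(j + l).+1) := p`_i * q`_(j + l - i).
  have e1 : (p * q)`_(j + l) = p`_j * q`_l + \sum_(i | i != Ordinal jlt) F i.
    by rewrite coefM (bigD1 (Ordinal jlt)) //= addKn.
  have hF i : hom (d + e - g *+ (j + l)) (F i).
    have -> : d + e - g *+ (j + l) = (d - g *+ i) + (e - g *+ (j + l - i)).
      by rewrite addrACA -opprD -mulrnDr subnKC // -ltnS.
    by apply: homM => //; [have [] := hP i | have [] := hQ (j + l - i)%N].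
  have -> : p`_j * q`_l = (p * q)`_(j + l) - \sum_(i | i != Ordinal jlt) F i.
    by rewrite e1 addrK.
  apply: (proj2 (maxid_hadd VV) (d + e - g *+ (j + l))) => //; last exact: hom_sum.
  apply: (hadd_sum (d := d + e - g *+ (j + l)) (maxid_hadd VV)) => i ij; split=> //.
  have [lt|gt|eq] := ltngtP i j.
  - rewrite /F mulrC; apply: maxidM => //; first by case: (hQ (j + l - i)%N).
    by apply: jmin => //; case: (hP i).
  - apply: maxidM => //; first by case: (hP i).
    apply: lmin; last by case: (hQ (j + l - i)%N).
    have := ltn_ord i; lia.
  - by case/eqP: ij; apply: val_inj.
apply: mj; have -> : p`_j = (q`_l)^-1 * (p`_j * q`_l).
  by rewrite mulrCA mulVr ?mulr1 // (homgU (hval_homg VV Vl)).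
exact: maxidM.
Qed.

Lemma hp_divide K g n d P p : hring K -> P \is monic -> size P = n.+1 ->
  hpoly K g (g *+ n) P -> hpoly K g d p ->
  exists T s, [/\ hpoly K g (d - g *+ n) T, hpoly K g d s, p = T * P + s & (size s <= n)%N].
Proof.
move=> KK mP sP hP; have KA := hring_hadd KK.
move: {2}(size p) (leqnn (size p)) => N; elim: N p => [|N IH] p sp hp_.
  exists 0, p; split=> //; [by apply: hp0; case: KA | by rewrite mul0r add0r | exact: leq_trans sp _].
have [le|gt] := leqP (size p) n.
  by exists 0, p; split=> //; [by apply: hp0; case: KA | by rewrite mul0r add0r].
have [spN|spN] := leqP (size p) N; first exact: IH.
have {sp spN} sp : size p = N.+1 by apply/eqP; rewrite eqn_leq sp.
have nN : (n <= N)%N by rewrite sp ltnS in gt.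
pose c := p`_N; pose M := c *: 'X^(N - n).
have [Kc hc] := hp_ N.
have hM : hpoly K g (d - g *+ n) M.
  have -> : d - g *+ n = (d - g *+ N) + g *+ (N - n).
    by rewrite -{1}(subnK nN) mulrnDr opprD addrA addrAC subrK.
  exact: hpZXn.
have hMP : hpoly K g d (M * P).
  by rewrite -[d](subrK (g *+ n)); apply: hpMr.
have [||T [s [hT hs e ss]]] := IH (p - M * P).
- apply/leq_sizeP => j Nj; rewrite coefB /M -scalerAl coefZ coefXnM.
  move: Nj; rewrite leq_eqVlt => /orP[/eqP<-|Nj].
    rewrite ltnNge leq_subr /= subKn //.
    by have /monicP := mP; rewrite lead_coefE sP /= => ->; rewrite mulr1 subrr.
  rewrite (nth_default _ (_ : (size p <= j)%N)) ?sp // sub0r.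
  case: ifP => _; rewrite ?mulr0 ?oppr0 //.
  by rewrite nth_default ?mulr0 ?oppr0 // sP; lia.
- exact: hpB.
exists (M + T), s; split=> //; first exact: hpD.
by rewrite mulrDl -addrA -e addrC subrK.
Qed.

Lemma hp_root_monic K g d h p : hfield K -> hom g h -> hpoly K g d p -> p != 0 ->
  p.[h] = 0 -> exists r, [/\ hpoly K g (g *+ (size p).-1) r, (size r <= (size p).-1)%N &
    h ^+ (size p).-1 = r.[h]].
Proof.
move=> [KK KV] hh hP p0 ph; set e := (size p).-1.
have c0 : p`_e != 0 by have := p0; rewrite -lead_coef_eq0 lead_coefE.
have [Kc hc] := hP e.
have Uc : p`_e \is a GRing.unit by apply: homU hc c0.
exists ('X^e - ((p`_e)^-1)%:P * p); split.
- apply: hpB; [exact: hring_hadd|exact: hpXn|].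
  have -> : g *+ e = - (d - g *+ e) + d by rewrite opprB subrK.
  by apply: hpMr => //; apply: hpC; [exact: hring_hadd|exact: KV|exact: homV].
- apply/leq_sizeP => j; rewrite leq_eqVlt coefB coefXn coefCM => /orP[/eqP<-|ej].
    by rewrite eqxx mulVr // subrr.
  have -> : p`_j = 0 by apply: nth_default; apply: leq_trans (leqSpred _) ej.
  by rewrite gtn_eqF // mulr0 subrr.
- by rewrite hornerD hornerN hornerM ph mulr0 subr0 hornerXn.
Qed.

Lemma monic_XnB n (r : {poly R}) : (size r <= n)%N ->
  'X^n - r \is monic /\ size ('X^n - r) = n.+1.
Proof.
move=> sr; have s : size ('X^n - r) = n.+1.
  by rewrite size_polyDl size_polyXn // size_polyN ltnS.
split=> //; apply/monicP; rewrite lead_coefE s /= coefB coefXn eqxx.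
by rewrite nth_default // subr0.
Qed.

Lemma hval_setI V K : hval V -> hring K -> hring (V `&` K).
Proof.
move=> [[Vh V1 VM [V0 VB]] _] [Kh K1 KM [K0 KB]]; split.
- by move=> x [/Vh].
- by split.
- by move=> x y [Vx Kx] [Vy Ky]; split; [apply: VM | apply: KM].
- split; first by split.
  by move=> g x y [Vx Kx] [Vy Ky] hx hy; split; [apply: VB hx hy | apply: KB hx hy].
Qed.

(* By Gauss's lemma, the minimal polynomial over a field [K] of an element
   integral over [V `&` K] has its coefficients in [V]. *)
Lemma integ_descent K g h : hfield K -> hom g h -> integ K g h ->
  exists C : seq R, [/\ forall c, c \in C -> K c,
    forall V, hval V -> (forall c, c \in C -> V c) -> V h &
    forall V, hval V -> integ (V `&` K) g h -> forall c, c \in C -> V c].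
Proof.
move=> FK hh iK; have [KK KV] := FK; have KA := hring_hadd KK.
pose Pn n := `[< exists r, [/\ hpoly K g (g *+ n) r, (size r <= n)%N & h ^+ n = r.[h]] >].
have exn : exists n, Pn n by have [n [r H]] := iK; exists n; apply/asboolP; exists r.
have [n /asboolP[r [hr sr er]] nmin] := ex_minnP exn.
have [mP sP] := monic_XnB sr; set P := 'X^n - r in mP sP.
have hP : hpoly K g (g *+ n) P by apply: hpB => //; apply: hpXn.
have Ph : P.[h] = 0 by rewrite hornerD hornerN hornerXn er subrr.
exists (polyseq r); split.
- by move=> c /(nthP 0)[i _ <-]; case: (hr i).
- move=> V VV H; apply: (@integ_hval V V g) => //; exists n, r; split=> // i.
  have [_ hri] := hr i; split=> //.
  have [lt|ge] := ltnP i (size r); first by apply: H; rewrite mem_nth.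
  by rewrite nth_default //; apply: hval0.
move=> V VV [m [s [hs ss es]]].
have VK := hval_setI VV KK; have [mQ sQ] := monic_XnB ss; set Q := 'X^m - s in mQ sQ.
have hQ' : hpoly (V `&` K) g (g *+ m) Q by apply: hpB; [exact: hring_hadd | exact: hpXn |].
have hQ : hpoly K g (g *+ m) Q by apply: hp_sub hQ' => x [].
have Qh : Q.[h] = 0 by rewrite hornerD hornerN hornerXn es subrr.
(* [P] has least degree among the monic equations of [h] over [K], so it divides the equation [Q]
   with coefficients in [V]. *)
have [T [z [hT hz e sz]]] := hp_divide KK mP sP hP hQ.
have z0 : z = 0.
  apply/eqP; apply/negPn/negP => z0.
  have zh : z.[h] = 0 by move: Qh; rewrite e hornerD hornerM Ph mulr0 add0r.
  have [r' H] := hp_root_monic FK hh hz z0 zh.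
  have := nmin (size z).-1 (asboolT (ex_intro _ r' H)); rewrite leqNgt.
  by rewrite prednK ?sz // size_poly_gt0.
rewrite z0 addr0 in e.
have lT : lead_coef T = 1.
  by rewrite -(lead_coef_Mmonic T mP) -e; apply/monicP.
have T0 : T != 0 by rewrite -lead_coef_eq0 lT oner_neq0.
have P0 : P != 0 by rewrite -size_poly_gt0 sP.
(* With contents [a] of [P] and [b] of [T], Gauss's lemma makes [a * b] a content of [Q], so it lies
   in [V]. Since [T] is monic, [b^-1] lies in [V]; hence so does [a], which divides all coefficients
   of [P]. *)
have [j [a0 Va]] := hval_content VV hP P0; have [l [b0 Vb]] := hval_content VV hT T0.
set a := P`_j in a0 Va; set b := T`_l in b0 Vb.
have ha : homg a by apply: hp_homg hP.
have hb : homg b by apply: hp_homg hT.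
have Ua := homgU ha a0; have Ub := homgU hb b0.
have norm q c d' (hq : hpoly K g d' q) i : c != 0 -> hom (d' - g *+ i) c ->
    (forall j, V (q`_j / c)) -> hpoly V g (g *+ i) (c^-1%:P * q).
  move=> c0 hc H j'; rewrite coefCM mulrC; split=> //; have [_ hqj] := hq j'.
  have -> : g *+ i - g *+ j' = d' - g *+ j' - (d' - g *+ i).
    by rewrite opprB [RHS]addrC addrA subrK.
  by apply: homM => //; apply: homV.
have prim1 (q : {poly R}) i : q`_i \is a GRing.unit -> prim V ((q`_i)^-1%:P * q).
  by move=> U; exists i; rewrite coefCM mulVr //; split; [case: VV => [[]] | exact: maxid_not1].
have hP0 : hpoly V g (g *+ j) (a^-1%:P * P) by apply: (norm P a _ hP) => //; case: (hP j).
have hT0 : hpoly V g (g *+ l) (b^-1%:P * T) by apply: (norm T b _ hT) => //; case: (hT l).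
have [i [Vc mc]] := gauss VV hP0 hT0 (prim1 P j Ua) (prim1 T l Ub).
set c := (a^-1%:P * P * (b^-1%:P * T))`_i in Vc mc; have [c0 Vci] := notin_maxid VV Vc mc.
have Vab : V (a * b).
  have eQ : Q = (a * b)%:P * (a^-1%:P * P * (b^-1%:P * T)).
    by rewrite e mulrACA -polyCM [RHS]mulrA -polyCM mulrACA !mulrV // mulr1 polyC1 mul1r mulrC.
  have -> : a * b = Q`_i * c^-1.
    by rewrite eQ coefCM mulrK // (homgU (hval_homg VV Vc)).
  by apply: hvalM => //; case: (hQ' i) => [[]].
have Vbi : V b^-1.
  by have := Vb (size T).-1; rewrite -lead_coefE lT mul1r.
have Va' : V a by rewrite -(mulrK Ub a); apply: hvalM.
move=> _ /(nthP 0)[i' lt <-].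
have -> : r`_i' = - P`_i'.
  by rewrite coefB coefXn ltn_eqF ?sub0r ?opprK // (leq_trans lt).
have [_ hPi] := hP i'; apply: (haddN (hring_hadd (hval_hring VV))) hPi.
by rewrite -(divrK Ua P`_i'); apply: hvalM.
Qed.

(** * Rings of fractions in one generator *)

(** A multiplicative system in [A[X]], sorted by degree. Two kinds occur: polynomials over a
    subfield that do not vanish at [t], and primitive polynomials over the trace of a valuation
    ring. *)
Definition denominators (A : set R) g t (Q : G -> set {poly R}) : Prop :=
  [/\ Q 0 1, forall e e' v v', Q e v -> Q e' v' -> Q (e + e') (v * v'),
      forall e v, Q e v -> hpoly A g e v & forall e v, Q e v -> v.[t] != 0].

(** The homogeneous elements [u(t) / v(t)] with numerators over [J]: a ring when [J] is the
    coefficient ring, an ideal of that ring when [J] is an ideal. *)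
Definition fractions (J : set R) (Q : G -> set {poly R}) g t : set R :=
  [set x | exists h e u v, [/\ hom h x, Q e v, hpoly J g (e + h) u & x * v.[t] = u.[t]]].

Section Fractions.
Variables (A : set R) (Q : G -> set {poly R}) (g : G) (t : R).
Hypotheses (AA : hring A) (ht : hom g t) (dQ : denominators A g t Q).

Lemma denom_unit e v : Q e v -> v.[t] \is a GRing.unit.
Proof. by case: dQ => _ _ h h' Qv; apply: (homU gr (hp_hom ht (h _ _ Qv))); apply: h' Qv. Qed.

Lemma frP J h x : J 0 -> fractions J Q g t x -> hom h x ->
  exists e u v, [/\ Q e v, hpoly J g (e + h) u & x * v.[t] = u.[t]].
Proof.
move=> J0 [h' [e [u [v [hx Qv hu E]]]]] hx'.
have [x0|x0] := eqVneq x 0.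
  exists 0, 0, 1; rewrite x0 mul0r horner0; split=> //; first by case: dQ.
  exact: hp0.
by exists e, u, v; rewrite -(homI gr hx hx').
Qed.

Lemma fr_hadd J : hadd J -> (forall a b, A a -> J b -> J (a * b)) -> hadd (fractions J Q g t).
Proof.
move=> JJ AJ; have J0 := proj1 JJ; split.
  exists 0, 0, 0, 1; rewrite mul0r horner0; split=> //; first exact: hom0.
    by case: dQ.
  exact: hp0.
move=> h x y fx fy hx hy.
have [e [u [v [Qv hu E]]]] := frP J0 fx hx; have [e' [u' [v' [Qv' hu' E']]]] := frP J0 fy hy.
have [_ QM QA _] := dQ.
exists h, (e + e'), (v' * u - v * u'), (v * v'); split.
- exact: homB.
- exact: QM.
- apply: hpB => //.
    have -> : e + e' + h = e' + (e + h) by rewrite addrCA addrA addrC.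
    by apply: (hpM _ AJ) hu => //; apply: QA.
  have -> : e + e' + h = e + (e' + h) by rewrite addrA.
  by apply: (hpM _ AJ) hu' => //; apply: QA.
- by rewrite hornerD hornerN !hornerM -E -E'; ring.
Qed.

Lemma fr_mul J J' : (forall a b, J a -> J' b -> J' (a * b)) -> hadd J' ->
  forall x y, fractions J Q g t x -> fractions J' Q g t y -> fractions J' Q g t (x * y).
Proof.
move=> JM JJ x y [h [e [u [v [hx Qv hu E]]]]] [h' [e' [u' [v' [hy Qv' hu' E']]]]].
have [_ QM QA _] := dQ.
exists (h + h'), (e + e'), (u * u'), (v * v'); split.
- exact: homM.
- exact: QM.
- by rewrite addrACA; apply: (hpM JJ JM).
- by rewrite !hornerM -E -E'; ring.
Qed.

Lemma fr_hring : hring (fractions A Q g t).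
Proof.
have [Ah A1 AM A0] := AA; split.
- by move=> x [h [? [? [? [hx _ _ _]]]]]; exists h.
- exists 0, 0, 1, 1; rewrite !hornerE; split=> //; [exact: hom1|by case: dQ|].
  by rewrite ?addr0; case: dQ => Q1 _ QA _; apply: QA.
- exact: fr_mul.
- exact: fr_hadd.
Qed.

Lemma fr_sub : A `<=` fractions A Q g t.
Proof.
move=> a Aa; have [Ah A1 AM A0] := AA; have [h ha] := Ah a Aa.
exists h, 0, a%:P, 1; rewrite !hornerE; split=> //; first by case: dQ.
by rewrite ?add0r; apply: hpC.
Qed.

Lemma fr_gen : fractions A Q g t t.
Proof.
exists g, 0, 'X, 1; rewrite !hornerE; split=> //; first by case: dQ.
by rewrite ?add0r; apply: hpX.
Qed.

Lemma fr_denomV e v : Q e v -> fractions A Q g t v.[t]^-1.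
Proof.
move=> Qv; have [Q1 _ QA Q0] := dQ.
exists (- e), e, 1, v; rewrite subrr mulVr ?(denom_unit Qv) // hornerC; split=> //.
  by apply: homV (Q0 _ _ Qv) => //; apply: hp_hom ht (QA _ _ Qv).
exact: QA.
Qed.

Lemma fr_denom e v : Q e v -> fractions A Q g t v.[t].
Proof.
move=> Qv; have [Q1 _ QA Q0] := dQ.
exists e, 0, v, 1; rewrite hornerC mulr1 add0r; split=> //; last exact: QA.
by apply: hp_hom ht (QA _ _ Qv).
Qed.

Lemma fr_common_denominator (s : seq R) : (forall x, x \in s -> fractions A Q g t x) ->
  exists e D, Q e D /\ forall x h, x \in s -> hom h x ->
    exists2 w, hpoly A g (e + h) w & x * D.[t] = w.[t].
Proof.
have [Ah A1 AM [A0 _]] := AA; have [Q1 QM QA _] := dQ.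
elim: s => [|a s IH] H; first by exists 0, 1.
have [x xs|e [D [QD HD]]] := IH; first by apply: H; rewrite inE xs orbT.
have [ha [e' [u [v [hha Qv hu E]]]]] := H a (mem_head _ _).
exists (e' + e), (v * D); split; first exact: QM.
move=> x h; rewrite inE => /orP[/eqP->|xs] hx.
  have [e1 [u1 [v1 [Qv1 hu1 E1]]]] := frP A0 (H a (mem_head _ _)) hx.
  have [a0|a0] := eqVneq a 0.
    by exists 0; [apply: hp0 | rewrite a0 mul0r horner0].
  have hh : ha = h by apply: homI hha hx a0.
  exists (u * D); last by rewrite !hornerM mulrA E.
  have -> : e' + e + h = (e' + ha) + e by rewrite hh addrAC.
  by apply: hpMr => //; apply: QA.
have [w hw Ew] := HD x h xs hx; exists (v * w).
  by rewrite -addrA; apply: hpMr => //; apply: QA.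
by rewrite !hornerM mulrCA Ew.
Qed.

Lemma fr_min V : hring V -> A `<=` V -> V t -> (forall e v, Q e v -> V v.[t]^-1) ->
  fractions A Q g t `<=` V.
Proof.
move=> VV AV Vt H x [h [e [u [v [hx Qv hu E]]]]].
rewrite -[x](mulrK (denom_unit Qv)) E; have [_ _ VM _] := VV.
apply: VM; last exact: H Qv.
by have [] := hp_horner VV AV ht Vt hu.
Qed.

End Fractions.

Definition nonvanishing (K : set R) g t : G -> set {poly R} :=
  fun e => [set v | hpoly K g e v /\ v.[t] != 0].

(** The homogeneous elements of the graded field [K(t)], whether or not [t] is algebraic over
    [K]. *)
Definition frac (K : set R) g t : set R := fractions K (nonvanishing K g t) g t.

(** Denominators come from the smaller field and numerators from the larger ring. This gives both
    [K(t)] and the localization of [K[t]] at the nonzero elements of [k[t]]. *)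
Lemma fq_denominators K F g t : hring K -> hring F -> K `<=` F -> hom g t ->
  denominators F g t (nonvanishing K g t).
Proof.
move=> KK FF KF ht; have [_ K1 _ KA] := KK; split.
- by split; [apply: hpC => //; apply: hom1 | rewrite hornerC oner_neq0].
- move=> e e' v v' [hv v0] [hv' v0']; split; first exact: hpMr.
  by rewrite hornerM homg_mul_neq0 //; [exists e; apply: hp_hom hv | exists e'; apply: hp_hom hv'].
- by move=> e v [hv _]; apply: hp_sub hv.
- by move=> e v [].
Qed.

Lemma frac_denominators K g t : hring K -> hom g t -> denominators K g t (nonvanishing K g t).
Proof. by move=> KK; apply: fq_denominators. Qed.

Lemma frac_hfield K g t : hfield K -> hom g t -> hfield (frac K g t).
Proof.
move=> [KK KV] ht; have dQ := frac_denominators KK ht; split; first exact: fr_hring.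
move=> x [h [e [u [v [hx [hv v0] hu E]]]]] x0.
have hgx : homg x by exists h.
have u0 : u.[t] != 0.
  by rewrite -E homg_mul_neq0 //; exists e; apply: hp_hom hv.
exists (- h), (e + h), v, u; split=> //; [exact: homV|by rewrite addrK|].
by rewrite -E mulrA mulVr ?mul1r // homgU.
Qed.

Lemma frac_sub K g t : hfield K -> hom g t -> K `<=` frac K g t.
Proof. by move=> [KK KV] ht; apply: fr_sub => //; apply: frac_denominators. Qed.

Lemma frac_gen K g t : hfield K -> hom g t -> frac K g t t.
Proof. by move=> [KK KV] ht; apply: fr_gen => //; apply: frac_denominators. Qed.

Lemma frac_min K F g t : hring K -> hfield F -> hom g t -> K `<=` F -> F t ->
  frac K g t `<=` F.
Proof.
move=> KK [FF FV] ht KF Ft; apply: fr_min => //; first exact: frac_denominators.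
by move=> e v [hv v0]; apply: FV => //; have [] := hp_horner FF KF ht Ft hv.
Qed.

Lemma frac_mono k K g t : k `<=` K -> frac k g t `<=` frac K g t.
Proof.
move=> kK x [h [e [u [v [hx [hv v0] hu E]]]]].
by exists h, e, u, v; split=> //; [split=> //; apply: hp_sub hv | apply: hp_sub hu].
Qed.

(** * Transcendental elements and Gauss valuations *)

Definition transcendental (K : set R) g t : Prop :=
  forall d p, hpoly K g d p -> p != 0 -> p.[t] != 0.

Lemma not_transcendental K g t : hfield K -> hom g t -> ~ transcendental K g t -> integ K g t.
Proof.
move=> KK ht nt; apply: contrapT => ni; apply: nt => d p hP p0; apply/eqP => pt.
by apply: ni; have [r H] := hp_root_monic KK ht hP p0 pt; exists (size p).-1, r.
Qed.

(* [V `&` K] is a minimal valuation ring of [K] over [k]. *)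
Definition minval (k K V : set R) : Prop :=
  forall W, hval W -> k `<=` W -> W `<=` V -> V `&` K `<=` W.

(** An [x] in [W] outside [V] has its inverse in the maximal ideal of [V], and [y = (y / x) x]
    brings every [y] of [V] into [W]. *)
Lemma hval_comparable V W : hval V -> hval W -> maxid V `<=` W -> W `<=` V \/ V `<=` W.
Proof.
move=> VV WW mW; have [WV|/existsNP[x /not_implyP[Wx nVx]]] := pselect (W `<=` V); first by left.
have hx := hval_homg WW Wx; have [x0 mx] := notin_hval VV hx nVx; right=> y Vy.
by rewrite -(divrK (homgU hx x0) y); apply: hvalM => //; apply/mW/maxidM.
Qed.

(** This is the preimage in [V] of the copy of [k] in the residue field; integrality over it means
    that the residue is algebraic over [k]. *)
Lemma base_plus_maxid k V : hring k -> hval V -> k `<=` V ->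
  hring [set x | exists d b m, [/\ k b, hom d b, maxid V m, hom d m & x = b + m]].
Proof.
move=> kk VV kV; have [kh k1 kM [k0 kB]] := kk; have mA := maxid_hadd VV.
have m0 := maxid0 VV.
split.
- by move=> _ [d [b [m [_ hb _ hm ->]]]]; exists d; apply: homD.
- by exists 0, 1, 0; rewrite addr0; split=> //; [apply: hom1|apply: hom0].
- move=> _ _ [d [b [m [kb hb mm hm ->]]]] [d' [b' [m' [kb' hb' mm' hm' ->]]]].
  exists (d + d'), (b * b'), (b * m' + b' * m + m * m'); split.
  + exact: kM.
  + exact: homM.
  + have mD := haddD mA (g := d + d').
    apply: (mD).
    * apply: (mD); [apply: maxidM => //; exact: kV|apply: maxidM => //; exact: kV|exact: homM|].
      by rewrite addrC; apply: homM.
    * by apply: maxidM => //; case: mm.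
    * by apply: homD; [apply: homM | rewrite addrC; apply: homM].
    * exact: homM.
  + apply: homD; last exact: homM.
    by apply: homD; [apply: homM | rewrite addrC; apply: homM].
  + by ring.
- split; first by exists 0, 0, 0; rewrite addr0; split=> //; apply: hom0.
  move=> g _ _ [d [b [m [kb hb mm hm ->]]]] [d' [b' [m' [kb' hb' mm' hm' ->]]]] hx hy.
  have [x0|x0] := eqVneq (b + m) 0.
    exists d', (- b'), (- m'); rewrite x0 sub0r opprD; split=> //;
      try exact: homN.
      exact: (haddN (hring_hadd kk)) hb'.
    exact: (haddN mA) hm'.
  have [y0|y0] := eqVneq (b' + m') 0.
    by exists d, b, m; rewrite y0 subr0.
  have dg : d = g by apply: (homI gr _ hx x0); apply: homD.
  have dg' : d' = g by apply: (homI gr _ hy y0); apply: homD.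
  subst d d'; exists g, (b - b'), (m - m'); split; try exact: homB.
  + exact: kB hb hb'.
  + exact: (proj2 mA) hm hm'.
  + by ring.
Qed.

(* If V restricts to a minimal valuation ring of K over k, then its residue
   field on K is algebraic over k, so t stays transcendental over it: V is a Gauss valuation. *)
Section GaussPoint.
Variables (k K V : set R) (g : G) (t : R).
Hypotheses (fk : hfield k) (fK : hfield K) (VV : hval V).
Hypotheses (minV : minval k K V) (ht : hom g t) (kV : frac k g t `<=` V).
Hypothesis tk : transcendental k g t.

Let Vt : V t. Proof. exact/kV/frac_gen. Qed.
Let kV' : k `<=` V. Proof. by apply: subset_trans kV; apply: frac_sub. Qed.

(** A primitive polynomial with value in the maximal ideal would be an algebraic equation for the
    residue of [t] over that of [V] on [K]. By minimality every valuation ring between [k + m] and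
    [V] contains the coefficients, so [t] would be integral over [k + m], against its transcendence
    over [k]. *)
Lemma prim_unit d p : hpoly (V `&` K) g d p -> prim V p -> V p.[t] /\ ~ maxid V p.[t].
Proof.
move=> hp_ pp; have [kk kinv] := fk; have [KK Kinv] := fK.
have VR := hval_hring VV; have VKR := hval_setI VV KK.
split; first by have [] := hp_horner VR (fun x => @proj1 _ _) ht Vt hp_.
move: {2}(size p) (leqnn (size p)) => N; elim: N p hp_ pp => [|N IH] p hp_ pp sp mp.
  case: pp => j [_]; rewrite nth_default; last exact: leq_trans sp _.
  by case; apply: maxid0.
have [le|gt] := leqP (size p) N; first exact: (IH p).
have {sp gt} sp : size p = N.+1 by apply/eqP; rewrite eqn_leq sp.
have [[Vc Kc] hc] := hp_ N; set c := p`_N in Vc Kc hc.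
have hpt : hom d p.[t] by apply: hp_hom hp_.
(* A leading term in the maximal ideal affects neither primitivity nor the residue of the value, so
   it is dropped. *)
have [mc|nmc] := pselect (maxid V c).
  apply: (IH (p - c *: 'X^N)).
  - apply: hpB => //; first exact: hring_hadd.
    by rewrite -[d](subrK (g *+ N)); apply: hpZXn => //; apply: hring_hadd.
  - have [j [Vj mj]] := pp; exists j; rewrite coefB coefZ coefXn.
    case: eqP mj => [-> //|_ mj]; by rewrite mulr0 subr0.
  - apply/leq_sizeP => j; rewrite coefB coefZ coefXn leq_eqVlt => /orP[/eqP<-|Nj].
      by rewrite eqxx mulr1 subrr.
    by rewrite gtn_eqF // mulr0 subr0 nth_default // sp.
  - rewrite hornerD hornerN hornerZ hornerXn.
    apply: (proj2 (maxid_hadd VV) d) => //.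
      by rewrite mulrC; apply: maxidM => //; apply: hringX.
    by rewrite -[d](subrK (g *+ N)); apply: homM => //; apply: homX.
have [c0 Vci] := notin_maxid VV Vc nmc; have Uc := homU gr hc c0.
have [N0|N0] := posnP N.
  by apply: nmc; rewrite /c N0; move: mp; rewrite (size1_polyC (p := p)) ?sp ?N0 // hornerC coefC.
pose S := [set x | exists d b m, [/\ k b, hom d b, maxid V m, hom d m & x = b + m]].
have SS : hring S by apply: base_plus_maxid.
have mS : maxid V `<=` S.
  move=> m mm; have [e hm] := hval_homg VV (proj1 mm).
  by exists e, 0, m; rewrite add0r; split=> //; [case: kk => _ _ _ []|apply: hom0].
have kS : k `<=` S.
  case: (kk) => kh _ _ _ b kb; have [e hb] := kh b kb.
  by exists e, b, 0; rewrite addr0; split=> //; [apply: maxid0|apply: hom0].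
have [|n [r [hr sr er]]] := integ_of_hval SS ht.
  move=> W WW SW; have [WV|VW] := hval_comparable VV WW (subset_trans mS SW); last exact: VW.
  have VKW : V `&` K `<=` W by apply: minV => //; apply: subset_trans SW.
  have WR := hval_hring WW.
  (* [c^-1 p] is monic over [W], and its value at [t] lies in the maximal ideal of [V], hence in
     [W]. Subtracting this value yields a monic equation for [t] over [W]. *)
  apply: (@integ_hval W W g) => //; exists N, ('X^N - c^-1%:P * p + (c^-1 * p.[t])%:P); split.
  - have e1 : g *+ N = - (d - g *+ N) + d by rewrite opprB subrK.
    have Wci : W c^-1 by apply: VKW; split=> //; apply: Kinv.
    have hci : hom (- (d - g *+ N)) c^-1 by apply: homV.
    apply: hpD; [exact: hring_hadd| |].
      apply: hpB; [exact: hring_hadd|exact: hpXn|].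
      rewrite e1; apply: hpMr => //; last exact: hp_sub hp_.
      by apply: hpC => //; apply: hring_hadd.
    apply: hpC; [exact: hring_hadd| |by rewrite e1; apply: homM].
    by apply: hvalM => //; apply/SW/mS.
  - apply/leq_sizeP => j; rewrite leq_eqVlt coefD coefB coefXn coefCM coefC => /orP[/eqP<-|Nj].
      by rewrite eqxx mulVr // gtn_eqF // subrr addr0.
    rewrite gtn_eqF // (nth_default _ (_ : (size p <= j)%N)) ?sp // mulr0 subr0 add0r.
    by rewrite gtn_eqF // (leq_trans _ Nj).
  - by rewrite hornerD hornerD hornerN hornerM !hornerC hornerXn subrK.
(* Replacing each coefficient of [r] by its part in [k] gives a monic polynomial over [k] whose
   value at [t] is in the maximal ideal of [V], whereas the nonzero elements of [k(t)] are units of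
   [V]. *)
have /choice[b Hb] : forall i, exists b, [/\ k b, hom (g *+ n - g *+ i) b &
    maxid V (r`_i - b) /\ hom (g *+ n - g *+ i) (r`_i - b)].
  move=> i; have [[e [b [m [kb hb mm hm E]]]] hri] := hr i.
  have [r0|r0] := eqVneq r`_i 0.
    exists 0; rewrite r0 subr0; split; [by case: (kk) => _ _ _ []|exact: hom0|].
    by split; [apply: maxid0|apply: hom0].
  have ee : e = g *+ n - g *+ i by apply: (homI gr _ hri r0); rewrite E; apply: homD.
  exists b; have -> : r`_i - b = m by rewrite E addrC addKr.
  by rewrite -ee.
pose rb := \poly_(i < size r) b i.
have hrb : hpoly k g (g *+ n) rb.
  move=> i; rewrite coef_poly; case: ifP => _; first by have [] := Hb i.
  by split; [case: (kk) => _ _ _ []|apply: hom0].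
have hrm : hpoly (maxid V) g (g *+ n) (r - rb).
  move=> i; rewrite coefB coef_poly; case: ltnP => [_|ge]; first by have [_ _] := Hb i.
  by rewrite nth_default // subr0; split; [apply: maxid0|apply: hom0].
have [mP sP] := monic_XnB (leq_trans (size_poly _ _) sr : (size rb <= n)%N).
have hP : hpoly k g (g *+ n) ('X^n - rb) by apply: hpB; [exact: hring_hadd|exact: hpXn|].
have P0 : 'X^n - rb != 0 by rewrite -size_poly_gt0 sP.
have Pt0 := tk hP P0.
have mPt : maxid V ('X^n - rb).[t].
  have -> : ('X^n - rb).[t] = (r - rb).[t] by rewrite !hornerD !hornerN hornerXn er.
  rewrite horner_coef; apply: (hadd_sum (d := g *+ n) (maxid_hadd VV)) => i _.
  have [mi hi] := hrm i; split; first by rewrite mulrC; apply: maxidM => //; apply: hringX.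
  by rewrite -[g *+ n](subrK (g *+ i)); apply: homM => //; apply: homX.
case: mPt => _ /(_ Pt0); apply; apply: kV.
by apply: (fr_denomV ht (frac_denominators kk ht) (e := g *+ n)); split.
Qed.

End GaussPoint.

Section GaussPointExtension.
Variables (k K V : set R) (g : G) (t : R).
Hypotheses (fk : hfield k) (fK : hfield K) (VV : hval V).
Hypotheses (minV : minval k K V) (ht : hom g t) (kV : frac k g t `<=` V).
Hypothesis tk : transcendental k g t.

Lemma normalize_content d p : hpoly K g d p -> p != 0 ->
  exists a e, [/\ K a, hom e a, a != 0,
    hpoly (V `&` K) g (d - e) (a^-1%:P * p) & prim V (a^-1%:P * p)].
Proof.
move=> hP p0; have [KK Kinv] := fK; have [j [a0 Va]] := hval_content VV hP p0.
have [Ka ha] := hP j; have Ua := homU gr ha a0.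
exists p`_j, (d - g *+ j); split=> //.
  move=> i; have [Ki hi] := hP i; rewrite coefCM mulrC; split.
    split; first exact: Va.
    by case: KK => _ _ KM _; apply: KM => //; apply: Kinv.
  by rewrite addrAC; apply: homM => //; apply: homV.
exists j; rewrite coefCM mulVr //; split; last exact: maxid_not1.
by case: VV => [[]].
Qed.

(** Divided by its content, a nonzero polynomial becomes primitive and takes a unit value at [t]. *)
Lemma transcendental_ext : transcendental K g t.
Proof.
move=> d p hP p0; have [a [e [Ka ha a0 hq pq]]] := normalize_content hP p0.
have [Vq mq] := prim_unit fk fK VV minV ht kV tk hq pq; apply/eqP => pt; apply: mq.
by rewrite hornerM pt mulr0; apply: maxid0.
Qed.

(** Up to values of primitive polynomials, which are units of [V], an element of [K(t)] is a
    quotient [c] of contents. If it is in [V], then [c] is in the trace of [V] on [K], hence in [W].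
    The trace of [W] on [K] is again minimal, so these values are units of [W] too. *)
Lemma minval_frac : minval (frac k g t) (frac K g t) V.
Proof.
move=> W WW kW WV x [Vx fx]; have [KK Kinv] := fK; have WR := hval_hring WW.
have kW' : k `<=` W by apply: subset_trans kW; apply: frac_sub.
have Wt : W t by apply/kW/frac_gen.
have VKW : V `&` K `<=` W by apply: minV.
have [x0|x0] := eqVneq x 0; first by rewrite x0; apply: hval0.
have [h [e [u [v [hx [hv v0] hu E]]]]] := fx.
have vn0 : v != 0 by apply: contraNneq v0 => ->; rewrite horner0.
have [a [e1 [Ka ha a0 hv1 pv1]]] := normalize_content hv vn0.
set v1 := _ * v in hv1 pv1; pose u1 := a^-1%:P * u; have Ua := homU gr ha a0.
have E1 : x * v1.[t] = u1.[t] by rewrite !hornerM !hornerC mulrCA E.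
have hai : hom (- e1) a^-1 by apply: homV.
have hu1 : hpoly K g (- e1 + (e + h)) u1.
  by apply: hpMr => //; apply: hpC => //; [apply: hring_hadd|apply: Kinv].
have [Vv1 mv1] := prim_unit fk fK VV minV ht kV tk hv1 pv1.
have [v10 Vv1i] := notin_maxid VV Vv1 mv1.
have hgv1 := hval_homg VV Vv1; have Uv1 := homgU hgv1 v10.
have u1t : u1.[t] != 0 by rewrite -E1 homg_mul_neq0 //; exists h.
have u1n0 : u1 != 0 by apply: contraNneq u1t => ->; rewrite horner0.
have [c [e2 [Kc hc c0 hu2 pu2]]] := normalize_content hu1 u1n0.
have [Vu2 mu2] := prim_unit fk fK VV minV ht kV tk hu2 pu2; set u2 := _ * u1 in hu2 pu2 Vu2 mu2.
have [u20 Vu2i] := notin_maxid VV Vu2 mu2.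
have Uc := homU gr hc c0; have Uu2 := homgU (hval_homg VV Vu2) u20.
have Ec : u1.[t] = c * u2.[t] by rewrite /u2 [(_ * u1).[t]]hornerM hornerC mulrA mulrV // mul1r.
have Vc : V c.
  by rewrite -(mulrK Uu2 c) -Ec -E1; apply: hvalM => //; apply: hvalM.
have Wu1 : W u1.[t].
  rewrite Ec; apply: hvalM => //; first by apply: VKW.
  by have [] := hp_horner WR VKW ht Wt hu2.
have minW : minval k K W.
  move=> W' WW' kW'' W'W y [Wy Ky]; apply: minV => //; first exact: subset_trans WV.
  by split=> //; apply: WV.
have Wv1 : W v1.[t] by have [] := hp_horner WR VKW ht Wt hv1.
have Wv1i : W v1.[t]^-1.
  have hWv1 : hpoly (W `&` K) g (e - e1) v1.
    by apply: hp_sub hv1 => y VKy; split; [apply: VKW | case: VKy].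
  have pWv1 : prim W v1.
    have [j [Vj mj]] := pv1; have [[_ Kj] hj] := hv1 j.
    have [j0 Vji] := notin_maxid VV Vj mj.
    exists j; split; first exact: VKW.
    by move=> [_ /(_ j0)]; apply; apply: VKW; split=> //; apply: Kinv.
  have [_ mW] := prim_unit fk fK WW minW ht kW tk hWv1 pWv1.
  by have [] := notin_maxid WW Wv1 mW.
by rewrite -(mulrK Uv1 x) E1; apply: hvalM.
Qed.

End GaussPointExtension.

(** * Descent of membership conditions along one generator *)

(* Membership of [V] in [U] depends only on [V `&` K] and is stable under
   generization; thus [U] stands for an open subset of P_{K/k}. *)
Definition upclosed (k K : set R) (U : set (set R)) : Prop :=
  forall V W, hval V -> hval W -> k `<=` V -> k `<=` W -> U V -> V `&` K `<=` W -> U W.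

Lemma hfield_homg K : hfield K -> K `<=` homg.
Proof. by move=> [[]]. Qed.

(** Valuation rings containing [K] satisfy [U] because the trivial one does, so [h] is integral over
    [K]. For [V] in [U], those containing the trace of [V] on [K] satisfy [U] as well, so [h] is
    integral over this trace and [integ_descent] applies. *)
Lemma algebraic_descent k K U h : hfield K -> k `<=` K -> upclosed k K U -> U homg ->
  homg h -> (forall V, hval V -> k `<=` V -> U V -> V h) ->
  exists C : seq R, [/\ forall c, c \in C -> K c,
    forall V, hval V -> k `<=` V -> U V -> forall c, c \in C -> V c &
    forall V, hval V -> (forall c, c \in C -> V c) -> V h].
Proof.
move=> fK kK upU UT [g hh] H; have [KK _] := fK; have Kh := hfield_homg fK.
have iK : integ K g h.
  apply: integ_of_hval => // V VV KV; apply: H => //; first exact: subset_trans KV.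
  apply: (upU homg) => //; [exact: hval_homgT| | |].
  - exact: subset_trans Kh.
  - exact: subset_trans KV.
  - by move=> x [_ /KV].
have [C [CK CV VC]] := integ_descent fK hh iK.
exists C; split=> // V VV kV UV; apply: VC => //.
apply: integ_of_hval => //; first exact: hval_setI.
move=> W WW VKW; have kW : k `<=` W by move=> x kx; apply: VKW; split; [apply: kV | apply: kK].
by apply: H => //; apply: (upU V).
Qed.

(* The localization of [K[t]] at the nonzero elements of [k[t]] is normal, so the
   denominator of an element integral over it divides an element of [k[t]]. *)
Lemma integral_denominator k K g t q c : hfield k -> hfield K -> k `<=` K -> hom g t ->
  transcendental K g t -> hom q c -> frac K g t c ->
  integ (fractions K (nonvanishing k g t) g t) q c ->
  exists e D w, [/\ hpoly k g e D, D.[t] != 0, hpoly K g (e + q) w & c * D.[t] = w.[t]].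
Proof.
move=> fk fK kK ht tK hc fc [n [r [hr sr er]]]; have [kk _] := fk; have [KK Kinv] := fK.
have [Kh K1 KM KA] := KK; have K0 := proj1 KA.
have dQ := fq_denominators kk KK kK ht.
have [e [D [[hD D0] HD]]] : exists e D, nonvanishing k g t e D /\ forall x h, x \in polyseq r -> hom h x ->
    exists2 w, hpoly K g (e + h) w & x * D.[t] = w.[t].
  by apply: (fr_common_denominator KK dQ) => x /(nthP 0)[i _ <-]; case: (hr i).
have hDK : hpoly K g e D by apply: hp_sub hD.
(* [I] is the ideal of denominators of [c]: the polynomials [W] with [c W(t)] in [K[t]]. It is
   generated by the monic [v0'] of least degree, with numerator [u0]. *)
pose I d W := hpoly K g d W /\ exists2 u, hpoly K g (d + q) u & c * W.[t] = u.[t].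
pose Pn m := `[< exists d v, [/\ I d v, v != 0 & size v = m] >].
have exn : exists m, Pn m.
  have [d [u [v [[hv v0] hu E]]]] := frP (frac_denominators KK ht) K0 fc hc.
  exists (size v); apply/asboolP; exists d, v; split=> //; first by split=> //; exists u.
  by apply: contraNneq v0 => ->; rewrite horner0.
have [m /asboolP[d [v [[hv [u hu E]] v0 sv]]] vmin] := ex_minnP exn.
have lc0 : lead_coef v != 0 by rewrite lead_coef_eq0.
have [Kl hl] := hv (size v).-1; rewrite -lead_coefE in Kl hl.
have Ul := homU gr hl lc0; set a := lead_coef v in lc0 Kl hl Ul.
pose d0 := g *+ (size v).-1.
have ha : hom (- (d - d0)) a^-1 by apply: homV.
have d0E : d0 = - (d - d0) + d by rewrite opprB subrK.
pose v0' := a^-1%:P * v; pose u0 := a^-1%:P * u.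
have haP : hpoly K g (- (d - d0)) a^-1%:P by apply: hpC => //; apply: Kinv.
have hv0 : hpoly K g d0 v0' by rewrite d0E; apply: hpMr.
have hu0 : hpoly K g (d0 + q) u0 by rewrite {1}d0E -addrA; apply: hpMr.
have E0 : c * v0'.[t] = u0.[t] by rewrite !hornerM !hornerC mulrCA E.
have sv0 : size v0' = m.
  apply/eqP; rewrite -sv eqn_leq /v0' mul_polyC size_scale_leq /=.
  by rewrite -{1}[v]scale1r -(mulrV Ul) -scalerA size_scale_leq.
have mpos : (0 < m)%N by rewrite -sv size_poly_gt0.
have v0n : v0' != 0 by rewrite -size_poly_gt0 sv0.
have mv0 : v0' \is monic.
  by apply/monicP; rewrite lead_coefE sv0 -sv coefCM -lead_coefE mulVr.
clearbody v0' u0.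
have v0t := tK _ _ hv0 v0n; have Uv0 := homU gr (hp_hom ht hv0) v0t.
have Idiv d' W : I d' W -> exists T, [/\ hpoly K g (d' - d0) T & W = T * v0'].
  move=> [hW [uW huW EW]].
  have [|T [s [hT hs e' ss]]] := hp_divide (n := (size v).-1) KK mv0 _ hv0 hW.
    by rewrite sv0 sv prednK.
  suff s0 : s = 0 by exists T; rewrite {1}e' s0 addr0.
  apply/eqP; apply/negPn/negP => s0.
  have Is : I d' s.
    split=> //; exists (uW - T * u0).
      apply: hpB => //.
      have -> : d' + q = (d' - d0) + (d0 + q) by rewrite addrA subrK.
      exact: hpMr.
    have -> : s = W - T * v0' by rewrite e' addrC addKr.
    by rewrite !hornerD !hornerN !hornerM -EW -E0; ring.
  have := vmin (size s) (asboolT (ex_intro _ d' (ex_intro _ s (And3 Is s0 erefl)))).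
  by rewrite leqNgt -sv -(prednK (_ : 0 < size v)%N) ?ltnS ?ss // sv.
(* One factor [u0] can be removed: if [D u0^(j+1) = T v0'], then [c] times the value of [D u0^j] is
   [T(t)], because [u0(t) = c v0'(t)]. *)
have step j : I (e + (d0 + q) *+ j.+1) (D * u0 ^+ j.+1) -> I (e + (d0 + q) *+ j) (D * u0 ^+ j).
  move=> /Idiv[T [hT eT]]; split.
    apply: hpMr => //; elim: j {T hT eT} => [|j IH].
      by rewrite mulr0n expr0; apply: hpC => //; apply: hom1.
    by rewrite mulrS exprS; apply: hpMr.
  exists T.
    have -> // : e + (d0 + q) *+ j + q = e + (d0 + q) *+ j.+1 - d0.
    by rewrite mulrSr [d0 + q]addrC !addrA addrK.
  apply: (mulIr Uv0); rewrite -[RHS]hornerM -eT exprSr !hornerM -E0; ring.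
have hu0X j : hpoly K g ((d0 + q) *+ j) (u0 ^+ j).
  elim: j => [|j IH]; first by rewrite mulr0n expr0; apply: hpC => //; apply: hom1.
  by rewrite mulrS exprS; apply: hpMr.
have hv0X j : hpoly K g (d0 *+ j) (v0' ^+ j).
  elim: j => [|j IH]; first by rewrite mulr0n expr0; apply: hpC => //; apply: hom1.
  by rewrite mulrS exprS; apply: hpMr.
case: n => [|n] in hr sr er.
  move: sr er; rewrite leqn0 size_poly_eq0 => /eqP ->; rewrite expr0 horner0.
  by move/eqP; rewrite oner_eq0.
have /choice[w Hw] : forall i, exists w, hpoly K g (e + (q *+ n.+1 - q *+ i)) w /\ r`_i * D.[t] = w.[t].
  move=> i; have [_ hri] := hr i; have [lt|ge] := ltnP i (size r).
    by have [w hw Ew] := HD _ _ (mem_nth 0 lt) hri; exists w.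
  by exists 0; rewrite nth_default // mul0r horner0; split=> //; apply: hp0.
(* At [t], [c D u0^n] equals [D c^(n+1) v0'^n]. The integral equation replaces [c^(n+1)] by powers
   up to [c^n]; [D] clears its coefficients and [v0'^n] clears these powers. *)
have In : I (e + (d0 + q) *+ n) (D * u0 ^+ n).
  split; first exact: hpMr.
  exists (\sum_(i < size r) w i * u0 ^+ i * v0' ^+ (n - i)).
    move=> j; rewrite coef_sum.
    have hF (i : 'I_(size r)) : hpoly K g (e + (d0 + q) *+ n + q) (w i * u0 ^+ i * v0' ^+ (n - i)).
      have lin : (i <= n)%N by rewrite -ltnS (leq_trans (ltn_ord i)).
      have [hw _] := Hw i.
      have -> : e + (d0 + q) *+ n + q =
          e + (q *+ n.+1 - q *+ i) + (d0 + q) *+ i + d0 *+ (n - i).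
        have -> : q *+ n.+1 - q *+ i = q *+ (n - i) + q.
          by rewrite -mulrSr -subSn // mulrnBr // leqW.
        rewrite -[in (d0 + q) *+ n](subnKC lin) mulrnDr [(d0 + q) *+ (n - i)]mulrnDl.
        by rewrite -!addrA; congr (e + _); rewrite addrA addrC -addrA.
      by apply: hpMr => //; apply: hpMr.
    have KP : forall i : 'I_(size r), true -> K (w i * u0 ^+ i * v0' ^+ (n - i))`_j /\
        hom (e + (d0 + q) *+ n + q - g *+ j) (w i * u0 ^+ i * v0' ^+ (n - i))`_j.
      by move=> i _; apply: hF.
    by split; [exact: hadd_sum KA KP | exact: hom_sum (fun i Pi => proj2 (KP i Pi))].
  rewrite hornerM horner_exp -E0 exprMn.
  transitivity (D.[t] * c ^+ n.+1 * v0'.[t] ^+ n); first by rewrite exprS; ring.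
  rewrite er (horner_coef r) horner_sum mulr_sumr mulr_suml; apply: eq_bigr => i _.
  have lin : (i <= n)%N by rewrite -ltnS (leq_trans (ltn_ord i)).
  have [_ Ew] := Hw i; rewrite !hornerM !horner_exp -E0 -Ew exprMn.
  by rewrite -[in LHS](subnKC lin) exprD; ring.
have ID j : (j <= n)%N -> I (e + (d0 + q) *+ (n - j)) (D * u0 ^+ (n - j)).
  elim: j => [|j IH] jn; first by rewrite subn0.
  by apply: step; rewrite -subSn // subSS; apply/IH/ltnW.
have [_ [w' hw' Ew']] := ID n (leqnn n).
exists e, D, w'; split=> //; first by move: hw'; rewrite subnn mulr0n addr0.
by rewrite -Ew' subnn expr0 mulr1.
Qed.

(** The fractions with primitive denominators form the Gauss extension of the trace of [O]; those
    with numerators over the maximal ideal form a proper ideal. Chevalley's theorem then extends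
    this pair from [K(t)] to the whole ring. *)
Lemma gauss_extension K O g t : hfield K -> hval O -> hom g t -> transcendental K g t ->
  exists V, [/\ hval V, O `&` K `<=` V, V t, maxid O `&` K `<=` maxid V &
    forall d p, hpoly (O `&` K) g d p -> prim O p -> V p.[t]^-1].
Proof.
move=> fK OO ht tK; have [KK Kinv] := fK.
have AA := hval_setI OO KK; set A := O `&` K in AA *.
pose J := maxid O `&` K; pose Q d := [set p | hpoly A g d p /\ prim O p].
have AK : A `<=` K by move=> x [].
have AO : A `<=` O by move=> x [].
have JA : J `<=` A by move=> x [[Ox _] Kx]; split.
have prim_neq0 p : prim O p -> p != 0.
  move=> [j [_ mj]]; apply/eqP => p0; apply: mj; rewrite p0 coef0; exact: maxid0.
have dQ : denominators A g t Q.
  split.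
  - split; first by apply: hpC => //; [exact: hring_hadd|case: AA|exact: hom1].
    by exists 0; rewrite coefC eqxx; split; [case: OO => [[]]|exact: maxid_not1].
  - move=> e e' v v' [hv pv] [hv' pv']; split; first exact: hpMr.
    by apply: (gauss OO _ _ pv pv'); [apply: hp_sub hv | apply: hp_sub hv'].
  - by move=> e v [].
  - move=> e v [hv pv]; apply: tK (prim_neq0 _ pv); exact: hp_sub hv.
have JJ : hadd J.
  have [m0 mB] := maxid_hadd OO; have [_ _ _ [K0 KB]] := KK.
  split; first by split.
  by move=> h x y [mx Kx] [my Ky] hx hy; split; [apply: mB hx hy | apply: KB hx hy].
have AJ a b : A a -> J b -> J (a * b).
  move=> [Oa Ka] [mb Kb]; split; first exact: maxidM.
  by case: KK => _ _ KM _; apply: KM.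
have BB := fr_hring AA dQ.
have II : hideal (fractions A Q g t) (fractions J Q g t).
  split.
  - move=> x [h [e [u [v [hx Qv hu E]]]]].
    by exists h, e, u, v; split=> //; apply: hp_sub hu.
  - by apply: (fr_hadd dQ).
  - by move=> b x; apply: (fr_mul dQ) => //.
  - move=> f1; have [e [u [v [[hv pv] hu E]]]] := frP dQ (proj1 JJ) f1 (hom1 gr).
    rewrite addr0 mul1r in hu E.
    (* Transcendence of [t] turns equal values into equal polynomials, but [u] has its coefficients
       in the maximal ideal and [v] is primitive. *)
    have vu : v = u.
      apply/eqP; rewrite -subr_eq0; apply/negPn/negP => n0.
      have hvu : hpoly K g e (v - u).
        apply: hpB; [exact: hring_hadd|exact: hp_sub hv|].
        by apply: hp_sub hu; apply: subset_trans AK.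
      by have := tK _ _ hvu n0; rewrite hornerD hornerN E subrr eqxx.
    by have [j [_ mj]] := pv; apply: mj; rewrite vu; have [[]] := hu j.
have [V [VV AV IV]] := chevalley BB II; exists V; split=> //.
- by apply: subset_trans AV; apply: fr_sub => //.
- by apply: AV; apply: fr_gen.
- apply: subset_trans IV => x Jx.
  have [h hx] := hval_homg OO (proj1 (proj1 Jx)).
  exists h, 0, x%:P, 1; rewrite !hornerC mulr1 add0r; split=> //; first by case: dQ.
  exact: hpC.
- by move=> d p hp_ pp; apply: AV; apply: (fr_denomV ht dQ (e := d)); split.
Qed.

(** The elements sought are the coefficients of [w] in [c = w(t) / D(t)] with [D] over [k]. For [O]
    in [U] the Gauss extension [V] contains [k(t)] and lies in [U], so it contains [w(t)], which
    amounts to the content of [w] being in [O]. *)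
Lemma transcendental_descent k K g t U c : hfield k -> hfield K -> k `<=` K ->
  hom g t -> transcendental K g t -> upclosed k K U -> U homg -> frac K g t c ->
  (forall V, hval V -> frac k g t `<=` V -> U V -> V c) ->
  exists C : seq R, [/\ forall x, x \in C -> K x,
    forall V, hval V -> k `<=` V -> U V -> forall x, x \in C -> V x &
    forall V, hval V -> frac k g t `<=` V -> (forall x, x \in C -> V x) -> V c].
Proof.
move=> fk fK kK ht tK upU UT fc H; have [kk kinv] := fk; have [KK Kinv] := fK.
have Kh := hfield_homg fK.
have [q hc] : homg c by have [h [? [? [? [hx _ _ _]]]]] := fc; exists h.
have dQ := fq_denominators kk KK kK ht.
(* A valuation ring containing this localization contains [k(t)] and [K]; containing [K], it
   satisfies [U] as the trivial one does. *)
have ic : integ (fractions K (nonvanishing k g t) g t) q c.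
  apply: integ_of_hval => //; first exact: fr_hring.
  move=> V VV fV.
  have KV : K `<=` V by apply: subset_trans fV; apply: fr_sub.
  apply: H => //.
    apply: subset_trans fV => x [h [e [u [v [hx Qv hu E]]]]].
    by exists h, e, u, v; split=> //; apply: hp_sub hu.
  apply: (upU homg) => //; [exact: hval_homgT| | |].
  - exact: subset_trans Kh.
  - exact: subset_trans KV.
  - by move=> x [_ /KV].
have [e [D [w [hD D0 hw E]]]] := integral_denominator fk fK kK ht tK hc fc ic.
have UD := homU gr (hp_hom ht hD) D0.
exists (polyseq w); split.
- by move=> x /(nthP 0)[i _ <-]; case: (hw i).
- move=> O OO kO UO x /(nthP 0)[i _ <-].
  have [w0|w0] := eqVneq w 0; first by rewrite w0 coef0; apply: hval0.
  have [V [VV OV Vt mV pV]] := gauss_extension fK OO ht tK.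
  have kOK : k `<=` O `&` K by move=> y ky; split; [apply: kO | apply: kK].
  have kV : k `<=` V by apply: subset_trans OV.
  have fV : frac k g t `<=` V.
    apply: (fr_min ht (frac_denominators kk ht) (hval_hring VV) kV Vt) => e' v [hv v0].
    apply: (pV e'); first exact: hp_sub hv.
    have vn0 : v != 0 by apply: contraNneq v0 => ->; rewrite horner0.
    have lv : lead_coef v != 0 by rewrite lead_coef_eq0.
    have [kl _] := hv (size v).-1; rewrite -lead_coefE in kl.
    exists (size v).-1; rewrite -lead_coefE; split; first exact: kO.
    by move=> [_ /(_ lv)]; apply; apply/kO/kinv.
  have Vc : V c by apply: H => //; apply: (upU O).
  have [j [a0 Oa]] := hval_content OO hw w0; set a := w`_j in a0 Oa.
  have [Ka ha] := hw j; rewrite -/a in Ka ha; have Ua := homU gr ha a0.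
  (* Otherwise [a^-1] is in the maximal ideal of [O], hence of [V]; but [V] contains [a], which is
     [c D(t)] times the inverse of the value of the primitive [p]. *)
  suff Oaa : O a by rewrite -(divrK Ua w`_i); apply: hvalM.
  apply: contrapT => nO; have [_ mai] := notin_hval OO (Kh _ Ka) nO.
  have [Vai] : maxid V a^-1 by apply: mV; split=> //; apply: Kinv.
  rewrite (homg_neq0V (Kh _ Ka) a0) invrK => /(_ isT); apply.
  pose p := a^-1%:P * w.
  have hpp : hpoly (O `&` K) g (g *+ j) p.
    move=> l; have [Kl hl] := hw l; rewrite coefCM mulrC; split.
      by split=> //; case: KK => _ _ KM _; apply: KM => //; apply: Kinv.
    have -> : g *+ j - g *+ l = (e + q - g *+ l) - (e + q - g *+ j).
      by rewrite opprB [RHS]addrC addrA subrK.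
    by apply: homM => //; apply: homV.
  have pp : prim O p.
    by exists j; rewrite coefCM mulVr //; split; [case: OO => [[]]|exact: maxid_not1].
  have -> : a = c * D.[t] * p.[t]^-1.
    have pt0 : p.[t] != 0.
      apply: (tK (g *+ j)); first by apply: hp_sub hpp => y [].
      by apply/eqP => p0; have := maxid_not1 OO; case; have [l []] := pp; rewrite p0 coef0 => _ []; apply: maxid0.
    have Up := homU gr (hp_hom ht hpp) pt0.
    by apply: (mulIr Up); rewrite mulrVK // E hornerM hornerC mulrA mulrV // mul1r.
  apply: hvalM => //; last exact: pV hpp pp.
  by apply: hvalM => //; apply: fV; apply: (fr_denom ht (frac_denominators kk ht) (e := e)); split.
- move=> V VV fV CV; rewrite -(mulrK UD c) E; apply: hvalM => //; last first.
    by apply: fV; apply: (fr_denomV ht (frac_denominators kk ht) (e := e)); split.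
  have Vt : V t by apply/fV/frac_gen.
  have hwV : hpoly V g (e + q) w.
    move=> i; have [_ hi] := hw i; split=> //.
    have [lt|ge] := ltnP i (size w); first by apply: CV; rewrite mem_nth.
    by rewrite nth_default //; apply: hval0.
  by have [] := hp_horner (hval_hring VV) (@subset_refl _ _) ht Vt hwV.
Qed.

(** * Adjoining finitely many elements of l *)

Definition gen (k : set R) (s : seq R) : set R :=
  [set x | forall F, hfield F -> k `<=` F -> (forall y, y \in s -> F y) -> F x].

Lemma homg_hfield : hfield homg.
Proof. by split; [exact: homg_hring | exact: homgV]. Qed.

Lemma gen_hfield k s : hfield k -> (forall y, y \in s -> homg y) -> hfield (gen k s).
Proof.
move=> fk hs; have kh := hfield_homg fk; have [[_ k1 _ [k0 _]] _] := fk; split.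
  split.
  - by move=> x; apply=> //; exact: homg_hfield.
  - by move=> F _ kF _; apply: kF.
  - by move=> x y gx gy F fF kF sF; case: (fF) => [[_ _ h _] _]; apply: h; [apply: gx|apply: gy].
  - split; first by move=> F _ kF _; apply: kF.
    move=> g x y gx gy hx hy F fF kF sF; case: (fF) => [[_ _ _ [_ h]] _].
    by apply: h hx hy; [apply: gx|apply: gy].
by move=> x gx x0 F fF kF sF; case: (fF) => _; apply=> //; apply: gx.
Qed.

Lemma gen_sub k s : k `<=` gen k s.
Proof. by move=> x kx F _ kF _; apply: kF. Qed.

Lemma gen_mem k s y : y \in s -> gen k s y.
Proof. by move=> ys F _ _; apply. Qed.

(** This is the algebraic closure of [k] in the graded field. For inverses: if [x] were a nonunit of
    [V], the lowest nonzero coefficient of its monic equation over [k] would be a sum of multiples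
    of [x], thus a nonunit, although it is a unit of [k]. *)
Lemma algebraic_closure_hfield k : hfield k ->
  hfield [set x | homg x /\ forall V, hval V -> k `<=` V -> V x].
Proof.
move=> fk; have [kk kinv] := fk; have [kh k1 _ [k0 _]] := kk; split.
  split.
  - by move=> x [].
  - by split; [exists 0; apply: hom1 | move=> V _; apply].
  - move=> x y [hx Hx] [hy Hy]; split; first by case: homg_hring => _ _ h _; apply: h.
    by move=> V VV kV; apply: hvalM; [|apply: Hx|apply: Hy].
  - split; first by split; [exists 0; apply: hom0 | move=> V _; apply].
    move=> g x y [_ Hx] [_ Hy] hx hy; split; first by exists g; apply: homB.
    by move=> V VV kV; case: (VV) => [[_ _ _ [_ h]] _]; apply: h hx hy; [apply: Hx|apply: Hy].
move=> x [hgx Hx] x0; split; first exact: homgV.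
move=> V VV kV; have [g hx] := hgx; apply: contrapT => nV.
have Vx := Hx V VV kV; have mx : maxid V x by split.
have [n [r [hr sr er]]] := integ_of_hval kk hx Hx.
have [mP sP] := monic_XnB sr; set P := 'X^n - r in mP sP.
have hP : hpoly k g (g *+ n) P by apply: hpB; [exact: hring_hadd|exact: hpXn|].
have exj : exists j, P`_j != 0.
  by exists n; have /monicP := mP; rewrite lead_coefE sP /= => ->; rewrite oner_neq0.
have [j j0 jmin] := ex_minnP exj.
have jn : (j < n.+1)%N.
  by rewrite ltnS; apply: jmin; have /monicP := mP; rewrite lead_coefE sP /= => ->; rewrite oner_neq0.
have [kj hj] := hP j; have Ux := homU gr hx x0.
have Px : P.[x] = 0 by rewrite hornerD hornerN hornerXn er subrr.
have mj : maxid V P`_j.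
  have -> : P`_j = - \sum_(i < n.+1 | i != Ordinal jn) P`_i * x ^+ i / x ^+ j.
    apply/eqP; rewrite -addr_eq0; apply/eqP/(mulIr (unitrX j Ux)).
    rewrite mul0r mulrDl mulr_suml -[RHS]Px horner_coef sP [in RHS](bigD1 (Ordinal jn)) //=; congr (_ + _).
    by apply: eq_bigr => i _; rewrite divrK // unitrX.
  have hF (i : 'I_n.+1) : i != Ordinal jn ->
      maxid V (P`_i * x ^+ i / x ^+ j) /\ hom (g *+ n - g *+ j) (P`_i * x ^+ i / x ^+ j).
    move=> ij; have [ki hi] := hP i; have [lt|gt|eq] := ltngtP i j.
    - have -> : P`_i = 0.
        by apply/eqP; apply/negPn/negP => /jmin; rewrite leqNgt lt.
      by rewrite !mul0r; split; [apply: maxid0|apply: hom0].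
    - split.
        rewrite -[in x ^+ i](subnKC gt) exprD exprS.
        have -> : P`_i * (x * x ^+ j * x ^+ (i - j.+1)) / x ^+ j = (P`_i * x ^+ (i - j.+1)) * x.
          have -> : P`_i * (x * x ^+ j * x ^+ (i - j.+1)) = P`_i * x ^+ (i - j.+1) * x * x ^+ j by ring.
          by rewrite mulrK // unitrX.
        by apply: maxidM => //; apply: hvalM; [|apply: kV|apply: hringX => //; apply: hval_hring].
      have -> : g *+ n - g *+ j = (g *+ n - g *+ i) + g *+ i - g *+ j by rewrite subrK.
      apply: homM => //; first by apply: homM => //; apply: homX.
      by apply: homV; [|apply: homX|apply: homgX_neq0].
    - by case/eqP: ij; apply: val_inj.
  apply: (haddN (maxid_hadd VV) (g := g *+ n - g *+ j)).
    exact: (hadd_sum (d := g *+ n - g *+ j) (maxid_hadd VV)).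
  by apply: hom_sum => i /hF[].
by case: mj => _ /(_ j0); apply; apply/kV/kinv.
Qed.

(** An algebraic generator [t] lies in every valuation ring over [k], so it is omitted. For a
    transcendental one the induction runs over [k(t)] and [K(t)] with the same [U] and [V0], and
    each of the finitely many elements found in [K(t)] is brought down to [K]. The hypothesis
    [U homg] says that the open set contains the generic point. *)
Theorem descent (s : seq R) : forall k K U V0 h, (forall y, y \in s -> homg y) ->
  hfield k -> hfield K -> k `<=` K -> hval V0 -> gen k s `<=` V0 -> minval k K V0 ->
  upclosed k K U -> U homg -> homg h ->
  (forall V, hval V -> gen k s `<=` V -> U V -> V h) ->
  exists C : seq R, [/\ forall x, x \in C -> K x,
    forall V, hval V -> k `<=` V -> U V -> forall x, x \in C -> V x &
    forall V, hval V -> gen k s `<=` V -> (forall x, x \in C -> V x) -> V h].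
Proof.
elim: s => [|t s IH] k K U V0 h hs fk fK kK VV0 gV0 mV0 upU UT hh H.
  have gk : gen k [::] = k.
    by rewrite eqEsubset; split; [move=> x; apply | apply: gen_sub].
  rewrite gk in H *; have [C [C1 C2 C3]] := algebraic_descent fK kK upU UT hh H.
  by exists C; split=> // V VV _; apply: C3.
have [kk _] := fk; have [g ht] := hs t (mem_head _ _).
have {}hs y : y \in s -> homg y by move=> ys; apply: hs; rewrite inE ys orbT.
have gs : gen k s `<=` gen k (t :: s).
  by move=> x gx F fF kF sF; apply: gx => // y ys; apply: sF; rewrite inE ys orbT.
have [tk|ntk] := pselect (transcendental k g t); last first.
  have it := not_transcendental fk ht ntk.
  have gV V : hval V -> gen k s `<=` V -> gen k (t :: s) `<=` V.
    move=> VV gV x gx; have fg := gen_hfield fk hs.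
    set F := [set x | homg x /\ forall V, hval V -> gen k s `<=` V -> V x].
    have kF : k `<=` F.
      move=> y ky; split; first exact: hfield_homg ky.
      by move=> W _; apply; apply: gen_sub.
    have sF y : y \in t :: s -> F y.
      rewrite inE => /orP[/eqP->|ys].
        split; first by exists g.
        move=> W WW gW; apply: integ_hval it => //; apply: subset_trans gW; exact: gen_sub.
      by split; [apply: hs | move=> W _; apply; apply: gen_mem].
    by have [_ h'] := gx F (algebraic_closure_hfield fg) kF sF; apply: h'.
  have [||C [C1 C2 C3]] := IH k K U V0 h hs fk fK kK VV0 _ mV0 upU UT hh.
  - exact: subset_trans gV0.
  - by move=> V VV gsV; apply: H => //; apply: gV.
  by exists C; split=> // V VV gsV; apply: C3 => //; apply: subset_trans gsV.
have ft : frac k g t `<=` gen k (t :: s).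
  move=> x; apply: frac_min => //.
  - by apply: gen_hfield => // y; rewrite inE => /orP[/eqP->|/hs //]; exists g.
  - exact: gen_sub.
  - by apply: gen_mem; rewrite mem_head.
have fV0 : frac k g t `<=` V0 by apply: subset_trans gV0.
have tK := transcendental_ext fk fK VV0 mV0 ht fV0 tk.
have mV1 := minval_frac fk fK VV0 mV0 ht fV0 tk.
have gE : gen (frac k g t) s = gen k (t :: s).
  rewrite eqEsubset; split=> x gx F fF kF sF.
    apply: gx => //.
      by apply: frac_min => //; apply: sF; rewrite mem_head.
    by move=> y ys; apply: sF; rewrite inE ys orbT.
  apply: gx => //; first by apply: subset_trans kF; apply: frac_sub.
  by move=> y; rewrite inE => /orP[/eqP->|/sF //]; apply/kF/frac_gen.
have upU1 : upclosed (frac k g t) (frac K g t) U.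
  move=> V W VV WW kV kW UV VW; apply: (upU V) => //.
  - by apply: subset_trans kV; apply: frac_sub.
  - by apply: subset_trans kW; apply: frac_sub.
  - by move=> x [Vx Kx]; apply: VW; split=> //; apply: frac_sub.
have [||C [C1 C2 C3]] := IH _ _ U V0 h hs (frac_hfield fk ht) (frac_hfield fK ht) (frac_mono kK) VV0 _ mV1 upU1 UT hh.
- by rewrite gE.
- by rewrite gE.
have {C1 C2} CC c : c \in C -> exists E : seq R, [/\ forall x, x \in E -> K x,
    forall V, hval V -> k `<=` V -> U V -> forall x, x \in E -> V x &
    forall V, hval V -> frac k g t `<=` V -> (forall x, x \in E -> V x) -> V c].
  move=> cC; apply: (transcendental_descent fk fK kK ht tK upU UT); first exact: C1.
  by move=> V VV fV UV; apply: C2.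
have {CC} [E [E1 E2 E3]] : exists E : seq R, [/\ forall x, x \in E -> K x,
    forall V, hval V -> k `<=` V -> U V -> forall x, x \in E -> V x &
    forall V, hval V -> frac k g t `<=` V -> (forall x, x \in E -> V x) -> forall c, c \in C -> V c].
  elim: {C3} C CC => [|c C IHC] CC; first by exists [::].
  have [x xC|E [E1 E2 E3]] := IHC; first by apply: CC; rewrite inE xC orbT.
  have [E' [E1' E2' E3']] := CC c (mem_head _ _).
  exists (E' ++ E); split.
  - by move=> x; rewrite mem_cat => /orP[/E1'|/E1].
  - by move=> V VV kV UV x; rewrite mem_cat => /orP[/(E2' V)|/(E2 V)]; apply.
  - move=> V VV fV EV x; rewrite inE => /orP[/eqP->|xC].
      by apply: E3' => // y yE; apply: EV; rewrite mem_cat yE.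
    by apply: E3 xC => // y yE; apply: EV; rewrite mem_cat yE orbT.
exists E; split=> // V VV gV EV; apply: C3 => //; first by rewrite gE.
by apply: E3 => //; apply: subset_trans gV.
Qed.

End HomogeneousSets.

(** * Graded fields and the spaces P_{K/k} *)

Section UnitRing.
Variable R : comNzRingType.

(* The carriers of graded fields are only [comNzRingType]s; a classical choice of
   inverses gives access to the theory of units. *)
Definition invertible : {pred R} := fun x => `[< exists y, y * x = 1 >].

Definition classical_inv (x : R) : R :=
  if pselect (exists y, y * x = 1) is left e then sval (cid e) else x.

Lemma classical_mulVx : {in invertible, left_inverse 1 classical_inv *%R}.
Proof.
move=> x /asboolP ex; rewrite /classical_inv; case: pselect => [e|//].
exact: svalP (cid e).
Qed.

Lemma classical_unitPl (x y : R) : y * x = 1 -> invertible x.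
Proof. by move=> e; apply/asboolP; exists y. Qed.

Lemma classical_inv_out : {in [predC invertible], classical_inv =1 id}.
Proof. by move=> x; rewrite /classical_inv !inE => /asboolPn n; case: pselect. Qed.

Definition classical_unitRing : comUnitRingType :=
  HB.pack_for comUnitRingType (GRing.ComNzRing.sort R)
    (GRing.ComNzRing_hasMulInverse.Build R classical_mulVx classical_unitPl classical_inv_out).

End UnitRing.

(** * Homogeneous components and the graded subrings they determine *)

Section Decompositions.
Variables (G : zmodType) (R : comNzRingType) (hom : G -> set R).
Hypothesis gf : graded_field hom.

Let hom_0 g : hom g 0. Proof. by case: gf => [[]]. Qed.
Let hom_B g x y : hom g x -> hom g y -> hom g (x - y).
Proof. by case: gf => [[_ h _ _] _]; apply: h. Qed.

Lemma sum_pad (s u : seq G) (c : G -> R) : uniq s -> uniq u -> {subset s <= u} ->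
  \sum_(g <- u) (if g \in s then c g else 0) = \sum_(g <- s) c g.
Proof.
move=> us uu su; have e : perm_eq [seq g <- u | g \in s] s.
  apply: uniq_perm => //; first exact: filter_uniq.
  by move=> g; rewrite mem_filter; case: (boolP (g \in s)) => //= /su.
by rewrite -big_mkcond -big_filter; apply: (perm_big _ e).
Qed.

Lemma is_decomp_uniq x s c s' c' : is_decomp hom x s c -> is_decomp hom x s' c' ->
  forall g, (if g \in s then c g else 0) = (if g \in s' then c' g else 0).
Proof.
move=> [us hc xs] [us' hc' xs'] g.
pose u := undup (s ++ s').
have uu : uniq u by apply: undup_uniq.
have su : {subset s <= u} by move=> i h; rewrite mem_undup mem_cat h.
have su' : {subset s' <= u} by move=> i h; rewrite mem_undup mem_cat h orbT.
pose d i := (if i \in s then c i else 0) - (if i \in s' then c' i else 0).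
have hd i : hom i (d i) by apply: hom_B; case: ifP.
have d0 : \sum_(i <- u) d i = 0.
  by rewrite sumrB sum_pad // sum_pad // -xs -xs' subrr.
have [gu|gu] := boolP (g \in u).
  by apply/eqP; rewrite -subr_eq0; apply/eqP; case: gf => _ [_ [h _]]; exact: (h u d uu hd d0 g gu).
have gs : g \notin s by apply: contra gu => /su.
have gs' : g \notin s' by apply: contra gu => /su'.
by rewrite (negPf gs) (negPf gs').
Qed.

Definition single g (x : R) : G -> R := fun h => if h == g then x else 0.

Lemma is_decomp_single g x : hom g x -> is_decomp hom x [:: g] (single g x).
Proof.
move=> hx; split=> //; last by rewrite big_seq1 /single eqxx.
by move=> h; rewrite /single; case: eqP => [->|_].
Qed.

(** Invertibility is assumed without degrees; comparing the parts of degree 0 in [x y = 1] shows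
    that the component of [y] in degree [- g] is already an inverse. *)
Lemma graded_inverse g x : hom g x -> x != 0 -> exists2 y, hom (- g) y & y * x = 1.
Proof.
move=> hx x0; have [[_ _ h1 hM] [dec [_ inv]]] := gf.
have [y xy] := inv g x hx x0; have [s [c [us hc yE]]] := dec y.
exists (c (- g)) => //.
have d1 : is_decomp hom 1 [seq g + h | h <- s] (fun h => x * c (h - g)).
  split.
  - by rewrite map_inj_uniq //; apply: addrI.
  - by move=> h; rewrite -[h in hom h](subrKC g); apply: hM.
  - rewrite big_map -xy yE mulr_sumr; apply: eq_bigr => h _.
    by rewrite addrC addKr.
have := is_decomp_uniq d1 (is_decomp_single h1) 0.
rewrite mem_seq1 eqxx /single eqxx sub0r mulrC; case: ifP => // _ e.
by have := oner_neq0 R; rewrite -e eqxx.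
Qed.

Lemma graded_field_units : graded_units (hom : G -> set (classical_unitRing R)).
Proof.
have [[_ _ h1 hM] _] := gf; split=> //.
- move=> g x hx x0; have [y _ yx] := graded_inverse hx x0.
  by apply/asboolP; exists y.
- move=> g x hx x0; have [y hy yx] := graded_inverse hx x0.
  have Ux : (x : classical_unitRing R) \is a GRing.unit by apply/asboolP; exists y.
  suff <- : (y : classical_unitRing R) = x^-1 by [].
  by apply: (mulIr Ux); rewrite mulVr.
- move=> g h x hx hy x0; have := is_decomp_uniq (is_decomp_single hx) (is_decomp_single hy) g.
  rewrite !mem_seq1 eqxx /single eqxx; case: eqP => // _ e.
  by rewrite e eqxx in x0.
Qed.

Definition hpart (S : set R) : set (classical_unitRing R) :=
  [set x | homogeneous hom x /\ S x].

(** The way back from [hpart]: a graded subring is the additive span of its homogeneous elements. *)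
Definition hspan (V : set (classical_unitRing R)) : set R :=
  [set x | exists l : seq R, (forall y, y \in l -> V y) /\ x = \sum_(y <- l) y].

Local Notation uhom := (hom : G -> set (classical_unitRing R)).
Let gr := graded_field_units.

Lemma hspan_decomp V x : V `<=` homogeneous uhom -> hadd uhom V -> hspan V x ->
  exists s c, is_decomp hom x s c /\ forall g, V (c g).
Proof.
move=> Vh VA [l [lV ->]]; have V0 := proj1 VA.
elim: l lV => [|y l IH] lV.
  by exists [::], (fun=> 0); rewrite big_nil; split=> //; split=> //; rewrite big_nil.
have [s [c [[us hc e] Vc]]] := IH (fun z zl => lV z (mem_behead (s := y :: l) zl)).
have [g hy] := Vh y (lV y (mem_head _ _)).
pose u := undup (g :: s).
have h1 i : hom i (if i \in s then c i else 0) by case: ifP.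
have h2 i : hom i (single g y i) by have [_ h _] := is_decomp_single hy.
exists u, (fun i => (if i \in s then c i else 0) + single g y i); split; first split.
- exact: undup_uniq.
- by move=> i; apply: (homD gr).
- rewrite big_cons e big_split /= addrC sum_pad ?undup_uniq //; last first.
    by move=> i is_; rewrite mem_undup inE is_ orbT.
  congr (_ + _); have gu : {subset [:: g] <= u}.
    by move=> i; rewrite mem_seq1 => /eqP->; rewrite mem_undup mem_head.
  have := sum_pad (fun=> y) (isT : uniq [:: g]) (undup_uniq _) gu; rewrite big_seq1 => {1}<-.
  by apply: eq_bigr => i _; rewrite mem_seq1.
- move=> i; apply: (haddD gr VA _ _ (h1 i) (h2 i)); first by case: ifP.
  by rewrite /single; case: ifP => // _; apply: lV; rewrite mem_head.
Qed.

Lemma hspan_mem V x : V x -> hspan V x.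
Proof.
move=> Vx; exists [:: x]; rewrite big_seq1; split=> // y.
by rewrite mem_seq1 => /eqP->.
Qed.

Lemma hspan_decomp_mem V x s c : V `<=` homogeneous uhom -> hadd uhom V -> hspan V x ->
  is_decomp hom x s c -> forall g, g \in s -> V (c g).
Proof.
move=> Vh VA Vx dx g gs; have [s' [c' [dx' Vc]]] := hspan_decomp Vh VA Vx.
have := is_decomp_uniq dx dx' g; rewrite gs => ->.
by case: ifP => // _; case: VA.
Qed.

Lemma hspan_homog V x : V `<=` homogeneous uhom -> hadd uhom V -> hspan V x ->
  homogeneous hom x -> V x.
Proof.
move=> Vh VA Vx [g hx]; have := hspan_decomp_mem Vh VA Vx (is_decomp_single hx) (mem_head g _).
by rewrite /single eqxx.
Qed.

Lemma graded_subring_span S : subring_set S -> graded_set hom S -> S = hspan (hpart S).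
Proof.
move=> [S1 SB SM] SG; rewrite eqEsubset; split=> x.
  have [_ [dec _]] := gf; have [s [c dx]] := dec x => Sx; exists (map c s).
  split; last by case: dx => _ _; rewrite big_map.
  move=> _ /mapP[g gs ->]; split; first by exists g; case: dx.
  exact: SG dx g gs.
have S0 : S 0 by rewrite -(subrr 1); apply: SB.
move=> [l [lS ->]]; elim: l lS => [|y l IH] lS; first by rewrite big_nil.
rewrite big_cons -[\sum_(_ <- _) _]opprK; have [_ Sy] := lS y (mem_head _ _).
apply: (SB) => //; rewrite -sub0r; apply: (SB) => //.
by apply: IH => z zl; apply: lS; rewrite inE zl orbT.
Qed.

Lemma hpart_inj S S' : subring_set S -> graded_set hom S ->
  subring_set S' -> graded_set hom S' -> hpart S = hpart S' -> S = S'.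
Proof.
by move=> rS gS rS' gS' e; rewrite (graded_subring_span rS gS) e -graded_subring_span.
Qed.

Lemma hpart_hring S : subring_set S -> hring uhom (hpart S).
Proof.
have [[h0 hB h1 hM] _] := gf; move=> [S1 SB SM]; split.
- by move=> x [].
- by split=> //; exists 0.
- by move=> x y [[g hx] Sx] [[h hy] Sy]; split; [exists (g + h); apply: hM | apply: SM].
- split; first by split; [exists 0 | rewrite -(subrr 1); apply: SB].
  by move=> g x y [_ Sx] [_ Sy] hx hy; split; [exists g; apply: hB | apply: SB].
Qed.

Lemma mul1_inv (x y : R) : x * y = 1 -> y = (x : classical_unitRing R)^-1.
Proof.
move=> xy; have Ux : (x : classical_unitRing R) \is a GRing.unit.
  by apply/asboolP; exists y; rewrite mulrC.
by apply: (mulrI Ux); rewrite mulrV.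
Qed.

Lemma gvr_hval k O : gvr hom k O -> hval uhom (hpart O).
Proof.
move=> [rO gO kO vO]; split; first exact: hpart_hring.
move=> x hx x0; have [Ox|[y Oy /mul1_inv yE]] := vO x hx x0; first by left.
by right; rewrite -yE; split=> //; rewrite yE; apply: (homgV gr).
Qed.

Lemma subfield_hfield k : graded_subfield hom k -> hfield uhom (hpart k).
Proof.
move=> [rk gk ik]; split; first exact: hpart_hring.
move=> x [hx kx] x0; have [y ky /mul1_inv yE] := ik x hx x0 kx.
by rewrite -yE; split=> //; rewrite yE; apply: (homgV gr).
Qed.

Lemma hpart_span V : V `<=` homogeneous uhom -> hadd uhom V -> hpart (hspan V) = V.
Proof.
move=> Vh VA; rewrite eqEsubset; split=> x; first by move=> [hx Vx]; apply: hspan_homog.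
by move=> Vx; split; [apply: Vh | apply: hspan_mem].
Qed.

Lemma hval_gvr k V : graded_set hom k -> hval uhom V -> hpart k `<=` V ->
  gvr hom k (hspan V).
Proof.
move=> gk VV kV; have [[Vh V1 VM VA] Vv] := VV; split.
- split; first exact: hspan_mem.
  + move=> x y [l [lV ->]] [l' [lV' ->]]; exists (l ++ map -%R l').
    split; last by rewrite big_cat big_map /= sumrN.
    move=> z; rewrite mem_cat => /orP[/lV //|/mapP[z' /lV' Vz' ->]].
    by have [h hz'] := Vh _ Vz'; apply: (haddN gr VA Vz' hz').
  + move=> x y [l [lV ->]] [l' [lV' ->]]; exists [seq a * b | a <- l, b <- l'].
    split; last by rewrite big_allpairs_dep mulr_suml; apply: eq_bigr => a _; rewrite mulr_sumr.
    by move=> z /allpairsP[[a b] /= [/lV Va /lV' Vb ->]]; apply: VM.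
- by move=> x s c Vx dx g gs; apply/hspan_mem/(hspan_decomp_mem Vh VA Vx dx).
- move=> x kx; have [_ [dec _]] := gf; have [s [c dx]] := dec x; exists (map c s).
  split; last by case: dx => _ _; rewrite big_map.
  move=> _ /mapP[g gs ->]; apply: kV; split; first by exists g; case: dx.
  exact: gk dx g gs.
- move=> x hx x0; have [Vx|Vx] := Vv x hx x0; first by left; apply: hspan_mem.
  right; exists ((x : classical_unitRing R)^-1); first exact: hspan_mem.
  by rewrite (mulrV (homgU gr hx x0)).
Qed.

End Decompositions.

(** * Limits of valuation rings along ultrafilters *)

Section Ultra.
Variables (G : zmodType) (R : comUnitRingType) (hom : G -> set R).
Variables (T : Type) (v : T -> set R).
Hypothesis hv : forall t, hval hom (v t).

Lemma fip_ultra (S : set R) (N : set T) :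
  (forall s : seq R, (forall x, x \in s -> S x) -> exists t, N t /\ forall x, x \in s -> v t x) ->
  exists F : set_system T, [/\ UltraFilter F, F N & forall x, S x -> F [set t | v t x]].
Proof.
move=> fip; pose B (s : seq R) := [set t | N t /\ forall x, x \in s -> v t x].
pose D := [set s : seq R | forall x, x \in s -> S x].
have FB : ProperFilter (filter_from D B).
  apply: filter_from_proper; last by move=> s /fip.
  apply: filter_from_filter; first by exists [::].
  move=> s s' Ds Ds'; exists (s ++ s').
    by move=> x; rewrite mem_cat => /orP[/Ds|/Ds'].
  move=> t [Nt vt]; split; split=> // x xs; apply: vt; rewrite mem_cat xs ?orbT //.
have [F [UF sF]] := ultraFilterLemma FB; exists F; split=> //.
  by apply: sF; exists [::] => // t [].
move=> x Sx; apply: sF; exists [:: x]; first by move=> y; rewrite mem_seq1 => /eqP->.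
by move=> t [_]; apply; rewrite mem_head.
Qed.

(** The ring axioms hold for the limit along any proper filter; maximality is what decides between
    [x] and [x^-1]. *)
Lemma ultra_hval (F : set_system T) : UltraFilter F ->
  hval hom [set x | F [set t | v t x]].
Proof.
move=> UF; have PF : ProperFilter F := @ultra_proper _ _ UF.
have all (P : T -> Prop) : (forall t, P t) -> F [set t | P t].
  by move=> H; apply: filterS filterT => t _; apply: H.
split; first split.
- move=> x Fx; have [t vx] := filter_ex Fx; exact: hval_homg (hv t) vx.
- by apply: all => t; case: (hv t) => [[]].
- by move=> x y Fx Fy; apply: filterS2 Fx Fy => t vx vy; apply: hvalM.
- split; first by apply: all => t; apply: hval0.
  move=> g x y Fx Fy hx hy; apply: filterS2 Fx Fy => t vx vy.
  by case: (hv t) => [[_ _ _ [_ h]] _]; apply: h hx hy.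
move=> x hx x0; have [Fx|nFx] := in_ultra_setVsetC [set t | v t x] UF; first by left.
right; apply: filterS nFx => t /= nx.
by have [//|] := proj2 (hv t) x hx x0.
Qed.

Lemma hval_fip (S : set R) h : (forall V, hval hom V -> S `<=` V ->
    (forall x, (forall t, v t x) -> V x) -> V h) ->
  exists s : seq R, (forall x, x \in s -> S x) /\
    forall t, (forall x, x \in s -> v t x) -> v t h.
Proof.
move=> H; apply: contrapT => nH.
have [|F [UF FN FS]] := @fip_ultra S [set t | ~ v t h].
  move=> s sS; apply: contrapT => nt; apply: nH; exists s; split=> // t vt.
  by apply: contrapT => nh; apply: nt; exists t.
have PF : ProperFilter F := @ultra_proper _ _ UF.
have Fh : F [set t | v t h].
  by apply: (H _ (ultra_hval UF)) => // x vx; apply: filterS filterT => t _; apply: vx.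
by have [t [? ?]] := filter_ex (filterI Fh FN).
Qed.

End Ultra.

(** * The topology of P_{K/k} *)

Section PKk.
Variables (G : zmodType) (E : gext G).

Definition uK : comUnitRingType := classical_unitRing (gK E).
Definition uhom : G -> set uK := ghom (gtop E).

Lemma uhomP : graded_units uhom.
Proof. exact: graded_field_units (gfieldP (gtop E)). Qed.

Definition hv (O : PKk E) : set uK := hpart (ghom (gtop E)) (sval O).
Definition hk : set uK := hpart (ghom (gtop E)) (gbase E).

Lemma hv_hval (O : PKk E) : hval uhom (hv O).
Proof. exact (gvr_hval (gfieldP (gtop E)) (svalP O)). Qed.

Lemma hk_hv (O : PKk E) : hk `<=` hv O.
Proof. by case: (svalP O) => _ _ h _ x [hx kx]; split=> //; apply: h. Qed.

Lemma hk_hfield : hfield uhom hk.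
Proof. exact (subfield_hfield (gfieldP (gtop E)) (gbaseP E)). Qed.

Lemma PKk_eq (O O' : PKk E) : sval O = sval O' -> O = O'.
Proof. by case: O O' => [O p] [O' p'] /= e; subst O'; congr exist; apply: Prop_irrelevance. Qed.

Lemma hv_inj (O O' : PKk E) : (forall x, hv O x <-> hv O' x) -> O = O'.
Proof.
move=> e; apply: PKk_eq; have [r g _ _] := svalP O; have [r' g' _ _] := svalP O'.
by apply: (hpart_inj (gfieldP (gtop E)) r g r' g'); apply/funext => x; apply/propext; exact: e.
Qed.

Definition PKk_of (V : set uK) (VV : hval uhom V) (kV : hk `<=` V) : PKk E :=
  exist _ _ (let: And3 _ gk _ := gbaseP E in hval_gvr (gfieldP (gtop E)) gk VV kV).

Lemma hv_of V VV kV : hv (@PKk_of V VV kV) = V.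
Proof.
have [[Vh _ _ VA] _] := VV; exact (hpart_span (gfieldP (gtop E)) Vh VA).
Qed.

Definition basic (s : seq uK) : set (PKk E) := [set O | forall x, x \in s -> hv O x].

Lemma open_basis (A : set (PKk E)) O : open A -> A O ->
  exists s : seq uK, basic s O /\ basic s `<=` A.
Proof.
move=> oA.
have [D Dsub <-] : exists2 D : set (set (PKk E)),
  D `<=` finI_from (@Psub_dom G E) (@Psub G E) & \bigcup_(X in D) X = A := oA.
move=> [X DX XO]; have [F Fsub XF] := Dsub X DX; rewrite -XF in XO.
exists (pmap id (finmap.enum_fset F)); split.
  move=> x; rewrite mem_pmap map_id => xF.
  have /Fsub := xF; rewrite inE => -[f hf [e]]; subst f; split=> //.
  exact: (XO (Some x) xF).
move=> O' bO'; exists X => //; rewrite -XF => -[f|] /= fF //.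
by have [] : hv O' f by apply: bO'; rewrite mem_pmap map_id.
Qed.

Lemma open_hv (x : uK) : homogeneous uhom x -> open [set O : PKk E | hv O x].
Proof.
move=> hx; exists [set [set O : PKk E | hv O x]]; last by rewrite bigcup_set1.
move=> _ ->; exists (finmap.fset1 (Some x : option (gK E))).
  by move=> i; rewrite finmap.in_fset1 => /eqP->; rewrite inE; exists x.
rewrite eqEsubset; split=> O /=.
  by move=> H; split=> //; apply: (H (Some x)); rewrite /= finmap.in_fset1.
by move=> [_ Ox] i; rewrite /= finmap.in_fset1 => /eqP->.
Qed.

Lemma open_basic s : (forall x, x \in s -> homogeneous uhom x) -> open (basic s).
Proof.
elim: s => [|a s IH] hs.
  have -> : basic [::] = setT by apply/funext => O; apply/propext; split.
  exact: openT.
have -> : basic (a :: s) = [set O | hv O a] `&` basic s.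
  rewrite eqEsubset; split=> O.
    by move=> H; split; [apply: H; rewrite mem_head | move=> x xs; apply: H; rewrite inE xs orbT].
  by move=> [Oa Os] x; rewrite inE => /orP[/eqP->|/Os].
apply: openI; first by apply/open_hv/hs; rewrite mem_head.
by apply: IH => x xs; apply: hs; rewrite inE xs orbT.
Qed.

Lemma open_up (A : set (PKk E)) O O' : open A -> A O -> hv O `<=` hv O' -> A O'.
Proof. by move=> oA AO OO'; have [s [sO sA]] := open_basis oA AO; apply: sA => x /sO /OO'. Qed.

Lemma basic_homg s O : basic s O -> forall x, x \in s -> homogeneous uhom x.
Proof. by move=> bO x /bO[]. Qed.

Definition ultra_limit (F : set_system (PKk E)) (UF : UltraFilter F) : PKk E :=
  PKk_of (ultra_hval hv_hval UF)
    (fun x kx => filterS (fun O _ => hk_hv O kx) (@filterT _ F _)).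

Lemma ultra_limitE F UF x : hv (@ultra_limit F UF) x <-> F [set O | hv O x].
Proof. by rewrite hv_of. Qed.

Lemma ultra_limit_basic F UF s : basic s (@ultra_limit F UF) -> F (basic s).
Proof.
move=> bs; elim: s bs => [|a s IH] bs; first by apply: filterS filterT => O _ x.
have Fa : F [set O | hv O a] by apply/(ultra_limitE UF)/bs; rewrite mem_head.
have Fs : F (basic s) by apply: IH => x xs; apply: bs; rewrite inE xs orbT.
apply: filterS2 Fa Fs => O Oa Os x; rewrite inE => /orP[/eqP->//|]; exact: Os.
Qed.

Lemma ultra_limit_open F UF A : open A -> A (@ultra_limit F UF) -> F A.
Proof.
by move=> oA /(open_basis oA)[s [/ultra_limit_basic Fs sA]]; apply: filterS Fs.
Qed.

Lemma compact_basic s : compact (basic s).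
Proof.
rewrite compact_ultra => F UF Fs; exists (ultra_limit UF); split.
  by move=> x xs; apply/ultra_limitE; apply: filterS Fs => O; apply.
move=> B; rewrite nbhsE => -[A [oA AO] AB].
by apply: filterS AB _; apply: (ultra_limit_open (UF := UF)).
Qed.

(** Otherwise some ultrafilter contains the complement of [A] and all conditions from [S]. Its limit
    contains [S], so it lies in the open set [A], and then [A] belongs to the ultrafilter as
    well. *)
Lemma compactness (S : set uK) (A : set (PKk E)) : open A ->
  (forall O, S `<=` hv O -> A O) ->
  exists s : seq uK, (forall x, x \in s -> S x) /\ basic s `<=` A.
Proof.
move=> oA SA; apply: contrapT => nH.
have [|F [UF FN FS]] := @fip_ultra _ (PKk E) hv S (~` A).
  move=> s sS; apply: contrapT => nt; apply: nH; exists s; split=> // O sO.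
  by apply: contrapT => nA; apply: nt; exists O.
have PF : ProperFilter F := @ultra_proper _ _ UF.
have FA : F A.
  by apply: (ultra_limit_open (UF := UF)) => //; apply: SA => x Sx; apply/ultra_limitE/FS.
by have [O [? ?]] := filter_ex (filterI FA FN).
Qed.

Definition affine_union (ss : seq (seq uK)) : set (PKk E) :=
  [set O | exists2 s, s \in ss & basic s O].

Lemma compact_affine_union ss : compact (affine_union ss).
Proof.
elim: ss => [|s ss IH].
  have -> : affine_union [::] = set0 by apply/seteqP; split=> // O [].
  exact: compact0.
have -> : affine_union (s :: ss) = basic s `|` affine_union ss.
  apply/seteqP; split=> O.
    by move=> [s']; rewrite inE => /orP[/eqP->|ss'] b; [left|right; exists s'].
  by move=> [b|[s' ss' b]]; [exists s => //; rewrite mem_head|exists s' => //; rewrite inE ss' orbT].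
by apply: compactU => //; apply: compact_basic.
Qed.

Lemma compact_open_affine_union (A : set (PKk E)) : open A -> compact A ->
  exists ss, A = affine_union ss.
Proof.
move=> oA cA.
pose D := [set s : seq uK | (forall x, x \in s -> homogeneous uhom x) /\ basic s `<=` A].
pose DD := [set ss : seq (seq uK) | forall s, s \in ss -> D s].
apply: contrapT => nA.
have FF : ProperFilter (filter_from DD (fun ss => A `\` affine_union ss)).
  apply: filter_from_proper.
    apply: filter_from_filter; first by exists [::].
    move=> ss ss' Ds Ds'; exists (ss ++ ss').
      by move=> s; rewrite mem_cat => /orP[/Ds|/Ds'].
    move=> O [AO nO]; split; split=> // -[s sss sO]; apply: nO; exists s => //;
      by rewrite mem_cat sss ?orbT.
  move=> ss Ds; apply/set0P/negP => /eqP e; apply: nA; exists ss.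
  apply/seteqP; split=> O; last by move=> [s /Ds[_ sA]] /sA.
  by move=> AO; apply: contrapT => nO; have : set0 O by rewrite -e.
have [|O [AO clO]] := cA _ FF; first by exists [::] => // O [].
have [s [sO sA]] := open_basis oA AO.
have Ds : D s by split=> //; apply: basic_homg sO.
have [||O' [[AO' nO'] sO']] := clO (A `\` affine_union [:: s]) (basic s).
- by exists [:: s] => // s'; rewrite mem_seq1 => /eqP->.
- by apply: open_nbhs_nbhs; split=> //; apply: open_basic; apply: basic_homg sO.
by apply: nO'; exists s; rewrite ?mem_head.
Qed.

(** The trivial valuation ring K. *)
Definition generic : PKk E :=
  PKk_of (hval_homgT uhomP) (fun x kx => proj1 kx).

Lemma open_generic (A : set (PKk E)) : open A -> A !=set0 -> A generic.
Proof.
move=> oA [O AO]; apply: open_up oA AO _; rewrite hv_of => x [] //.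
Qed.

Lemma compact_open_capI (A B : set (PKk E)) : open A -> compact A -> open B -> compact B ->
  compact (A `&` B).
Proof.
move=> oA cA oB cB; have [ss eA] := compact_open_affine_union oA cA.
have [ss' eB] := compact_open_affine_union oB cB.
have -> : A `&` B = affine_union [seq s ++ s' | s <- ss, s' <- ss'].
  rewrite eA eB; apply/seteqP; split=> O.
    move=> [[s sss sO] [s' sss' s'O]]; exists (s ++ s'); first exact: allpairs_f.
    by move=> x; rewrite mem_cat => /orP[/sO|/s'O].
  move=> [_ /allpairsP[[s s'] /= [sss sss' ->]] bO]; split; [exists s|exists s'] => // x xs;
    by apply: bO; rewrite mem_cat xs ?orbT.
exact: compact_affine_union.
Qed.

(** * Quasi-compact open subsets as objects *)

Section OpenSubspace.
Variable U : set (PKk E).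
Hypotheses (oU : open U) (cU : compact U) (neU : U !=set0).

Let incl : set_type U -> PKk E := set_val.

Lemma incl_open (B : set (set_type U)) : open B -> open (incl @` B).
Proof.
move=> [W oW <-]; have -> : incl @` (incl @^-1` W) = W `&` U.
  apply/seteqP; split=> O.
    by move=> [x Wx <-]; split=> //; apply: set_valP.
  by move=> [WO UO]; exists (exist _ O (mem_set UO)).
exact: openI.
Qed.

Lemma incl_compact (B : set (set_type U)) : compact (incl @` B) -> compact B.
Proof.
move=> cB F FF FB; have [|p [[x Bx xp] clp]] := cB (incl @ F) _.
  by rewrite /nbhs /= ; apply: filterS FB => x Bx; exists x.
exists x; split=> // A N FA; rewrite nbhsE => -[N' [[W oW eW] N'x] N'N].
have FA' : (incl @ F) (incl @` A).
  by rewrite /nbhs /=; apply: filterS FA => y Ay; exists y.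
have Wp : nbhs p W.
  by rewrite -xp; apply: open_nbhs_nbhs; split=> //; move: N'x; rewrite -eW.
have [q [[y Ay <-] Wy]] := clp _ _ FA' Wp.
by exists y; split=> //; apply: N'N; rewrite -eW.
Qed.

Lemma incl_local_homeo : local_homeo incl.
Proof.
split; first exact: initial_continuous.
move=> x; exists setT; split; [exact: openT|by []|by move=> a b _ _; apply: val_inj|].
by move=> V oV _; apply: incl_open.
Qed.

Lemma incl_nonempty : exists x : set_type U, True.
Proof. by have [O UO] := neU; exists (exist _ O (mem_set UO)). Qed.

(** Two nonempty open subsets always share the generic point. *)
Lemma incl_connected : connected [set: set_type U].
Proof.
move=> B [b Bb] [C oC BC] [D cD BD]; rewrite setTI in BC; rewrite setTI in BD.
have oB : open B by rewrite BC.
have oB' : open (~` B) by rewrite BD; apply: closed_openC.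
apply/seteqP; split=> // x _; apply: contrapT => nBx.
have [y By ey] : (incl @` B) generic.
  by apply: open_generic; [apply: incl_open|exists (incl b); exists b].
have [z Bz ez] : (incl @` (~` B)) generic.
  by apply: open_generic; [apply: incl_open|exists (incl x); exists x].
by apply: Bz; have -> : z = y by apply: val_inj; apply: etrans ez (esym ey).
Qed.

Lemma incl_compactT : compact [set: set_type U].
Proof.
apply: incl_compact; rewrite (_ : incl @` setT = U) //.
apply/seteqP; split=> O; first by move=> [x _ <-]; apply: set_valP.
by move=> UO; exists (exist _ O (mem_set UO)).
Qed.

Lemma incl_qs : quasi_separated (set_type U).
Proof.
have ci : continuous incl by apply: initial_continuous.
have cim B : compact B -> compact (incl @` B).
  by apply: continuous_compact; apply: continuous_subspaceT.
move=> A B oA cA oB cB; apply: incl_compact.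
have -> : incl @` (A `&` B) = (incl @` A) `&` (incl @` B).
  apply/seteqP; split=> O; first by move=> [x [Ax Bx] <-]; split; exists x.
  move=> [[x Ax <-] [y By e]]; exists x => //; split=> //.
  by rewrite (_ : x = y) //; apply: val_inj.
by apply: compact_open_capI; [apply: incl_open|apply: cim|apply: incl_open|apply: cim].
Qed.

(** The source of the objects over P_{K_H/k} that witness strictness. *)
Definition open_object : birobj G :=
  BirObj incl_local_homeo incl_nonempty incl_connected incl_compactT incl_qs.

End OpenSubspace.

End PKk.

Arguments hk {G} E.
Arguments generic {G} E.

(** * Restriction of valuation rings and descent of affinity *)

Section Embedding.
Variables (G : zmodType) (E F : gext G) (phi : {rmorphism gK E -> gK F}).
Hypotheses (emb : gemb phi) (base : phi @` gbase E `<=` gbase F).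

Let phiU : uK E -> uK F := phi.

Lemma emb_inj x y : phi x = phi y -> x = y. Proof. by case: emb => h _; apply: h. Qed.

Lemma emb_hom g x : uhom g x -> uhom g (phiU x).
Proof. by case: emb => _; apply. Qed.

Lemma emb_homg x : homogeneous (@uhom _ E) x -> homogeneous (@uhom _ F) (phiU x).
Proof. by move=> [g hx]; exists g; apply: emb_hom. Qed.

Lemma emb_eq0 (x : uK E) : phiU x = 0 -> x = 0.
Proof. by move=> e; apply: emb_inj; rewrite [LHS]e; symmetry; apply: (rmorph0 phi). Qed.

Lemma emb_neq0 (x : uK E) : x != 0 -> phiU x != 0.
Proof. by move=> x0; apply/eqP => /emb_eq0 e; rewrite e eqxx in x0. Qed.

Lemma emb_inv (x : uK E) : homogeneous (@uhom _ E) x -> x != 0 -> phiU x^-1 = (phiU x)^-1.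
Proof.
move=> hx x0; apply: (mul1_inv (x := phi x)).
have e : x * x^-1 = 1 by rewrite mulrV // (homgU (uhomP E) hx).
by transitivity (phi (x * x^-1)); [symmetry; apply: (rmorphM phi) | rewrite e; apply: (rmorph1 phi)].
Qed.

Lemma emb_homI g x : homogeneous (@uhom _ E) x -> uhom g (phiU x) -> uhom g x.
Proof.
move=> [h hx] hpx; have [->|x0] := eqVneq x 0; first exact: (hom0 (uhomP E)).
by rewrite -(homI (uhomP F) (emb_hom hx) hpx (emb_neq0 x0)).
Qed.

Lemma emb_hadd A : A `<=` homogeneous (@uhom _ E) -> hadd (@uhom _ E) A ->
  hadd (@uhom _ F) (phiU @` A).
Proof.
move=> Ah [A0 AB]; split; first by exists 0 => //; apply: (rmorph0 phi).
move=> g _ _ [x Ax <-] [y Ay <-] hx hy; exists (x - y); last exact: (rmorphB phi).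
by apply: AB (emb_homI (Ah _ Ax) hx) (emb_homI (Ah _ Ay) hy).
Qed.

Lemma emb_hring A : hring (@uhom _ E) A -> hring (@uhom _ F) (phiU @` A).
Proof.
move=> [Ah A1 AM AA]; split.
- by move=> _ [x Ax <-]; apply/emb_homg/Ah.
- by exists 1 => //; apply: (rmorph1 phi).
- by move=> _ _ [x Ax <-] [y Ay <-]; exists (x * y); [apply: AM | apply: (rmorphM phi)].
- exact: emb_hadd.
Qed.

Lemma emb_hideal A J : hring (@uhom _ E) A -> hideal (@uhom _ E) A J ->
  hideal (@uhom _ F) (phiU @` A) (phiU @` J).
Proof.
move=> [Ah A1 AM AA] [JA JJ JM J1]; split.
- by move=> _ [x Jx <-]; exists x => //; apply: JA.
- by apply: emb_hadd => //; apply: subset_trans Ah.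
- by move=> _ _ [x Ax <-] [y Jy <-]; exists (x * y); [apply: JM | apply: (rmorphM phi)].
- move=> [x Jx e]; apply: J1; rewrite (_ : 1 = x) //; apply: emb_inj.
  by rewrite [RHS]e; apply: (rmorph1 phi).
Qed.

Lemma emb_hfield A : hfield (@uhom _ E) A -> hfield (@uhom _ F) (phiU @` A).
Proof.
move=> [AA AV]; split; first exact: emb_hring.
move=> _ [x Ax <-] x0; have hx : homogeneous (@uhom _ E) x by case: AA => h _ _ _; apply: h.
have x0' : x != 0 by apply: contraNneq x0 => ->; apply/eqP/(rmorph0 phi).
by exists x^-1; [apply: AV | apply: emb_inv].
Qed.

Lemma hval_maxid_hideal V : hval (@uhom _ E) V -> hideal (@uhom _ E) V (maxid V).
Proof.
move=> VV; split.
- by move=> x [].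
- exact: (maxid_hadd (uhomP E) VV).
- by move=> b x Vb mx; apply: (maxidM (uhomP E) VV).
- exact: (maxid_not1 VV).
Qed.

Lemma emb_hk : phiU @` hk E `<=` hk F.
Proof.
move=> _ [x [hx kx] <-]; split; first exact: emb_homg.
by apply: base; exists x.
Qed.

Lemma hval_pull V : hval (@uhom _ F) V ->
  hval (@uhom _ E) [set x | homogeneous (@uhom _ E) x /\ V (phiU x)].
Proof.
move=> VV; have [[Vh V1 VM [V0 VB]] Vv] := VV.
have [Eh E1 EM [E0 EB]] := homg_hring (uhomP E); split; first split.
- by move=> x [].
- by split=> //; rewrite [phiU 1](rmorph1 phi).
- by move=> x y [hx Vx] [hy Vy]; split; [apply: EM | rewrite [phiU _](rmorphM phi); apply: VM].
- split; first by split=> //; rewrite [phiU 0](rmorph0 phi).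
  move=> g x y [hx Vx] [hy Vy] gx gy; split; first exact: EB gx gy.
  by rewrite [phiU _](rmorphB phi); apply: VB (emb_hom gx) (emb_hom gy).
move=> x hx x0; have [Vx|Vx] := Vv _ (emb_homg hx) (emb_neq0 x0); first by left.
by right; split; [apply: (homgV (uhomP E)) | rewrite emb_inv].
Qed.

(** Restriction of a valuation ring of L that is only required to contain the image of k. The
    descent argument uses such rings, which need not contain l. *)
Definition pull V (VV : hval (@uhom _ F) V) (kV : phiU @` hk E `<=` V) : PKk E :=
  PKk_of (hval_pull VV) (fun x kx => conj (proj1 kx) (kV _ (ex_intro2 _ _ x kx erefl))).

Lemma hv_pull V VV kV x : homogeneous (@uhom _ E) x -> hv (@pull V VV kV) x <-> V (phiU x).
Proof. by move=> hx; rewrite hv_of; split=> [[]|]. Qed.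

Definition psi (O : PKk F) : PKk E :=
  pull (hv_hval O) (subset_trans emb_hk (@hk_hv G F O)).

Lemma hv_psi O x : homogeneous (@uhom _ E) x -> hv (psi O) x <-> hv O (phiU x).
Proof. exact: hv_pull. Qed.

Lemma sval_psi O : sval (psi O) = phi @^-1` sval O.
Proof.
have [rO gO _ _] := svalP O; have [rP gP _ _] := svalP (psi O).
apply: (hpart_inj (gfieldP (gtop E)) rP gP).
- case: rO => O1 OB OM; split; first by rewrite /preimage /= rmorph1.
  + by move=> x y Ox Oy; rewrite /preimage /= rmorphB; apply: OB.
  + by move=> x y Ox Oy; rewrite /preimage /= rmorphM; apply: OM.
- move=> x s c Ox [us hc e] g gs; apply: (gO (phi x) s (phi \o c)) => //.
  split=> //; first by move=> h; apply: (proj2 emb).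
  by rewrite e rmorph_sum.
apply/seteqP; split=> x [hx] H; split=> //.
  have Ox : hv (psi O) x by split.
  by have [_ h] := (hv_psi O hx).1 Ox.
have Ox : hv O (phiU x) by split=> //; apply: emb_homg.
by have [_ h] := (hv_psi O hx).2 Ox.
Qed.

Lemma psiP (O : PKk F) (O' : PKk E) : sval O' = phi @^-1` sval O <-> psi O = O'.
Proof. by rewrite -sval_psi; split=> [e|->//]; apply: PKk_eq. Qed.

Lemma psi_continuous : continuous psi.
Proof.
apply/continuousP => A oA; rewrite openE => O AO.
have [s [sO sA]] := open_basis oA AO; have hs := basic_homg sO.
rewrite /interior /= nbhsE; exists (basic (map phiU s)); last first.
  move=> O' bO'; apply: sA => x xs; apply/hv_psi; first exact: hs.
  by apply: bO'; apply: map_f.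
split; first by apply: open_basic => _ /mapP[x xs ->]; apply/emb_homg/hs.
by move=> _ /mapP[x xs ->]; apply/hv_psi; [apply: hs|apply: sO].
Qed.

(** An [x] outside [O] has its inverse in the maximal ideal of [O], hence of [V], which keeps the
    image of [x] out of [V]. *)
Lemma psi_of O V (VV : hval (@uhom _ F) V) kV : phiU @` hv O `<=` V ->
  phiU @` maxid (hv O) `<=` maxid V -> psi (PKk_of VV kV) = O.
Proof.
move=> OV mV; apply: hv_inj => x; have OO := hv_hval O; split=> [Px|Ox].
  have hx : homogeneous (@uhom _ E) x by case: Px.
  have Vx : V (phiU x) by rewrite -(hv_of VV kV); apply/hv_psi.
  apply: contrapT => nO; have [x0 mx] := notin_hval OO hx nO.
  have [_ ] : maxid V (phiU x^-1) by apply: mV; exists x^-1.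
  rewrite emb_inv // invrK (homg_neq0V (uhomP F) (emb_homg hx) (emb_neq0 x0)).
  by move=> /(_ isT).
have hx : homogeneous (@uhom _ E) x by case: Ox.
by apply/hv_psi => //; rewrite hv_of; apply: OV; exists x.
Qed.

(** When the base fields coincide, Chevalley's theorem lifts every point; this is the situation of K
    over K_H. *)
Lemma psi_surjective : hk F `<=` phiU @` hk E -> forall O, exists O', psi O' = O.
Proof.
move=> kF O; have OO := hv_hval O; have OR := hval_hring OO.
have [V [VV OV mV]] := chevalley (uhomP F) (emb_hring OR) (emb_hideal OR (hval_maxid_hideal OO)).
have kV : hk F `<=` V.
  by move=> x /kF [y ky <-]; apply: OV; exists y => //; apply: (hk_hv O).
by exists (PKk_of VV kV); apply: psi_of.
Qed.

(** Zorn's lemma: the intersection of a chain of valuation rings is one, for if it missed both [x]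
    and [x^-1], the smaller of two members of the chain would miss both. *)
Lemma minimal_point : exists O : PKk E, forall O' : PKk E, hv O' `<=` hv O -> hv O `<=` hv O'.
Proof.
pose r (O O' : PKk E) := `[< hv O' `<=` hv O >].
have [||C tC|O mO] := @ZL_preorder (PKk E) (generic E) r.
- by move=> O; apply/asboolP.
- by move=> O1 O2 O3 /asboolP h1 /asboolP h2; apply/asboolP; apply: subset_trans h1.
- have [[O0 CO0]|nC] := pselect (exists O, C O); last first.
    by exists (generic E) => O CO; case: nC; exists O.
  pose V := [set x | forall O, C O -> hv O x].
  have VV : hval (@uhom _ E) V.
    split; first split.
    - by move=> x /(_ _ CO0)[].
    - by move=> O _; case: (hv_hval O) => [[]].
    - by move=> x y Vx Vy O CO; apply: (hvalM (hv_hval O)); [apply: Vx|apply: Vy].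
    - split; first by move=> O _; apply: (hval0 (hv_hval O)).
      move=> g x y Vx Vy hx hy O CO; case: (hv_hval O) => [[_ _ _ [_ h]] _].
      by apply: h hx hy; [apply: Vx|apply: Vy].
    move=> x hx x0; apply: contrapT => /not_orP[/existsNP[O1 /not_implyP[C1 n1]]].
    move=> /existsNP[O2 /not_implyP[C2 n2]].
    have [//|i1] := proj2 (hv_hval O1) x hx x0.
    have [i2|//] := proj2 (hv_hval O2) x hx x0.
    by have [/asboolP h|/asboolP h] := tC _ _ C1 C2; [apply: n1; apply: h|apply: n2; apply: h].
  exists (PKk_of VV (fun x kx O _ => @hk_hv G E O x kx)) => O CO; apply/asboolP; rewrite hv_of.
  by move=> x; apply.
by exists O => O' h; have /asboolP := mO O' (asboolT h).
Qed.

End Embedding.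

(** * Separatedness and affinity along a proper morphism *)

Section ProperMorphism.
Variables (G : zmodType) (Y X : birobj G).
Variables (phi : {rmorphism bK X -> bK Y}) (f : bsp Y -> bsp X).
Hypothesis pf : proper_mor phi f.

Local Notation E := (bext X).
Local Notation F := (bext Y).

Let emb : @gemb G E F phi. Proof. by case: pf => [[]]. Qed.
Let base : phi @` gbase E `<=` gbase F. Proof. by case: pf => [[]]. Qed.
Let phiU : uK E -> uK F := phi.
Let psi := @psi G E F phi emb base.

Lemma proper_map y : psi (bmap Y y) = bmap X (f y).
Proof. by apply/psiP; case: pf => [[_ _ _ h] _ _]; apply: h. Qed.

Lemma proper_surjective O : exists O', psi O' = O.
Proof.
by case: pf => _ _ h; have [O' e] := h O; exists O'; apply/psiP.
Qed.

Lemma proper_fiber x O : psi O = bmap X x -> exists y, [/\ f y = x, bmap Y y = O &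
  forall y', f y' = x -> bmap Y y' = O -> y' = y].
Proof.
move=> /psiP e; case: pf => _ h _; have [y [[e1 e2] u]] := h x O e.
by exists y; split=> // y' e1' e2'; symmetry; apply: u.
Qed.

Lemma proper_range O : range (bmap Y) O <-> range (bmap X) (psi O).
Proof.
split=> [[y _ <-]|[x _ /esym/proper_fiber[y [_ e _]]]].
  by exists (f y) => //; rewrite proper_map.
by exists y.
Qed.

Lemma separated_proper : bir_separated Y <-> bir_separated X.
Proof.
split=> inj a b e.
  have [O eO] := proper_surjective (bmap X a).
  have [y [<- ey _]] := proper_fiber eO; have [y' [<- ey' _]] := proper_fiber (etrans eO e).
  by congr f; apply: inj; rewrite ey ey'.
have eab : f a = f b by apply: inj; rewrite -!proper_map e.
have [y [_ _ u]] := proper_fiber (proper_map a).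
by rewrite (u a) // (u b).
Qed.

Lemma range_open (Z : birobj G) : open (range (bmap Z)).
Proof.
rewrite openE => _ [z _ <-]; have [_ lh] := bmap_lh Z.
have [U [oU Uz _ h]] := lh z; rewrite /interior nbhsE.
exists (bmap Z @` U); last by move=> _ [w _ <-]; exists w.
by split; [apply: h | exists z].
Qed.

Lemma range_compact (Z : birobj G) : compact (range (bmap Z)).
Proof.
apply: continuous_compact; last exact: bsp_qc.
by apply: continuous_subspaceT; case: (bmap_lh Z).
Qed.

Lemma range_nonempty (Z : birobj G) : range (bmap Z) !=set0.
Proof. by have [z _] := bsp_ne Z; exists (bmap Z z); exists z. Qed.

(** The input of [descent] inside L: the images of K and k, and the valuation rings of L whose
    restriction to K lies in the image of X. *)
Let K : set (uK F) := phiU @` homogeneous (@uhom _ E).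
Let k : set (uK F) := phiU @` hk E.
Let U : set (set (uK F)) := [set V | exists2 O, range (bmap X) O &
  forall x, homogeneous (@uhom _ E) x -> (hv O x <-> V (phiU x))].

Let kF : k `<=` hk F. Proof. exact: emb_hk. Qed.

Lemma range_upclosed : upclosed (@uhom _ F) k K U.
Proof.
move=> V W VV WW kV kW [O RO OV] VW; exists (pull emb WW kW); last by move=> x hx; apply: hv_pull.
apply: open_up (range_open X) RO _ => x Ox; have hx : homogeneous (@uhom _ E) x by case: Ox.
by apply/hv_pull => //; apply: VW; split; [apply/OV | exists x].
Qed.

Lemma range_hv O : U (hv O) <-> range (bmap Y) O.
Proof.
rewrite proper_range; split=> [[O' RO' e]|R].
  rewrite (_ : psi O = O') //; apply: hv_inj => x.
  split=> H; have hx : homogeneous (@uhom _ E) x by [case: H].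
    by apply/(e _ hx)/(hv_psi emb base).
  by apply/(hv_psi emb base _ hx)/(e _ hx).
by exists (psi O) => // x hx; apply: hv_psi.
Qed.

(** The image of X is a finite union of affine sets. On each of them, [h] belongs to every valuation
    ring containing l and the finitely many defining elements, and [hval_fip] selects a finite part
    of l. *)
Lemma finite_generators h : (forall O, range (bmap Y) O -> hv O h) ->
  exists s : seq (uK F), (forall x, x \in s -> hk F x) /\
    forall V, hval (@uhom _ F) V -> gen (@uhom _ F) k s `<=` V -> U V -> V h.
Proof.
move=> Hh; have [ss eX] := compact_open_affine_union (range_open X) (@range_compact X).
(* Members of the family contain only [k]; containing l is among the conditions from which the
   finite selection is made. *)
pose T := {V : set (uK F) | hval (@uhom _ F) V /\ k `<=` V}.
have hT (t : T) : hval (@uhom _ F) (sval t) by case: (svalP t).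
have one s : s \in ss -> exists l : seq (uK F), (forall x, x \in l -> hk F x) /\
    forall V, hval (@uhom _ F) V -> k `<=` V -> (forall x, x \in l -> V x) ->
      (forall x, x \in s -> homogeneous (@uhom _ E) x /\ V (phiU x)) -> V h.
  move=> sss; have [hs|nhs] := pselect (forall x, x \in s -> homogeneous (@uhom _ E) x); last first.
    by exists [::]; split=> // V _ _ _ H; case: nhs => x /H[].
  have [|l [lS lh]] := @hval_fip G (uK F) (@uhom _ F) T (fun t => sval t) hT
    [set x | hk F x \/ x \in map phiU s] h.
    move=> V VV SV _; have kV : hk F `<=` V by move=> x kx; apply: SV; left.
    rewrite -(hv_of VV kV); apply: Hh; apply/proper_range; rewrite eX.
    exists s => // x xs; apply/(hv_psi emb base); first exact: hs.
    by rewrite hv_of; apply: SV; right; apply: map_f.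
  exists [seq x <- l | `[< hk F x >]]; split.
    by move=> x; rewrite mem_filter => /andP[/asboolP].
  move=> V VV kV lV sV; apply: (lh (exist _ V (conj VV kV))) => x xl /=.
  have [kx|/mapP[y ys ->]] := lS x xl; last by case: (sV y ys).
  by apply: lV; rewrite mem_filter xl andbT; apply/asboolP.
have {one} [l [lk lh]] : exists l : seq (uK F), (forall x, x \in l -> hk F x) /\
    forall s, s \in ss -> forall V, hval (@uhom _ F) V -> k `<=` V -> (forall x, x \in l -> V x) ->
      (forall x, x \in s -> homogeneous (@uhom _ E) x /\ V (phiU x)) -> V h.
  elim: ss one {eX} => [|s ss IH] one; first by exists [::].
  have [s' ss'|l [lk lh]] := IH; first by apply: one; rewrite inE ss' orbT.
  have [l' [lk' lh']] := one s (mem_head _ _); exists (l' ++ l); split.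
    by move=> x; rewrite mem_cat => /orP[/lk'|/lk].
  move=> s' s'ss V VV kV lV; move: s'ss; rewrite inE => /orP[/eqP->|s'ss].
    by apply: lh' => // x xl; apply: lV; rewrite mem_cat xl.
  by apply: lh => // x xl; apply: lV; rewrite mem_cat xl orbT.
exists l; split=> // V VV gV [O RO OV]; move: RO; rewrite eX => -[s sss sO].
apply: (lh s) => //.
- by apply: subset_trans gV; apply: gen_sub.
- by move=> x xl; apply: gV; apply: gen_mem xl.
- move=> x xs; have hx := basic_homg sO xs; split=> //.
  by apply/OV => //; apply: sO.
Qed.

Lemma affine_proper : bir_affine Y <-> bir_affine X.
Proof.
split=> -[inj [s [hs eR]]]; (split; first by apply/separated_proper); last first.
  exists (map phi s); split.
    by move=> _ /mapP[x xs ->]; apply: (emb_homg emb); apply: hs.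
  apply/seteqP; split=> O.
    move=> /proper_range; rewrite eR => H _ /mapP[x xs ->].
    by have := H x xs; rewrite sval_psi.
  by move=> H; apply/proper_range; rewrite eR => x xs; rewrite sval_psi; apply: H; apply: map_f.
have UT : U (homogeneous (@uhom _ F)).
  exists (generic E); first exact: open_generic (range_open X) (range_nonempty X).
  move=> x hx; rewrite hv_of; split=> // _; exact: (emb_homg emb).
(* Surjectivity of psi lifts a minimal ring to one that contains l, which serves as [V0] in
   [descent]. *)
have [O0 mO0] := @minimal_point G E; have [O1 e1] := proper_surjective O0.
have fk : hfield (@uhom _ F) k by apply: emb_hfield; [exact: emb|exact: hk_hfield].
have fK : hfield (@uhom _ F) K.
  by apply: emb_hfield; [exact: emb|apply: (homg_hfield (uhomP E))].
have kK : k `<=` K by move=> _ [x [hx _] <-]; exists x.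
have mV : minval (@uhom _ F) k K (hv O1).
  move=> W WW kW WO1 y [Oy [x hx e]]; subst y.
  apply/(hv_pull emb WW kW hx); apply: mO0; last by rewrite -e1; apply/hv_psi.
  move=> z Oz; have hz : homogeneous (@uhom _ E) z by case: Oz.
  by rewrite -e1; apply/hv_psi => //; apply: WO1; apply/(hv_pull emb WW kW hz).
have one h : h \in s -> exists C : seq (uK E), [/\ forall x, x \in C -> homogeneous (@uhom _ E) x,
    forall O, range (bmap X) O -> forall x, x \in C -> hv O x &
    forall O : PKk F, (forall x, x \in C -> hv (psi O) x) -> hv O h].
  move=> hin.
  have Hh O : range (bmap Y) O -> hv O h.
    by rewrite eR => /(_ h hin) Oh; split=> //; apply: hs.
  have [l [lk lh]] := finite_generators Hh.
  have gF : gen (@uhom _ F) k l `<=` hk F.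
    by move=> x; apply=> //; apply: hk_hfield.
  have [||C [C1 C2 C3]] := @descent G (uK F) (@uhom _ F) (uhomP F) l k K U (hv O1) h _
      fk fK kK (hv_hval O1) _ mV range_upclosed UT (hs h hin) lh.
  - by move=> y /lk[].
  - by apply: subset_trans gF _; apply: hk_hv.
  have {C1} [D [hD eD]] : exists D : seq (uK E), (forall x, x \in D -> homogeneous (@uhom _ E) x)
      /\ map phiU D = C.
    elim: C C1 {C2 C3} => [|c C IH] C1; first by exists [::].
    have [x xC|D [hD eD]] := IH; first by apply: C1; rewrite inE xC orbT.
    have [d hd ed] := C1 c (mem_head _ _); exists (d :: D); split; last by rewrite /= ed eD.
    by move=> x; rewrite inE => /orP[/eqP->|/hD].
  exists D; split=> //.
  - move=> O RO x xD; have [O' eO'] := proper_surjective O.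
    rewrite -eO'; apply/(hv_psi emb base); first exact: hD.
    apply: (C2 _ (hv_hval O')); last by rewrite -eD; apply: map_f.
      by apply: subset_trans kF _; apply: hk_hv.
    by apply/range_hv/proper_range; rewrite eO'.
  - move=> O DO; apply: (C3 _ (hv_hval O)).
      by apply: subset_trans gF _; apply: hk_hv.
    by move=> c; rewrite -eD => /mapP[x xD ->]; apply/(hv_psi emb base); [apply: hD|apply: DO].
have [C [hC C1 C2]] : exists C : seq (uK E), [/\ forall x, x \in C -> homogeneous (@uhom _ E) x,
    forall O, range (bmap X) O -> forall x, x \in C -> hv O x &
    forall O : PKk F, (forall x, x \in C -> hv (psi O) x) -> forall h, h \in s -> hv O h].
  elim: s one {hs eR} => [|h s IH] one; first by exists [::].
  have [h' h's|C [hC C1 C2]] := IH; first by apply: one; rewrite inE h's orbT.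
  have [C' [hC' C1' C2']] := one h (mem_head _ _); exists (C' ++ C); split.
  - by move=> x; rewrite mem_cat => /orP[/hC'|/hC].
  - by move=> O RO x; rewrite mem_cat => /orP[/(C1' _ RO)|/(C1 _ RO)].
  - move=> O CO h'; rewrite inE => /orP[/eqP->|].
      by apply: C2' => x xC; apply: CO; rewrite mem_cat xC.
    by apply: C2 => x xC; apply: CO; rewrite mem_cat xC orbT.
exists C; split=> //; apply/seteqP; split=> O.
  by move=> RO x xC; have [] := C1 O RO x xC.
move=> CO; have [O' eO'] := proper_surjective O; rewrite -eO'; apply/proper_range.
rewrite eR => h hin; have [] // := C2 O' _ h hin.
by move=> x xC; rewrite eO'; split; [apply: hC | apply: CO].
Qed.

End ProperMorphism.

(** * Descent of strictness *)

Section Subring.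
Variables (R : comNzRingType) (S : {pred R}) (SS : subring_closed S).

Definition subr_type := {x : R | x \in S}.
HB.instance Definition _ := SubChoice.on subr_type.

Definition subr_ring : comNzRingType := HB.pack_for comNzRingType subr_type
  (GRing.SubChoice_isSubComNzRing.Build R S subr_type SS).

Definition subr_val (x : subr_ring) : R := sval x.

Fact subr_val_zmod : zmod_morphism subr_val. Proof. by move=> x y. Qed.

Fact subr_val_monoid : monoid_morphism subr_val. Proof. by split. Qed.

Definition subr_incl : {rmorphism subr_ring -> R} :=
  HB.pack_for {rmorphism subr_ring -> R} subr_val
    (GRing.isZmodMorphism.Build subr_ring R subr_val subr_val_zmod)
    (GRing.isMonoidMorphism.Build subr_ring R subr_val subr_val_monoid).

Lemma subr_incl_inj : injective subr_incl.
Proof. by move=> x y e; apply: val_inj. Qed.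

Lemma subr_inclP x : x \in S -> exists y, subr_incl y = x.
Proof. by move=> Sx; exists (exist _ x Sx). Qed.

Lemma subr_incl_in y : subr_incl y \in S.
Proof. exact: svalP y. Qed.

End Subring.

(** * The graded field K_H *)

Section DegreePart.
Variables (G : zmodType) (E : gext G) (H : set G).
Hypothesis sH : subgroup_set H.

Let K := gK E.
Let hom : G -> set K := ghom (gtop E).
Let gf : graded_field hom := gfieldP (gtop E).
Local Notation KH := (gpart hom H).

Lemma subgroupN a : H a -> H (- a).
Proof. by case: sH => H0 HB Ha; rewrite -sub0r; apply: HB. Qed.

Lemma gpart_homog g x : hom g x -> H g -> KH x.
Proof.
move=> hx Hg; exists [:: g], (single g x); split; first exact: is_decomp_single.
by move=> h; rewrite mem_seq1 => /eqP->.
Qed.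

Lemma gpart_degree g x : KH x -> hom g x -> x != 0 -> H g.
Proof.
move=> [s [c [dx Hs]]] hx x0; have := is_decomp_uniq gf dx (is_decomp_single gf hx) g.
rewrite mem_seq1 eqxx /single eqxx; case: ifP => [gs _|_ e]; first exact: Hs.
by rewrite -e eqxx in x0.
Qed.

Lemma gpart_decomp x s c : KH x -> is_decomp hom x s c -> forall g, g \in s -> KH (c g).
Proof.
move=> [s' [c' [dx' Hs']]] dx g gs; have := is_decomp_uniq gf dx dx' g; rewrite gs => e.
have [_ hc _] := dx; have [c0|c0] := eqVneq (c g) 0.
  by rewrite c0; apply: (gpart_homog (g := 0)); [case: gf => [[]]|case: sH].
apply: gpart_homog (hc g) _; apply: Hs'.
by move: e; case: ifP => // _ e; rewrite e eqxx in c0.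
Qed.

Definition KHpred : {pred K} := fun x => `[< KH x >].

Definition Hdeg : set (classical_unitRing K) := [set x | exists2 g, H g & hom g x].

(** As a span of elements with degrees in [H], K_H is visibly closed under differences and
    products. *)
Lemma gpart_span : KH = hspan Hdeg.
Proof.
apply/seteqP; split=> x.
  move=> [s [c [[us hc e] Hs]]]; exists (map c s); split; last by rewrite big_map.
  by move=> _ /mapP[g gs ->]; exists g; [apply: Hs | apply: hc].
have gr := graded_field_units gf; have [H0 HB] := sH.
pose V : set (classical_unitRing K) := [set y | KH y /\ homogeneous hom y].
have V0 : forall y, Hdeg y -> V y.
  by move=> y [g Hg hy]; split; [apply: gpart_homog hy Hg | exists g].
have hV : V `<=` homogeneous hom by move=> y [].
have aV : hadd (hom : G -> set (classical_unitRing K)) V.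
  have h0 : hom 0 0 by case: gf => [[]].
  split; first by split; [apply: gpart_homog h0 H0 | exists 0].
  move=> g y z [Ky _] [Kz _] hy hz.
  have hyz : hom g (y - z) by case: gf => [[_ h _ _] _]; apply: h.
  split; last by exists g.
  have [y0|y0] := eqVneq y 0.
    have [z0|z0] := eqVneq z 0; first by rewrite y0 z0 subr0; apply: gpart_homog h0 H0.
    exact: gpart_homog hyz (gpart_degree Kz hz z0).
  exact: gpart_homog hyz (gpart_degree Ky hy y0).
move=> [l [lH e]].
have Vx : hspan V x by exists l; split=> // y /lH /V0.
have [s [c [dx Vc]]] := hspan_decomp gf hV aV Vx.
(* A degree with zero component need not lie in [H], so it is removed from the support. *)
have [us hc xE] := dx; exists [seq g <- s | c g != 0], c; split; last first.
  move=> g; rewrite mem_filter => /andP[c0 _]; have [Kc _] := Vc g.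
  exact: gpart_degree Kc (hc g) c0.
split=> //; first exact: filter_uniq.
rewrite big_filter xE [LHS](bigID (fun g => c g != 0)) /= [X in _ + X]big1 ?addr0 //.
by move=> g /negPn/eqP.
Qed.

Lemma KH_subring : subring_closed KHpred.
Proof.
have gr := graded_field_units gf; have [H0 HB] := sH.
have h1 : hom 0 1 by case: gf => [[]].
have HN a b : Hdeg a -> Hdeg b -> Hdeg (a * b).
  move=> [g Hg ha] [h Hh hb]; exists (g + h); last by apply: (homM gr).
  by rewrite -[h]opprK; apply: HB => //; apply: subgroupN.
have HM a : Hdeg a -> Hdeg (- a) by move=> [g Hg ha]; exists g => //; apply: (homN gr).
split.
- by apply/asboolP; apply: gpart_homog h1 H0.
- move=> x y /asboolP; rewrite gpart_span => -[l [lV ->]] /asboolP; rewrite gpart_span => -[l' [lV' ->]].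
  apply/asboolP; rewrite gpart_span; exists (l ++ map -%R l').
  split; last by rewrite big_cat big_map /= sumrN.
  by move=> z; rewrite mem_cat => /orP[/lV //|/mapP[z' /lV' Vz' ->]]; apply: HM.
- move=> x y /asboolP; rewrite gpart_span => -[l [lV ->]] /asboolP; rewrite gpart_span => -[l' [lV' ->]].
  apply/asboolP; rewrite gpart_span; exists [seq a * b | a <- l, b <- l'].
  split; last by rewrite big_allpairs_dep mulr_suml; apply: eq_bigr => a _; rewrite mulr_sumr.
  by move=> z /allpairsP[[a b] /= [/lV Va /lV' Vb ->]]; apply: HN.
Qed.

Let RH := subr_ring KH_subring.
Let incl : {rmorphism RH -> K} := subr_incl KH_subring.
Let homH : G -> set RH := fun g x => hom g (incl x).

Lemma KH_decomp x s c : is_decomp homH x s c -> is_decomp hom (incl x) s (incl \o c).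
Proof. by move=> [us hc e]; split=> //; rewrite e rmorph_sum. Qed.

Lemma KH_incl_in (x : RH) : KH (incl x).
Proof. by have /asboolP := subr_incl_in x. Qed.

Lemma KH_inclP x : KH x -> exists y : RH, incl y = x.
Proof. by move=> Kx; apply: subr_inclP; apply/asboolP. Qed.

Lemma KH_graded_field : graded_field homH.
Proof.
have [[h0 hB h1 hM] [dec [ind inv]]] := gf.
split; [split|split; [|split]].
- by move=> g; rewrite /homH rmorph0.
- by move=> g x y hx hy; rewrite /homH rmorphB; apply: hB.
- by rewrite /homH rmorph1.
- by move=> g h x y hx hy; rewrite /homH rmorphM; apply: hM.
- move=> x; have Kx := KH_incl_in x.
  have [s [c dx]] := dec (incl x); have [us hc e] := dx.
  have /choice[c' Hc'] : forall g, exists y : RH, incl y = if g \in s then c g else 0.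
    move=> g; case: ifP => gs; first exact/KH_inclP/(gpart_decomp Kx dx).
    by exists 0; rewrite rmorph0.
  exists s, c'; split=> //; first by move=> g; rewrite /homH Hc'; case: ifP.
  apply: (subr_incl_inj (SS := KH_subring)); rewrite rmorph_sum e; apply: eq_big_seq => g gs.
  by rewrite [RHS]Hc' gs.
- move=> s c us hc e g gs; apply: (subr_incl_inj (SS := KH_subring)).
  have e' : \sum_(h <- s) incl (c h) = 0 by rewrite -rmorph_sum e rmorph0.
  by rewrite rmorph0; exact: (ind s (incl \o c) us hc e' g gs).
- move=> g x hx x0; have ix0 : incl x != 0.
    by apply: contraNneq x0 => e; apply/eqP/(subr_incl_inj (SS := KH_subring)); rewrite rmorph0.
  have [y hy yx] := graded_inverse gf hx ix0.
  have Kx := KH_incl_in x.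
  have [z ez] := KH_inclP (gpart_homog hy (subgroupN (gpart_degree Kx hx ix0))).
  exists z; apply: (subr_incl_inj (SS := KH_subring)).
  by rewrite rmorphM rmorph1 [X in _ * X]ez mulrC.
Qed.

Hypothesis kH : gbase E `<=` KH.

Lemma KH_base : graded_subfield homH (incl @^-1` gbase E).
Proof.
have [[k1 kB kM] gk ik] := gbaseP E; split.
- split; first by rewrite /preimage /mkset rmorph1.
  + by move=> x y kx ky; rewrite /preimage /mkset rmorphB; apply: kB.
  + by move=> x y kx ky; rewrite /preimage /mkset rmorphM; apply: kM.
- by move=> x s c kx dx g gs; apply: (gk (incl x) s (incl \o c)) => //; apply: KH_decomp.
- move=> x [g hx] x0 kx; have ix0 : incl x != 0.
    by apply: contraNneq x0 => e; apply/eqP/(subr_incl_inj (SS := KH_subring)); rewrite rmorph0.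
  have [|y ky xy] := ik (incl x) _ ix0 kx; first by exists g.
  have [z ez] := KH_inclP (kH ky); exists z; first by rewrite /preimage /mkset ez.
  by apply: (subr_incl_inj (SS := KH_subring)); rewrite rmorphM rmorph1 ez.
Qed.

Definition degree_part : gext G := GExt (gtop := GField KH_graded_field) KH_base.

Definition degree_incl : {rmorphism gK degree_part -> gK E} := incl.

Lemma degree_incl_emb : gemb degree_incl.
Proof. by split; [exact: subr_incl_inj | move=> g x]. Qed.

Lemma degree_incl_range : range degree_incl = KH.
Proof.
apply/seteqP; split=> x; first by move=> [y _ <-]; exact: KH_incl_in.
by move=> /KH_inclP[y e]; exists y.
Qed.

Lemma degree_incl_base : degree_incl @` gbase degree_part = gbase E.
Proof.
apply/seteqP; split=> x; first by move=> [y ky <-].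
move=> kx; have [y e] := KH_inclP (kH kx); exists y => //.
by suff : gbase E (incl y) by []; rewrite e.
Qed.

End DegreePart.

(** * Common extensions of valuation rings *)

Section Amalgam.
Variables (G : zmodType) (R : comUnitRingType) (hom : G -> set R).
Hypothesis gr : graded_units hom.

(** The relation [Q] on the factors lets one construction cover the composite ring A P and its ideal
    J P + A M. *)
Definition product_sums (Q : R -> R -> Prop) : set R :=
  [set x | exists d (l : seq (R * R)),
    (forall p, p \in l -> Q p.1 p.2 /\ hom d (p.1 * p.2)) /\ x = \sum_(p <- l) p.1 * p.2].

Lemma product_sums_hom d (l : seq (R * R)) :
  (forall p, p \in l -> hom d (p.1 * p.2)) -> hom d (\sum_(p <- l) p.1 * p.2).
Proof. by move=> hl; rewrite big_seq; apply: (hom_sum gr). Qed.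

Lemma product_sums_hadd Q : (forall a b, Q a b -> Q (- a) b) -> hadd hom (product_sums Q).
Proof.
move=> QN; have neg d (l : seq (R * R)) :
    (forall p, p \in l -> Q p.1 p.2 /\ hom d (p.1 * p.2)) ->
    (forall p, p \in [seq (- p.1, p.2) | p <- l] -> Q p.1 p.2 /\ hom d (p.1 * p.2)) /\
    - (\sum_(p <- l) p.1 * p.2) = \sum_(p <- [seq (- p.1, p.2) | p <- l]) p.1 * p.2.
  move=> Ql; split; last by rewrite big_map -sumrN; apply: eq_bigr => p _; rewrite mulNr.
  move=> _ /mapP[p pl ->] /=; have [Qp hp_] := Ql p pl.
  by split; [apply: QN | rewrite mulNr; apply: (homN gr)].
split; first by exists 0, [::]; rewrite big_nil.
move=> g _ _ [d [l [Ql ->]]] [d' [l' [Ql' ->]]] hx hy.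
have [x0|x0] := eqVneq (\sum_(p <- l) p.1 * p.2) 0.
  by rewrite x0 sub0r; exists d', [seq (- p.1, p.2) | p <- l']; apply: neg.
have [y0|y0] := eqVneq (\sum_(p <- l') p.1 * p.2) 0.
  by rewrite y0 subr0; exists d, l.
have dg : d = g by apply: (homI gr _ hx x0); apply: product_sums_hom => p /Ql[].
have dg' : d' = g by apply: (homI gr _ hy y0); apply: product_sums_hom => p /Ql'[].
subst d d'; have [Ql'' e] := neg _ _ Ql'.
exists g, (l ++ [seq (- p.1, p.2) | p <- l']); rewrite big_cat -e; split=> // p.
by rewrite mem_cat => /orP[/Ql|/Ql''].
Qed.

Lemma product_sums_mul Q Q' Q'' :
  (forall a b a' b', Q a b -> Q' a' b' -> Q'' (a * a') (b * b')) ->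
  forall x y, product_sums Q x -> product_sums Q' y -> product_sums Q'' (x * y).
Proof.
move=> QM _ _ [d [l [Ql ->]]] [d' [l' [Ql' ->]]].
exists (d + d'), [seq (p.1 * p'.1, p.2 * p'.2) | p <- l, p' <- l']; split.
  move=> _ /allpairsP[[p p'] /= [pl pl' ->]] /=.
  have [Qp hp_] := Ql p pl; have [Qp' hp'] := Ql' p' pl'; split; first exact: QM.
  by rewrite mulrACA; apply: (homM gr).
rewrite big_allpairs_dep mulr_suml; apply: eq_bigr => p _; rewrite mulr_sumr.
by apply: eq_bigr => p' _; rewrite mulrACA.
Qed.

Lemma product_sums1 (Q : R -> R -> Prop) a b d : Q a b -> hom d (a * b) -> product_sums Q (a * b).
Proof.
move=> Qab hab; exists d, [:: (a, b)]; rewrite big_seq1; split=> // p.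
by rewrite mem_seq1 => /eqP->.
Qed.

(* [A] and [P] generate a ring in which [J] and [M] span a proper ideal, because
   a relation in degree 0 only involves elements of [A] with degree in [H]. *)
Lemma amalgam (H : set G) (A J P M : set R) : subgroup_set H -> hring hom A ->
  hadd hom J -> J `<=` A -> (forall a b, A a -> J b -> J (a * b)) ->
  hring hom P -> hideal hom P M ->
  (forall g x, P x -> hom g x -> x != 0 -> H g) ->
  (forall g x, A x -> hom g x -> H g -> P x) ->
  (forall g x, J x -> hom g x -> H g -> M x) ->
  exists V, [/\ hval hom V, A `<=` V, P `<=` V, J `<=` maxid V & M `<=` maxid V].
Proof.
move=> sH AA JJ JA AJ PP MM PH AP JM; have [Ah A1 AM AB] := AA; have [Ph P1 PM PB] := PP.
have [MP MA PMM M1] := MM.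
pose B := product_sums (fun a b => A a /\ P b).
pose I := product_sums (fun a b => (J a /\ P b) \/ (A a /\ M b)).
have AN a : A a -> A (- a).
  by move=> Aa; have [g ha] := Ah a Aa; apply: (haddN gr AB Aa ha).
have JN a : J a -> J (- a).
  by move=> Ja; have [g ha] := Ah a (JA _ Ja); apply: (haddN gr JJ Ja ha).
have BB : hring hom B.
  split.
  - move=> _ [d [l [Ql ->]]]; exists d; apply: product_sums_hom => p /Ql[] //.
  - by rewrite -[1]mulr1; apply: (product_sums1 (d := 0)); rewrite ?mulr1 //; apply: (hom1 gr).
  - by apply: product_sums_mul => a b a' b' [? ?] [? ?]; split; [apply: AM | apply: PM].
  - by apply: product_sums_hadd => a b [Aa Pb]; split=> //; apply: AN.
have II : hideal hom B I.
  split.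
  - move=> _ [d [l [Ql ->]]]; exists d, l; split=> // p /Ql[[[Jp Pp]|[Ap Mp]] hp_]; split=> //.
      by split=> //; apply: JA.
    by split=> //; apply: MP.
  - by apply: product_sums_hadd => a b [[Ja Pb]|[Aa Mb]]; [left|right]; split=> //; [apply: JN|apply: AN].
  - apply: product_sums_mul => a b a' b' [Aa Pb] [[Ja Pb']|[Aa' Mb]]; [left|right]; split.
    + exact: AJ.
    + exact: PM.
    + exact: AM.
    + exact: PMM.
  - move=> [d [l [Ql e]]]; apply: M1; rewrite e big_seq.
    have d0 : d = 0.
      apply: (homI gr (x := 1)); rewrite ?oner_neq0 //; last exact: (hom1 gr).
      by rewrite e; apply: product_sums_hom => p /Ql[].
    subst d; apply: (hadd_sum gr (d := 0) MA) => p /Ql[Qp hp_]; split=> //.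
    have [p0|p0] := eqVneq (p.1 * p.2) 0; first by rewrite p0; case: MA.
    have Ap : A p.1 by case: Qp => [[/JA]|[]].
    have Pp : P p.2 by case: Qp => [[]|[_ /MP]].
    have [h h2] := Ph _ Pp; have [g h1] := Ah _ Ap.
    (* The nonzero [p.2] has degree in [H], and the opposite degree of [p.1] is then in [H] too, so
       [AP] or [JM] moves the product into [M]. *)
    have n2 : p.2 != 0 by apply: contraNneq p0 => ->; rewrite mulr0.
    have gh : g + h = 0 by apply: (homI gr _ hp_ p0); apply: (homM gr).
    have Hg : H g.
      have -> : g = - h by apply/eqP; rewrite -addr_eq0 gh.
      by apply: subgroupN; [|apply: PH Pp h2 n2].
    case: Qp => [[Jp _]|[_ Mp]].
      by rewrite mulrC; apply: PMM => //; apply: JM h1 Hg.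
    by apply: PMM => //; apply: AP h1 Hg.
have [V [VV BV IV]] := chevalley gr BB II; exists V; split=> //.
- move=> a Aa; have [g ha] := Ah a Aa; apply: BV; rewrite -[a]mulr1.
  by apply: (product_sums1 (d := g)); rewrite ?mulr1.
- move=> b Pb; have [g hb] := Ph b Pb; apply: BV; rewrite -[b]mul1r.
  by apply: (product_sums1 (d := g)); rewrite ?mul1r.
- move=> a Ja; have [g ha] := Ah a (JA _ Ja); apply: IV; rewrite -[a]mulr1.
  by apply: (product_sums1 (d := g)); rewrite ?mulr1 //; left.
- move=> b Mb; have [g hb] := Ph b (MP _ Mb); apply: IV; rewrite -[b]mul1r.
  by apply: (product_sums1 (d := g)); rewrite ?mul1r //; right.
Qed.

End Amalgam.

Lemma degs_in_base (G : zmodType) (E : gext G) (H : set G) : degs_in E H ->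
  gbase E `<=` gpart (ghom (gtop E)) H.
Proof.
move=> dH x kx; have [_ [dec _]] := gfieldP (gtop E); have [s [c dx]] := dec x.
have [_ gk _] := gbaseP E; have [us hc e] := dx.
exists [seq g <- s | c g != 0], c; split.
  split=> //; first exact: filter_uniq.
  rewrite big_filter e [LHS](bigID (fun g => c g != 0)) /= [X in _ + X]big1 ?addr0 //.
  by move=> g /negPn/eqP.
by move=> g; rewrite mem_filter => /andP[c0 gs]; apply: (dH g (c g)) => //; exact: (gk x s c kx dx g gs).
Qed.

(** * Saturated open sets and strictness *)

(** Being the full preimage of the image in P_{K_H/k}, expressed through traces on K_H. *)
Definition saturated (G : zmodType) (E : gext G) (H : set G) (A : set (PKk E)) : Prop :=
  forall O1 O2 : PKk E,
    (forall x, gpart (ghom (gtop E)) H x -> (sval O1 x <-> sval O2 x)) -> A O1 -> A O2.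

Section Saturation.
Variables (G : zmodType) (E : gext G) (H : set G).
Hypotheses (sH : subgroup_set H) (kH : gbase E `<=` gpart (ghom (gtop E)) H).

Definition deg_ext : gext G := degree_part sH kH.

Definition deg_psi : PKk E -> PKk deg_ext :=
  @psi G deg_ext E (degree_incl sH kH) (degree_incl_emb sH kH)
    (eq_ind_r (fun A => A `<=` gbase E) (@subset_refl _ _) (degree_incl_base sH kH)).

Let incl : uK deg_ext -> uK E := degree_incl sH kH.
Let emb : @gemb G deg_ext E (degree_incl sH kH) := degree_incl_emb sH kH.

Lemma hv_deg_psi O y : homogeneous (@uhom _ deg_ext) y ->
  hv (deg_psi O) y <-> hv O (incl y).
Proof. exact: hv_psi. Qed.

Lemma deg_incl_inP g x : uhom g x -> H g -> exists y, uhom g y /\ incl y = x.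
Proof.
move=> hx Hg; have : gpart (ghom (gtop E)) H x by apply: gpart_homog hx Hg.
rewrite -(degree_incl_range sH kH) => -[y _ e]; exists y; split=> //.
by suff : uhom g (incl y) by []; rewrite [incl y]e.
Qed.

Lemma deg_incl_degree g y : uhom g (incl y) -> incl y != 0 -> H g.
Proof.
move=> hy y0; apply: (gpart_degree _ hy y0).
by rewrite -(degree_incl_range sH kH); exists y.
Qed.

Lemma deg_psiP O1 O2 : deg_psi O1 = deg_psi O2 <->
  (forall x, gpart (ghom (gtop E)) H x -> (sval O1 x <-> sval O2 x)).
Proof.
split=> [e x|e].
  rewrite -(degree_incl_range sH kH) => -[y _ <-].
  have := congr1 sval e; rewrite !sval_psi => e'.
  by have := congr1 (fun A : set _ => A y) e'; rewrite /preimage /mkset => ->.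
apply: PKk_eq; rewrite !sval_psi; apply/seteqP; split=> y Oy; apply/e => //;
  by rewrite -(degree_incl_range sH kH); exists y.
Qed.

Lemma deg_psi_surjective O : exists O', deg_psi O' = O.
Proof.
apply: psi_surjective => x [hx kx].
move: kx; rewrite -(degree_incl_base sH kH) => -[y ky e]; exists y => //.
split=> //; have [g hg] := hx; exists g.
by suff : uhom g (incl y) by []; rewrite [incl y]e.
Qed.

(** [V] has to contain [O0] but to dominate [w], so [amalgam] is applied with the zero ideal on the
    side of [O0]. *)
Lemma deg_psi_generize O0 (w : PKk deg_ext) : hv (deg_psi O0) `<=` hv w ->
  exists O, hv O0 `<=` hv O /\ deg_psi O = w.
Proof.
move=> Ow; have ww := hv_hval w; have wR := hval_hring ww.
have [||||||V [VV OV PV _ MV]] := amalgam (uhomP E) (A := hv O0) (J := [set 0])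
  (P := incl @` hv w) (M := incl @` maxid (hv w)) sH (hval_hring (hv_hval O0))
  (_ : hadd _ _) _ _ (emb_hring emb wR) (emb_hideal emb wR (hval_maxid_hideal ww)) _ _ _.
- by split=> // g _ _ -> ->; rewrite subr0.
- by move=> _ ->; apply: (hval0 (hv_hval O0)).
- by move=> a _ _ ->; rewrite /= mulr0.
- by move=> g _ [y wy <-] hx x0; apply: deg_incl_degree hx x0.
- move=> g x Ox hx Hg; have [y [hy e]] := deg_incl_inP hx Hg; exists y => //.
  have hgy : homogeneous (@uhom _ deg_ext) y by exists g.
  by apply: Ow; apply/(hv_deg_psi _ hgy); rewrite e.
- by move=> g _ -> _ _; exists 0; [exact: (maxid0 ww)|exact: (rmorph0 (degree_incl sH kH))].
have kV : hk E `<=` V by apply: subset_trans OV; apply: hk_hv.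
by exists (PKk_of VV kV); split; [rewrite hv_of | apply: psi_of].
Qed.

(** If [O] contains [w], its restriction is a generization of [w], which lifts to a generization of
    [O0]; that lift is in [A], and so is [O] by saturation. By compactness, finitely many elements
    of [w] already force membership in [A], and they define a neighbourhood of [w] in the image. *)
Lemma open_saturated_image (A : set (PKk E)) : open A -> saturated H A ->
  open (deg_psi @` A).
Proof.
move=> oA sA; rewrite openE => _ [O0 AO0 <-]; set w := deg_psi O0.
have [|s [sS sA']] := @compactness G E (incl @` hv w) A oA.
  move=> O wO; have [|O1 [O01 e]] := @deg_psi_generize O0 (deg_psi O).
    move=> y wy; have hy : homogeneous (@uhom _ deg_ext) y by case: wy.
    by apply/(hv_deg_psi _ hy); apply: wO; exists y.
  by apply: (sA O1); [apply/deg_psiP | apply: open_up oA AO0 O01].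
have [t [tw et]] : exists t : seq (uK deg_ext), (forall y, y \in t -> hv w y) /\ map incl t = s.
  elim: s sS {sA'} => [|x s IH] sS; first by exists [::].
  have [y ys|t [tw et]] := IH; first by apply: sS; rewrite inE ys orbT.
  have [y wy ey] := sS x (mem_head _ _); exists (y :: t); split; last by rewrite /= ey et.
  by move=> z; rewrite inE => /orP[/eqP->|/tw].
have ht y : y \in t -> homogeneous (@uhom _ deg_ext) y by move=> /tw[].
rewrite /interior nbhsE; exists (basic t).
  by split; [apply: open_basic | exact: tw].
move=> w' tw'; have [O eO] := deg_psi_surjective w'; exists O => //.
apply: sA'; rewrite -et => _ /mapP[y yt ->].
by apply/(hv_deg_psi _ (ht y yt)); rewrite eO; apply: tw'.
Qed.

End Saturation.

Section Strict.
Variables (G : zmodType) (X : birobj G) (H : set G).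

Lemma Hstrict_saturated : Hstrict H X -> saturated H (range (bmap X)).
Proof.
move=> [Z [phi [f [[[_ _ _ compat] fib _] rphi _]]]] O1 O2 e [x _ ex]; subst O1.
have [|y [[_ ey] _]] := fib (f x) O2; last by exists y.
rewrite compat; apply/seteqP; split=> z Oz; apply/e => //; by rewrite -rphi; exists z.
Qed.

(** The required object is the image of X in P_{K_H/k}, which is open and quasi-compact. Saturation
    gives existence in the fibre condition and separatedness gives uniqueness. *)
Lemma saturated_Hstrict : subgroup_set H -> degs_in (bext X) H -> bir_separated X ->
  saturated H (range (bmap X)) -> Hstrict H X.
Proof.
move=> sH dH sep sat; set E := bext X.
have kH := degs_in_base dH.
pose W := deg_psi sH kH @` range (bmap X).
have oW : open W by apply: open_saturated_image => //; exact: range_open.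
have pc : continuous (deg_psi sH kH) by apply: psi_continuous.
have cW : compact W.
  apply: continuous_compact; last exact: range_compact.
  exact: continuous_subspaceT.
have nW : W !=set0.
  by have [O RO] := range_nonempty X; exists (deg_psi sH kH O); exists O.
have inW x : W (deg_psi sH kH (bmap X x)) by exists (bmap X x) => //; exists x.
pose f x : set_type W := exist _ (deg_psi sH kH (bmap X x)) (mem_set (inW x)).
exists (open_object oW cW nW), (degree_incl sH kH), f; split; [split|exact: degree_incl_range|exact: degree_incl_base].
- split.
  + exact: degree_incl_emb.
  + by rewrite degree_incl_base.
  + apply/continuousP => _ [A oA <-].
    have bc : continuous (bmap X) by case: (bmap_lh X).
    have /continuousP bc' := bc; have /continuousP pc' := pc.
    exact: (bc' _ (pc' _ oA)).
  + by move=> x; apply: sval_psi.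
- move=> w O ew.
  have {}ew : deg_psi sH kH O = set_val w by apply/psiP.
  have [O0 [x0 _ e0] e1] : W (set_val w) by apply: set_valP.
  have [x _ ex] : range (bmap X) O.
    by apply: (sat (bmap X x0)); [apply/(deg_psiP sH kH); rewrite ew e0 | exists x0].
  exists x; split; last by move=> x' [_ e]; apply: sep; rewrite ex.
  by split=> //; apply: val_inj; rewrite /= ex.
- move=> O; have [O' <-] := @deg_psi_surjective G E H sH kH O; exists O'.
  exact: sval_psi.
Qed.

End Strict.

(** * Saturation along a proper morphism *)

Section SaturationDescent.
Variables (G : zmodType) (Y X : birobj G).
Variables (phi : {rmorphism bK X -> bK Y}) (f : bsp Y -> bsp X).
Hypothesis pf : proper_mor phi f.
Variable H : set G.
Hypotheses (sH : subgroup_set H) (dY : degs_in (bext Y) H).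

Local Notation E := (bext X).
Local Notation F := (bext Y).
Let emb : @gemb G E F phi. Proof. by case: pf => [[]]. Qed.
Let base : phi @` gbase E `<=` gbase F. Proof. by case: pf => [[]]. Qed.
Let phiU : uK E -> uK F := phi.

Lemma degs_in_proper : degs_in E H.
Proof.
move=> g x kx hx x0; apply: (dY (g := g) (x := phi x)).
- by apply: base; exists x.
- by case: emb => _; apply.
- exact: (emb_neq0 emb).
Qed.

Lemma emb_gpart x : gpart (ghom (gtop E)) H x -> gpart (ghom (gtop F)) H (phi x).
Proof.
move=> [s [c [[us hc e] Hs]]]; exists s, (phi \o c); split=> //; split=> //.
  by move=> g; apply: (proj2 emb).
by rewrite e rmorph_sum.
Qed.

Lemma saturated_up : saturated H (range (bmap X)) -> saturated H (range (bmap Y)).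
Proof.
move=> sX O1 O2 e /(proper_range pf) R; apply/(proper_range pf).
by apply: sX R => x Hx; rewrite !sval_psi; apply/e/emb_gpart.
Qed.

(** Lift [O1] to [O1'] and let [w] be its trace on L_H. A common extension of [O2] and [w] has the
    same trace on L_H as [O1'], so it is in the image of Y, and it restricts to [O2]. *)
Lemma saturated_down : saturated H (range (bmap Y)) -> saturated H (range (bmap X)).
Proof.
move=> sY O1 O2 e R; have [O1' e1] := proper_surjective pf O1.
have R' : range (bmap Y) O1' by apply/(proper_range pf); rewrite e1.
have kH := degs_in_base dY; pose p := deg_psi sH kH; pose w := p O1'.
pose incl : uK (deg_ext sH kH) -> uK F := degree_incl sH kH.
have embH : @gemb G (deg_ext sH kH) F (degree_incl sH kH) := degree_incl_emb sH kH.
have ww := hv_hval w; have wR := hval_hring ww.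
have OO := hv_hval O2; have OR := hval_hring OO.
(* On elements of K with degree in [H] the rings [w] and [O2] agree: [w] is the trace of [O1'],
   which restricts to [O1], and [O1] agrees with [O2] on K_H. *)
have key g x : homogeneous (@uhom _ E) x -> uhom g (phiU x) -> H g ->
    exists y, [/\ uhom g y, incl y = phiU x & hv w y <-> hv O2 x].
  move=> hx hpx Hg; have [y [hy ey]] := deg_incl_inP sH kH hpx Hg; exists y; split=> //.
  have hgy : homogeneous (@uhom _ (deg_ext sH kH)) y by exists g.
  have gx : uhom g x by apply: (emb_homI emb).
  have wy : hv w y <-> hv O1' (phiU x) by rewrite -ey; apply: hv_deg_psi.
  apply: (iff_trans wy).
  apply: (iff_trans (iff_sym (hv_psi emb base O1' hx))).
  have -> : psi emb base O1' = O1 by rewrite -e1; apply/psiP; rewrite sval_psi.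
  have Kx : gpart (ghom (gtop E)) H x by apply: gpart_homog gx Hg.
  by split=> -[_ Ox]; split=> //; apply/(e x Kx).
have [||||||V [VV AV PV JV MV]] := amalgam (uhomP F) (A := phiU @` hv O2)
  (J := phiU @` maxid (hv O2)) (P := incl @` hv w) (M := incl @` maxid (hv w)) sH
  (emb_hring emb OR) _ _ _ (emb_hring embH wR) (emb_hideal embH wR (hval_maxid_hideal ww)) _ _ _.
- by case: (emb_hideal emb OR (hval_maxid_hideal OO)).
- by case: (emb_hideal emb OR (hval_maxid_hideal OO)).
- by case: (emb_hideal emb OR (hval_maxid_hideal OO)).
- by move=> g _ [y wy <-] hx x0; apply: deg_incl_degree hx x0.
- move=> g _ [x Ox <-] hx Hg; have [y [hy ey wy]] := key g x (proj1 Ox) hx Hg.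
  by exists y => //; apply/wy.
- move=> g _ [x mx <-] hx Hg; have hgx := proj1 (proj1 mx).
  have [y [hy ey wy]] := key g x hgx hx Hg.
  exists y => //; split; first by apply/wy; case: mx.
  (* Nonunits correspond as well: if [y^-1] were in [w], then [key] for [x^-1] in degree [- g] would
     put [x^-1] into [O2]. *)
  move=> y0 wyi; have x0 : x != 0.
    apply: contraNneq y0 => x0; apply/eqP/(emb_eq0 embH); apply: etrans ey _.
    by rewrite x0; apply: (rmorph0 phi).
  have hgy : homogeneous (@uhom _ (deg_ext sH kH)) y by exists g.
  case: mx => _ /(_ x0); apply.
  have hxi := homgV (uhomP E) hgx x0.
  have exi : phiU x^-1 = (phiU x)^-1 by apply: (emb_inv phi).
  have hpi : uhom (- g) (phiU x^-1).
    by rewrite exi; apply: (homV (uhomP F) hx); apply: (emb_neq0 emb).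
  have [y' [hy' ey' <-]] := key _ _ hxi hpi (subgroupN sH Hg).
  rewrite (_ : y' = y^-1) //; apply: (emb_inj embH); apply: etrans ey' _.
  by rewrite exi -ey; symmetry; apply: (emb_inv (degree_incl sH kH)).
have kV : hk F `<=` V.
  move=> x [hx kx]; apply: PV; move: kx.
  rewrite -(degree_incl_base sH kH) => -[y ky ey]; exists y => //; apply: hk_hv; split=> //.
  by have [g hg] := hx; exists g; suff : uhom g (incl y) by []; rewrite [incl y]ey.
have eO2 : psi emb base (PKk_of VV kV) = O2 by apply: psi_of.
have ew : p (PKk_of VV kV) = w by apply: psi_of.
have RV : range (bmap Y) (PKk_of VV kV).
  by apply: sY R'; apply: (deg_psiP sH kH _ _).1; symmetry; apply: ew.
have transport O3 : sval O3 = sval O2 -> range (bmap X) O3 -> range (bmap X) O2.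
  by move=> /PKk_eq->.
by apply: (transport _ _ ((proper_range pf _).1 RV)); rewrite -eO2 !sval_psi.
Qed.

End SaturationDescent.

Theorem theorem8p1 (G : zmodType) (Y X : birobj G)
    (phi : {rmorphism bK X -> bK Y}) (f : bsp Y -> bsp X) :
  proper_mor phi f ->
  [/\ bir_separated Y <-> bir_separated X,
      bir_affine Y <-> bir_affine X &
      forall H : set G, subgroup_set H -> degs_in (bext Y) H ->
        (bir_separated Y /\ Hstrict H Y) <-> (bir_separated X /\ Hstrict H X)].
Proof.
move=> pf; split; [exact: separated_proper pf|exact: affine_proper pf|].
move=> H sH dY; have dX := degs_in_proper pf dY.
split=> -[sep /Hstrict_saturated sat]; (split; first by apply/(separated_proper pf)).
  apply: saturated_Hstrict => //; first by apply/(separated_proper pf).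
  exact: (saturated_down pf sH dY).
apply: saturated_Hstrict => //; first by apply/(separated_proper pf).
exact: (saturated_up pf).
Qed.
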